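(* Fix $1<p\le r<\infty$. Let $(A_n)_{n\in\mathbb N}$ be a sequence of symmetric random matrices satisfying assumptions (i)--(iv) of the context, with associated $\mu_n$, $\sigma_n^2(i,j)$ and $\bar\sigma_n$, and define $\bar A_n:=n^{-(\frac1p-\frac1r)}A_n$. Assume also that $\liminf_{n\to\infty}\bar\sigma_n>0$. Then, as $n\to\infty$, $$\frac{n}{\sqrt{2\sum_{i<j}\sigma_n^2(i,j)}}\big(\|\bar A_n\|_{r\to p}-\alpha_n(p,r)\big)\xrightarrow{d}Z\sim\mathrm{Normal}(0,2),$$ where $$\alpha_n(p,r)=(n-1)\mu_n+\Big(p-1+\frac1{r-1}\Big)\frac{\sum_{i<j}\sigma_n^2(i,j)}{n^2\mu_n}.$$
   Context: For an $n\times n$ matrix $A$ and $r,p\ge1$, $\|A\|_{r\to p}:=\sup_{x\in\mathbb R^n:\|x\|_r\le1}\|Ax\|_p$, where $\|x\|_q=(\sum_i|x_i|^q)^{1/q}$. $\mathrm{Normal}(m,s^2)$ is the normal law with mean $m$ and variance $s^2$; $\xrightarrow{d}$ is convergence in distribution. $f(n)=\omega(g(n))$ means $f(n)/g(n)\to\infty$. Assumptions on the matrices. For each $n\ge1$, $A_n=(a^n_{ij})_{i,j=1}^n$ is a symmetric random matrix such that: (i) $(a^n_{ij})_{1\le i<j\le n}$ are independent random variables, $a^n_{ij}$ having a distribution $F^n_{ij}$ supported on $[0,\infty)$ with mean $\mu_n$ and variance $\sigma_n^2(i,j)$; and $a^n_{ii}=0$ for all $i\in[n]=\{1,\dots,n\}$;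 (ii) there exist a sequence $(\bar\sigma_n)_{n\in\mathbb N}\subset(0,\infty)$ and constants $c_*,c^*\in(0,\infty)$ such that $$c_*\le\liminf_{n\to\infty}\min_{1\le i<j\le n}\frac{\sigma_n(i,j)}{\bar\sigma_n}\le\limsup_{n\to\infty}\max_{1\le i<j\le n}\frac{\sigma_n(i,j)}{\bar\sigma_n}\le c^*;$$ (iii) $\mu_n=O(1)$, $\mu_n=\omega\big(\frac{\log^{2/3}n}{n^{1/3}}\big)$, $\bar\sigma_n\ge n^{-\frac12+c_0}$ for some constant $c_0>0$, and $\frac{\bar\sigma_n^2}{\mu_n}=O(1)$; (iv) there exists $c>0$ (independent of $n$) such that $\max_{1\le i<j\le n}\mathbb E\big[|a^n_{ij}-\mu_n|^k\big]\le\frac{k!}{2}c^{k-2}\bar\sigma_n^2$ for all $k\ge3$. *)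

(* Defs.v *)
From HB Require Import structures.
From mathcomp Require Import all_boot all_order all_algebra.
From mathcomp Require Import all_classical all_reals all_analysis.

Set Implicit Arguments.
Unset Strict Implicit.
Unset Printing Implicit Defensive.

Import Order.TTheory GRing.Theory Num.Theory.
Import numFieldNormedType.Exports.

Local Open Scope classical_set_scope.
Local Open Scope ring_scope.

Definition vec_norm (R : realType) (n : nat) (q : R) (x : 'cV[R]_n) : R :=
  (\sum_(i < n) `|x i 0| `^ q) `^ q^-1.

(* The set is nonempty and bounded for all r, p >= 1, so the supremum may be
   taken in R. *)
Definition opnorm (R : realType) (n : nat) (r p : R) (A : 'M[R]_n) : R :=
  sup [set vec_norm p (A *m x) | x in [set x : 'cV[R]_n | vec_norm r x <= 1]].

(* Mutual independence of the subfamily of X indexed by D. *)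
Definition mutually_independent (d : measure_display) (T : measurableType d)
    (R : realType) (P : probability T R) (I : finType) (D : pred I)
    (X : I -> {RV P >-> R}) : Prop :=
  forall (J : {set I}) (B : I -> set R),
    (forall i, i \in J -> D i) ->
    (forall i, i \in J -> measurable (B i)) ->
    P [set w | forall i, i \in J -> B i (X i w)] =
    (\prod_(i in J) P (X i @^-1` B i))%E.

(* The X n may live on different probability spaces; their measurability is part
   of the definition, so that only probabilities of events are involved. *)
Definition cvg_in_distribution (R : realType) (d : nat -> measure_display)
    (T : forall n, measurableType (d n)) (P : forall n, probability (T n) R)
    (X : forall n, T n -> R)
    (Q : probability (measurableTypeR R) R) : Prop :=
  (forall n, measurable_fun [set: T n] (X n)) /\
  forall x : R, {for x, continuous (fun y : R => Q [set` `]-oo, y]])} ->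
    P n (X n @^-1` [set` `]-oo, x]]) @[n --> \oo] --> Q [set` `]-oo, x]].

(* Here s n i j stands for sigma_n(i,j) and sbar n for \bar\sigma_n. *)
Section assumptions.
Context (R : realType) (d : nat -> measure_display)
  (T : forall n, measurableType (d n)) (P : forall n, probability (T n) R)
  (a : forall n, 'I_n -> 'I_n -> {RV P n >-> R})
  (mu : nat -> R) (s : forall n, 'I_n -> 'I_n -> R) (sbar : nat -> R).

Definition assumption_i : Prop := forall n : nat, (1 <= n)%N ->
  [/\ forall (i j : 'I_n) w, a i j w = a j i w,
      forall (i : 'I_n) w, a i i w = 0,
      mutually_independent (fun e : 'I_n * 'I_n => (e.1 < e.2)%N)
        (fun e => a e.1 e.2) &
      forall i j : 'I_n, (i < j)%N ->
        [/\ distribution (P n) (a i j) `[0, +oo[ = 1%E,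
            ('E_(P n)[a i j] = (mu n)%:E)%E,
            0 <= s i j &
            ('V_(P n)[a i j] = (s i j ^+ 2)%:E)%E]].

(* The minimum and maximum over i < j range over a nonempty set when n >= 2;
   their values at n = 0, 1 do not affect the limits. *)
Definition assumption_ii : Prop :=
  (forall n, 0 < sbar n) /\
  exists c1 c2 : R, [/\ 0 < c1, 0 < c2,
    (c1%:E <= limn_einf (fun n : nat =>
       \big[Order.min/+oo]_(e : 'I_n * 'I_n | (e.1 < e.2)%N)
          (s e.1 e.2 / sbar n)%:E))%E &
    (limn_esup (fun n : nat =>
       \big[Order.max/-oo]_(e : 'I_n * 'I_n | (e.1 < e.2)%N)
          (s e.1 e.2 / sbar n)%:E) <= c2%:E)%E].

Definition assumption_iii : Prop :=
  [/\ mu =O_\oo (fun=> 1 : R),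
      (mu n / (ln n%:R `^ (2 / 3) / n%:R `^ (1 / 3))) @[n --> \oo] --> +oo,
      exists c0 : R, 0 < c0 /\
        forall n : nat, (1 <= n)%N -> n%:R `^ (- (1 / 2) + c0) <= sbar n &
      (fun n => sbar n ^+ 2 / mu n) =O_\oo (fun=> 1 : R)].

Definition assumption_iv : Prop := exists c : R, 0 < c /\
  forall (n : nat) (i j : 'I_n) (k : nat), (i < j)%N -> (3 <= k)%N ->
    ('E_(P n)[fun w => (`|a i j w - mu n| ^+ k)%R] <=
     (k`!%:R / 2 * c ^+ (k - 2) * sbar n ^+ 2)%:E)%E.

End assumptions.

Section centering.
Context (R : realType) (s : forall n, 'I_n -> 'I_n -> R).

Definition sum_var (n : nat) : R :=
  \sum_(i < n) \sum_(j < n | (i < j)%N) s i j ^+ 2.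

Definition alpha (mu : nat -> R) (p r : R) (n : nat) : R :=
  (n%:R - 1) * mu n
  + (p - 1 + (r - 1)^-1) * (sum_var n / (n%:R ^+ 2 * mu n)).

End centering.

(* Main.v *)
(** After rescaling, [n * ||Abar||] is the maximum of [y^T A x] over nonnegative vectors with
    [sum_i x_i^r = sum_i y_i^q = n], where [1/p + 1/q = 1]. The assumptions force [mu_n] and
    [sbar_n] to be of order one. Write [A = mu (J - I) + E], [x = 1 + xi] and [y = 1 + eta], and let
    [e] be the vector of row sums of [E]. The constraints make the rank-one part lose about
    [mu n (sum_i h_r(x_i) + sum_i h_q(y_i))], where the gap [h_a(x) = (x^a - 1)/a - (x - 1)] is
    quadratic near [1] (with coefficient [(a - 1)/2]), whereas the row sums gain
    [<e, xi> + <e, eta>]; the cross term [eta^T E xi] is negligible because the operator norm of [E]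
    is [o(n)]. Optimizing coordinatewise gives
    [n ||Abar|| = mu n (n - 1) + sum_ij E_ij + (1/(r-1) + 1/(q-1)) |e|^2/(2 mu n) + o(n)], and
    [1/(q-1) = p - 1]. By second and fourth moment bounds, [|e|^2] is
    [2 sum_(i<j) sigma_ij^2 + o(n^2)], so that [n (||Abar|| - alpha_n) = sum_ij E_ij + o(n)], and
    the sum of the independent entries obeys Lindeberg's central limit theorem. *)

(* Far from 1 the gap of exponent a grows like an a-th power, so for a < 2 it does not control the
   squared deviation, and the operator norm of E alone does not bound the cross term. This is where
   p <= r enters: it gives 1/r + 1/q <= 1, so one of r and q is at least 2. The vector with that
   exponent is measured in the Euclidean norm; the other is handled coordinatewise by Young's
   inequality, with a conjugate exponent that may exceed 2, and the excess is paid for by a bound L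
   on the squared entries of E. High moments make L a power of n as small as desired, so any power
   saving in the operator norm suffices: ||E||^4 <= sum_ij (E^2)_ij^2 has expectation O(n^3), whence
   ||E|| <= n^(7/8) with high probability. The estimates before the theorem concern a single n, with
   thresholds that depend only on p, r and the bounds for mu_n, the variances and the moments. Hence
   the probability spaces may change with n. *)
Require Import Defs.
From mathcomp Require Import all_boot all_order all_algebra ring lra.
From mathcomp Require Import all_classical all_reals all_analysis.
From mathcomp Require Import measurable_realfun.

Set Implicit Arguments.
Unset Strict Implicit.
Unset Printing Implicit Defensive.

Import Order.TTheory GRing.Theory Num.Theory.
Import numFieldNormedType.Exports.

Local Open Scope classical_set_scope.
Local Open Scope ring_scope.

(** * Power gaps *)

Section pointwise_derivatives.
Context {R : realType}.
Implicit Types (f g : R -> R) (x a b c : R).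

(** These rules are stated for explicit functions [fun t => ...], so that a derivative is assembled
    by a chain of [have] and its value adjusted at the end by [is_derive_eq]. *)
Lemma is_derive_cst_fun c x : is_derive x 1 (fun=> c) 0.
Proof. exact: is_derive_cst. Qed.

Lemma is_derive_add_fun f g x a b : is_derive x 1 f a -> is_derive x 1 g b ->
  is_derive x 1 (fun t => f t + g t) (a + b).
Proof. exact: is_deriveD. Qed.

Lemma is_derive_sub_fun f g x a b : is_derive x 1 f a -> is_derive x 1 g b ->
  is_derive x 1 (fun t => f t - g t) (a - b).
Proof. exact: is_deriveB. Qed.

Lemma is_derive_mul_fun f g x a b : is_derive x 1 f a -> is_derive x 1 g b ->
  is_derive x 1 (fun t => f t * g t) (f x * b + g x * a).
Proof. exact: is_deriveM. Qed.

Lemma is_derive_comp_fun f g x a b : is_derive (g x) 1 f a ->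
  is_derive x 1 g b -> is_derive x 1 (fun t => f (g t)) (a * b).
Proof. exact: is_derive1_comp. Qed.

Lemma is_derive_mull_fun c f x a : is_derive x 1 f a ->
  is_derive x 1 (fun t => c * f t) (c * a).
Proof.
move=> fa; have D := is_derive_mul_fun (is_derive_cst_fun c x) fa.
by apply: (is_derive_eq D); rewrite mulr0 addr0.
Qed.

Lemma is_derive_sqr_fun x : is_derive x 1 (fun t : R => t ^+ 2) (2 * x).
Proof.
have D := is_derive_id x (1 : R).
rewrite (_ : (fun _ => _) = (fun t => id t * id t)); last first.
  by apply/funext => t; rewrite expr2.
by apply: (is_derive_eq (is_derive_mul_fun D D)); rewrite /= mulr1; lra.
Qed.

End pointwise_derivatives.

Section mean_value.
Context {R : realType}.
Implicit Types f df : R -> R.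

(** The minimum and maximum of the endpoints let one statement serve both sides of the expansion
    point. *)
Lemma MVT_between f df (a b : R) :
  (forall x, Num.min a b <= x <= Num.max a b -> is_derive x 1 f (df x)) ->
  exists2 c, Num.min a b <= c <= Num.max a b & f b - f a = df c * (b - a).
Proof.
wlog : a b / a <= b => [H|ab].
  have /orP[/H//|ba] := le_total a b.
  rewrite minC maxC => /(H _ _ ba)[c cab e]; exists c => //.
  by rewrite -opprB e -mulrN opprB.
rewrite min_l// max_r// => dfE.
have [] := @MVT_segment R f df a b ab.
- by move=> x; rewrite in_itv/= => /andP[/ltW xa /ltW xb]; apply: dfE; rewrite xa.
- apply: derivable_within_continuous => x; rewrite in_itv/= => xab.
  exact: (@ex_derive _ _ _ _ _ _ _ (dfE x xab)).
- by move=> c; rewrite in_itv/= => cab e; exists c.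
Qed.

Lemma MVT_bound f df (a h M : R) :
  (forall x, `|x - a| <= `|h| -> is_derive x 1 f (df x)) ->
  (forall x, `|x - a| <= `|h| -> `|df x| <= M) ->
  `|f (a + h) - f a| <= M * `|h|.
Proof.
have inab x : Num.min a (a + h) <= x <= Num.max a (a + h) -> `|x - a| <= `|h|.
  rewrite ge_min le_max; have [h0|h0] := ger0P h; move=> /andP[/orP[] ? /orP[] ?];
  by rewrite ler_norml; lra.
move=> dfE dfM; have [x /inab xab|c /inab cab ->] := @MVT_between f df a (a + h).
  exact: dfE.
by rewrite addrAC subrr add0r normrM ler_wpM2r// dfM.
Qed.

End mean_value.

Section power_gap.
Context {R : realType}.
Implicit Types a b x t : R.

(* When [\sum_i x i `^ a = n], the gaps of the [x i] sum to [n - \sum_i x i]: they measure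
   what the rank-one part of the matrix loses when [x] leaves the constant vector. *)
Definition power_gap a x := (x `^ a - 1) / a - (x - 1).

Lemma power_gap1 a : power_gap a 1 = 0.
Proof. by rewrite /power_gap powR1 !subrr mul0r subr0. Qed.

(** This is Young's inequality for [x * (1 + t)] with the affine parts subtracted; the constants
    cancel because [a^-1 + b^-1 = 1]. It turns a linear gain in [x - 1] into a gap of [x] plus the
    conjugate gap of the slope. *)
Lemma power_gap_young a b x t : 1 < a -> a^-1 + b^-1 = 1 -> 0 <= x -> 0 <= 1 + t ->
  t * (x - 1) <= power_gap a x + power_gap b (1 + t).
Proof.
move=> a1 ab x0 t0; have a0 : 0 < a by lra.
have b0 : 0 < b.
  rewrite -invr_gt0; have : a^-1 < 1 by rewrite invf_lt1.
  by lra.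
have := conjugate_powR x0 t0 a0 b0 ab.
rewrite /power_gap !mulrBl !mul1r; lra.
Qed.

Lemma power_gap_ge0 a x : 1 < a -> 0 <= x -> 0 <= power_gap a x.
Proof.
move=> a1 x0; have a0 : 0 < a by lra.
have ab : a^-1 + (a / (a - 1))^-1 = 1.
  by rewrite invfM invrK; field; rewrite !gt_eqF//; lra.
have := power_gap_young a1 ab x0 (_ : 0 <= 1 + 0).
by rewrite addr0 power_gap1 addr0 mul0r; apply; rewrite ler01.
Qed.

Lemma near_power_le a (e : R) : 0 < e -> exists2 d : R, 0 < d <= 2^-1 &
  forall t, `|t| <= d -> (1 + t) `^ a <= 1 + e.
Proof.
move=> e0; have : {for 1, continuous (fun x : R => x `^ a)}.
  apply: differentiable_continuous; apply/derivable1_diffP.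
  by apply: derivable_powR; rewrite in_itv/= ltr01.
move=> /cvgrPdist_le/(_ e e0)/nbhs_ballP[d/= d0 H].
exists (Num.min (d / 2) 2^-1); first by rewrite lt_min ge_min lexx orbT andbT; lra.
move=> t; rewrite le_min => /andP[td _].
have : `|1 `^ a - (1 + t) `^ a| <= e.
  by apply: H; rewrite /ball/= opprD addrA subrr sub0r normrN; lra.
by rewrite powR1 ler_norml; lra.
Qed.

(** Second-order Taylor bound by two applications of the mean value theorem: the derivative of the
    gap at [1 + c] is [(1 + c)]^ (a - 1) - 1[, which is in turn](a - 1) * (1 + c') [^ (a - 2) * c].
    Continuity of the power at 1 keeps the last power below [1 + e]. *)
Lemma power_gap_near1 a (e : R) : 1 < a -> 0 < e -> exists2 d : R, 0 < d &
  forall t, `|t| <= d -> power_gap a (1 + t) <= (a - 1) / 2 * (1 + e) * t ^+ 2.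
Proof.
move=> a1 e0; have [d /andP[d0 d2] H] := near_power_le (a - 1 - 1) e0.
exists d => // t td.
pose k := (a - 1) * (1 + e).
have dgap (c : R) : `|c| <= d -> is_derive c 1
    (fun t : R => k / 2 * t ^+ 2 - power_gap a (1 + t))
    (k * c - ((1 + c) `^ (a - 1) - 1)).
  move=> cd; have c0 : 0 < 1 + c by move: cd; rewrite ler_norml; lra.
  have D1 : is_derive c 1 (fun t => 1 + t) (0 + 1).
    exact: is_derive_add_fun.
  have D2 := is_derive_comp_fun (is_derive1_powR a c0) D1.
  have D3 := is_derive_sub_fun D2 (is_derive_cst_fun 1 c).
  have D4 := is_derive_mul_fun D3 (is_derive_cst_fun a^-1 c).
  have D5 := is_derive_sub_fun D4 (is_derive_sub_fun D1 (is_derive_cst_fun 1 c)).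
  have D6 := is_derive_sub_fun (is_derive_mull_fun (k / 2) (is_derive_sqr_fun c)) D5.
  apply: (is_derive_eq D6); rewrite /k; field; rewrite gt_eqF//; lra.
(* An intermediate point has the sign of [t]; the product [c * t >= 0] decides the sign of the
   remainder whether [t] is positive or negative. *)
have between (c : R) : Num.min 0 t <= c <= Num.max 0 t -> `|c| <= d /\ 0 <= c * t.
  rewrite ge_min le_max; have [t0|t0] := ger0P t => /andP[/orP[] ? /orP[] ?];
  by move: td; rewrite !ler_norml; nra.
have [c /between[cd _]|c /between[cd ct]] := @MVT_between _
    (fun t : R => k / 2 * t ^+ 2 - power_gap a (1 + t))
    (fun c => k * c - ((1 + c) `^ (a - 1) - 1)) 0 t.
  exact: dgap.
rewrite addr0 power_gap1 expr0n/= mulr0 !subr0 => E.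
suff : 0 <= (k * c - ((1 + c) `^ (a - 1) - 1)) * t by rewrite -E /k; lra.
have [c' c'c] : exists2 c', `|c'| <= d &
    (1 + c) `^ (a - 1) - 1 = (a - 1) * (1 + c') `^ (a - 1 - 1) * c.
  have inc x : Num.min 1 (1 + c) <= x <= Num.max 1 (1 + c) -> `|x - 1| <= d.
    rewrite ge_min le_max => /andP[/orP[] ? /orP[] ?];
    by move: cd; rewrite !ler_norml; lra.
  have [x /inc|x /inc xd] := @MVT_between _ (fun x : R => x `^ (a - 1))
      (fun x => (a - 1) * x `^ (a - 1 - 1)) 1 (1 + c).
    rewrite ler_norml => xd.
    by apply: is_derive1_powR; lra.
  rewrite powR1 (_ : 1 + c - 1 = c); last by lra.
  by move=> ->; exists (x - 1) => //; congr (_ * _ `^ _ * _); lra.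
move=> ->; rewrite -mulrBl -mulrA mulr_ge0// /k -mulrBr mulr_ge0//; first lra.
by rewrite subr_ge0 H.
Qed.

(* [power_gap_young] at the point [1 + t] with a small multiple of [t] as slope converts the
   quadratic upper bound near [1] for the conjugate exponent into a lower bound. *)
Lemma power_gap_ge_sqr a : 1 < a -> exists2 k : R, 0 < k &
  forall t, -1 <= t <= 1 -> k * t ^+ 2 <= power_gap a (1 + t).
Proof.
move=> a1; pose b := a / (a - 1).
have ab : a^-1 + b^-1 = 1.
  by rewrite invfM invrK; field; rewrite !gt_eqF//; lra.
have b1 : 1 < b by rewrite ltr_pdivlMr ?mul1r; lra.
have [d d0 H] := power_gap_near1 b1 ltr01.
(* For the slope [c * t]: [c <= d] makes the quadratic bound for [b] applicable, [c <= 1] keeps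
   [1 + c * t] nonnegative, and [c * (b - 1) <= 1/2] makes the loss [(b - 1) * (c * t)^2] at most
   half of the gain [c * t^2]. *)
pose c := Num.min (Num.min d 1) (2^-1 / (b - 1)).
have c0 : 0 < c by rewrite !lt_min d0 ltr01 divr_gt0; lra.
have cd : c <= d by rewrite !ge_min lexx.
have c1 : c <= 1 by rewrite !ge_min lexx orbT.
have cb : c * (b - 1) <= 2^-1.
  by rewrite -ler_pdivlMr ?subr_gt0// !ge_min lexx orbT.
exists (c / 2); first lra.
move=> t /andP[t1 t2].
have := power_gap_young (t := c * t) a1 ab (_ : 0 <= 1 + t) _.
rewrite (addrC 1 t) addrK => /(_ _ _); move=> /(_ ltac:(lra) ltac:(nra)).
have : `|c * t| <= d.
  by rewrite normrM (gtr0_norm c0); have : `|t| <= 1 by [rewrite ler_norml t1]; nra.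
move=> /H; rewrite (addrC t 1) => Hc Hy; rewrite !expr2 in Hc *.
have : (c * (b - 1)) * (c * t ^+ 2) <= 2^-1 * (c * t ^+ 2).
  by rewrite ler_wpM2r// mulr_ge0 ?sqr_ge0// ltW.
rewrite expr2; nra.
Qed.

(** Write [1 + t = 2 * u]. Inserting Bernoulli's inequality for [u]^ a[in the part of]power_gap a (2
    * u)[left after removing]power_gap a 2 * u [^ a] shows that this part is at least
    [(a - 1) * (u - 1) >= 0]; moreover [u >= t / 2]. *)
Lemma power_gap_ge_powR a : 1 < a -> exists2 k : R, 0 < k &
  forall t, 1 <= t -> k * t `^ a <= power_gap a (1 + t).
Proof.
move=> a1; have [k k0 H] := power_gap_ge_sqr a1.
have c0 : 0 < power_gap a 2.
  rewrite (_ : 2 = 1 + 1); last by lra.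
  by apply: lt_le_trans (H 1 _); rewrite ?expr1n ?mulr1//; lra.
exists (power_gap a 2 * 2^-1 `^ a); first by rewrite mulr_gt0 ?powR_gt0//; lra.
move=> t t1; have [u ut] : exists u, u = (1 + t) / 2 by eexists.
have u0 : 0 <= u by lra.
have bern : 1 + a * (u - 1) <= u `^ a.
  by have := power_gap_ge0 a1 u0; rewrite /power_gap subr_ge0 ler_pdivlMr; lra.
have gap2 : power_gap a (2 * u) = 2 `^ a / a * u `^ a - a^-1 - 2 * u + 1.
  by rewrite /power_gap powRM; [field; rewrite gt_eqF//|..]; lra.
have E2 : 2 `^ a / a = power_gap a 2 + 1 + a^-1.
  by rewrite /power_gap; field; rewrite gt_eqF//; lra.
rewrite (_ : 1 + t = 2 * u); last by lra.
rewrite gap2 E2 -mulrA -powRM; [|lra|lra].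
have : power_gap a 2 * (2^-1 * t) `^ a <= power_gap a 2 * u `^ a.
  rewrite ler_pM2l// ge0_ler_powR ?nnegrE//; lra.
have : (1 + a^-1) * (1 + a * (u - 1)) <= (1 + a^-1) * u `^ a.
  rewrite ler_pM2l// addr_gt0// invr_gt0; lra.
have : (1 + a^-1) * (1 + a * (u - 1)) = 1 + a^-1 + (a + 1) * (u - 1).
  by field; rewrite gt_eqF//; lra.
nra.
Qed.

Lemma power_gap_ge_sqr_global a : 2 <= a -> exists2 k : R, 0 < k &
  forall t, -1 <= t -> k * t ^+ 2 <= power_gap a (1 + t).
Proof.
move=> a2; have a1 : 1 < a by lra.
have [k k0 H] := power_gap_ge_sqr a1.
have [l l0 K] := power_gap_ge_powR a1.
exists (Num.min k l); first by rewrite lt_min k0.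
move=> t t1; have [t2|/ltW t2] := leP t 1.
  apply: le_trans (H t _); last by rewrite t1.
  by rewrite ler_wpM2r ?sqr_ge0// ge_min lexx.
apply: le_trans (K t _); last by [].
apply: ler_pM; rewrite ?sqr_ge0 ?le_min ?(ltW k0) ?(ltW l0) ?ge_min ?lexx ?orbT//.
by rewrite -powR_mulrn; [apply: ler_powR|lra].
Qed.

End power_gap.

(** * Operator norms and bilinear forms *)

Section operator_norm.
Context {R : realType} (n : nat).
Implicit Types (A : 'M[R]_n) (x y z w : 'I_n -> R) (p q r M : R).

Definition bilin A y x : R := \sum_i \sum_j y i * A i j * x j.

Lemma powR_powR_inv (a q : R) : 0 < q -> 0 <= a -> (a `^ q) `^ q^-1 = a.
Proof. by move=> q0 a0; rewrite -powRrM divff ?gt_eqF// powRr1. Qed.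

Lemma powR_inv_powR (a q : R) : 0 < q -> 0 <= a -> (a `^ q^-1) `^ q = a.
Proof. by move=> q0 a0; rewrite -powRrM mulVf ?gt_eqF// powRr1. Qed.

Lemma powR_addr_gt0 (a s t : R) : 0 < a -> a `^ (s + t) = a `^ s * a `^ t.
Proof. by move=> a0; rewrite powRD// (gt_eqF a0) implybT. Qed.

Lemma powR_sum_ge0 q x : 0 <= \sum_i x i `^ q.
Proof. by apply: sumr_ge0 => i _; exact: powR_ge0. Qed.

Lemma vec_norm_le1 q (x : 'cV[R]_n) : 0 < q ->
  vec_norm q x <= 1 -> \sum_i `|x i 0| `^ q <= 1.
Proof.
move=> q0; rewrite /vec_norm => H.
rewrite -(@powR_inv_powR (\sum_i _) q)// ?powR_sum_ge0//.
rewrite [leRHS](_ : 1 = 1 `^ q); last by rewrite powR1.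
by apply: ge0_ler_powR; rewrite ?nnegrE ?powR_ge0// ltW.
Qed.

Lemma vec_norm_le q (x : 'cV[R]_n) z : 0 < q ->
  (forall i, `|x i 0| <= z i) -> vec_norm q x <= (\sum_i z i `^ q) `^ q^-1.
Proof.
move=> q0 xz; apply: ge0_ler_powR; rewrite ?nnegrE ?powR_sum_ge0 ?invr_ge0 ?(ltW q0)//.
apply: ler_sum => i _; apply: ge0_ler_powR; rewrite ?nnegrE ?(ltW q0)//.
by rewrite (le_trans _ (xz i)).
Qed.

Lemma vec_norm0 q : 0 < q -> vec_norm q (0 : 'cV[R]_n) = 0.
Proof.
move=> q0; rewrite /vec_norm big1 ?powR0 ?invr_eq0 ?gt_eqF// => i _.
by rewrite mxE normr0 powR0 ?gt_eqF.
Qed.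

Lemma opnorm_bounded p r A : 0 < p -> 0 < r ->
  has_sup [set vec_norm p (A *m x) | x in [set x : 'cV[R]_n | vec_norm r x <= 1]].
Proof.
move=> p0 r0; split.
  by exists (vec_norm p (A *m 0)), 0 => //=; rewrite vec_norm0.
exists ((\sum_i (\sum_j `|A i j|) `^ p) `^ p^-1) => _ [x /= /vec_norm_le1 -/(_ r0) x1 <-].
apply: vec_norm_le => // i; rewrite mxE (le_trans (ler_norm_sum _ _ _))//.
apply: ler_sum => j _; rewrite normrM ler_piMr//.
have : `|x j 0| `^ r <= 1.
  by apply: le_trans x1; rewrite (bigD1 j)//= lerDl sumr_ge0// => k _; exact: powR_ge0.
move=> H; rewrite -(powR_powR_inv r0 (normr_ge0 (x j 0))).
rewrite [leRHS](_ : 1 = 1 `^ r^-1); last by rewrite powR1.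
by apply: ge0_ler_powR; rewrite ?nnegrE ?powR_ge0 ?invr_ge0 ?(ltW r0).
Qed.

Lemma vec_norm_opnorm p r A (x : 'cV[R]_n) : 0 < p -> 0 < r ->
  vec_norm r x <= 1 -> vec_norm p (A *m x) <= opnorm r p A.
Proof.
move=> p0 r0 x1; apply: ub_le_sup; last by exists x.
by case: (opnorm_bounded A p0 r0).
Qed.

Lemma opnorm_le p r A M : 0 < p -> 0 < r ->
  (forall x : 'cV[R]_n, vec_norm r x <= 1 -> vec_norm p (A *m x) <= M) -> opnorm r p A <= M.
Proof.
move=> p0 r0 H; apply: ge_sup; first by case: (opnorm_bounded A p0 r0).
by move=> _ [x /= x1 <-]; exact: H.
Qed.

Lemma sum_holder p q y (w : 'cV[R]_n) : 1 < p -> p^-1 + q^-1 = 1 ->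
  (forall i, 0 <= y i) -> \sum_i y i `^ q <= 1 ->
  \sum_i y i * w i 0 <= vec_norm p w.
Proof.
move=> p1 pq y0 y1; have p0 : 0 < p by lra.
have q0 : 0 < q.
  by rewrite -invr_gt0; have : p^-1 < 1 by [rewrite invf_lt1]; lra.
have [W0|W0] := eqVneq (\sum_i `|w i 0| `^ p) 0.
  rewrite big1 ?powR_ge0// => i _.
  move/eqP: W0; rewrite psumr_eq0; last by move=> *; exact: powR_ge0.
  by move=> /allP/(_ i); rewrite mem_index_enum => /(_ isT)/eqP/powR_eq0_eq0/normr0_eq0 ->;
    rewrite mulr0.
set W := vec_norm p w; have Wgt0 : 0 < W by rewrite powR_gt0 ?lt0r ?W0 ?powR_sum_ge0.
have Wp : W `^ p = \sum_i `|w i 0| `^ p by rewrite powR_inv_powR ?powR_sum_ge0.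
rewrite -[leRHS]mul1r -ler_pdivrMr// mulr_suml.
apply: (@le_trans _ _ (\sum_i (y i `^ q / q + (`|w i 0| / W) `^ p / p))).
  apply: ler_sum => i _; rewrite -mulrA (@le_trans _ _ (y i * (`|w i 0| / W)))//.
    by rewrite ler_wpM2l// ler_wpM2r ?ler_norm ?invr_ge0 ?(ltW Wgt0)//.
  by apply: conjugate_powR => //; [rewrite divr_ge0// ltW|rewrite addrC].
have E : \sum_i (`|w i 0| / W) `^ p = 1.
  under eq_bigr do rewrite powRM ?invr_ge0 ?(ltW Wgt0)//.
  rewrite -mulr_suml -Wp -powRM ?invr_ge0 ?(ltW Wgt0)//.
  by rewrite divff ?gt_eqF// powR1.
rewrite big_split/= -!mulr_suml E mul1r addrC -[leRHS]pq lerD2l.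
by rewrite ler_piMl// invr_ge0 ltW.
Qed.

(** The test vectors need not be normalized: the excess of their norms is recorded by [u] and [v].
    In exponential form the two excesses combine into [expR (u + v)], which [lower_arith] bounds
    through [1 + x <= expR x]. *)
Lemma opnorm_ge_bilin p q r A x y (u v : R) : (0 < n)%N ->
  1 < p -> p^-1 + q^-1 = 1 -> 0 < r ->
  (forall i, 0 <= x i) -> (forall i, 0 <= y i) ->
  \sum_i x i `^ r <= n%:R * expR (r * u) ->
  \sum_i y i `^ q <= n%:R * expR (q * v) ->
  bilin A y x <=
    n%:R * expR (u + v) * opnorm r p (n%:R `^ (- (p^-1 - r^-1)) *: A).
Proof.
move=> n0 p1 pq r0 x0 y0 xr yq; have p0 : 0 < p by lra.
have q0 : 0 < q.
  by rewrite -invr_gt0; have : p^-1 < 1 by [rewrite invf_lt1]; lra.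
have N0 : 0 < n%:R :> R by rewrite ltr0n.
pose X := n%:R `^ r^-1 * expR u; pose Y := n%:R `^ q^-1 * expR v.
have X0 : 0 < X by rewrite mulr_gt0 ?powR_gt0 ?expR_gt0.
have scaled (s b : R) (z : 'I_n -> R) : 0 < s -> (forall i, 0 <= z i) ->
    \sum_i z i `^ s <= n%:R * expR (s * b) ->
    \sum_i (z i / (n%:R `^ s^-1 * expR b)) `^ s <= 1.
  move=> s0 z0; set D := _ * expR b.
  have D0 : 0 < D by rewrite mulr_gt0 ?powR_gt0 ?expR_gt0.
  have <- : D `^ s = n%:R * expR (s * b).
    rewrite powRM ?powR_ge0 ?expR_ge0// powR_inv_powR ?ler0n//.
    by rewrite (mulrC s b) expRM.
  move=> H; under eq_bigr do rewrite powRM ?invr_ge0 ?(ltW D0)//.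
  rewrite -mulr_suml; apply: (le_trans (ler_wpM2r (powR_ge0 _ _) H)).
  by rewrite -powRM ?invr_ge0 ?(ltW D0)// divff ?gt_eqF// powR1.
have x1 := scaled r u x r0 x0 xr; have y1 := scaled q v y q0 y0 yq.
pose c : R := n%:R `^ (- (p^-1 - r^-1)).
pose w := \col_j (x j / X) : 'cV[R]_n.
have wx : \sum_i `|w i 0| `^ r = \sum_i (x i / X) `^ r.
  by apply: eq_bigr => i _; rewrite mxE ger0_norm// divr_ge0// ltW.
have w1 : vec_norm r w <= 1.
  rewrite /vec_norm wx [leRHS](_ : 1 = 1 `^ r^-1); last by rewrite powR1.
  apply: ge0_ler_powR x1; rewrite ?nnegrE ?invr_ge0 ?(ltW r0)//.
  by apply: sumr_ge0 => i _; exact: powR_ge0.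
have H : \sum_i (y i / Y) * (c *: A *m w) i 0 <= opnorm r p (c *: A).
  apply: le_trans (vec_norm_opnorm _ p0 r0 w1).
  by apply: sum_holder pq _ y1 => // i; rewrite divr_ge0// ltW.
have E : \sum_i (y i / Y) * (c *: A *m w) i 0 = c / (X * Y) * bilin A y x.
  rewrite /bilin [(X * Y)^-1]invfM mulr_sumr; apply: eq_bigr => i _.
  by rewrite mxE !mulr_sumr; apply: eq_bigr => j _; rewrite !mxE; ring.
(* The exponent is [1/r + 1/q = 1 - (1/p - 1/r)]: this is why the scaling of the matrix leaves
   exactly one factor [n]. *)
have XY : X * Y = c * (n%:R * expR (u + v)).
  have -> : X * Y = n%:R `^ r^-1 * n%:R `^ q^-1 * (expR u * expR v).
    by rewrite /X /Y; ring.
  rewrite -expRD mulrA; congr (_ * _).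
  rewrite -[X in c * X](powRr1 (ler0n R n)) -!powR_addr_gt0//.
  by congr (_ `^ _); rewrite -pq; move: p^-1 q^-1 r^-1; clear => *; lra.
have c0 : 0 < c by rewrite powR_gt0.
have K0 : 0 < n%:R * expR (u + v) by rewrite mulr_gt0 ?expR_gt0.
rewrite -(ler_pdivrMl _ _ K0); apply: le_trans H; rewrite E XY.
by rewrite [(c * _)^-1]invfM mulrA divff ?gt_eqF// mul1r.
Qed.

Lemma opnorm_le_bilin p q r A M : (0 < n)%N ->
  1 < p -> p^-1 + q^-1 = 1 -> 0 < r -> 0 <= M ->
  (forall i j, 0 <= A i j) ->
  (forall x y, (forall i, 0 <= x i) -> (forall i, 0 <= y i) ->
     \sum_i x i `^ r = n%:R -> \sum_i y i `^ q = n%:R ->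
     bilin A y x <= n%:R * M) ->
  opnorm r p (n%:R `^ (- (p^-1 - r^-1)) *: A) <= M.
Proof.
move=> n0 p1 pq r0 M0 A0 H; have p0 : 0 < p by lra.
have q0 : 0 < q.
  by rewrite -invr_gt0; have : p^-1 < 1 by [rewrite invf_lt1]; lra.
have N0 : 0 < n%:R :> R by rewrite ltr0n.
set c : R := _ `^ _; have c0 : 0 < c by rewrite powR_gt0.
apply: opnorm_le => // x x1; pose z i := \sum_j A i j * `|x j 0|.
have z0 i : 0 <= z i by apply: sumr_ge0 => j _; rewrite mulr_ge0.
have cz i : `|(c *: A *m x) i 0| <= c * z i.
  rewrite mxE (le_trans (ler_norm_sum _ _ _))// mulr_sumr ler_sum// => j _.
  by rewrite mxE !normrM (gtr0_norm c0) (ger0_norm (A0 _ _)) mulrA.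
apply: (le_trans (vec_norm_le p0 cz)).
under eq_bigr do rewrite powRM ?(ltW c0)//.
rewrite -mulr_sumr powRM ?powR_ge0 ?powR_sum_ge0// powR_powR_inv ?(ltW c0)//.
have rho1 := vec_norm_le1 r0 x1.
set zeta := \sum_i z i `^ p; set rho := \sum_i `|x i 0| `^ r in rho1.
have rho0 : 0 <= rho by exact: powR_sum_ge0.
have zeta0 : 0 <= zeta by exact: powR_sum_ge0.
have [->|zetaN0] := eqVneq zeta 0; first by rewrite powR0 ?mulr0// invr_eq0 gt_eqF.
have zeta_gt0 : 0 < zeta by rewrite lt0r zetaN0.
have rho_gt0 : 0 < rho.
  rewrite lt0r rho0 andbT; apply: contra zetaN0 => /eqP rhoE.
  rewrite /zeta big1// => i _; rewrite /z big1 ?powR0 ?gt_eqF// => j _.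
  move/eqP: rhoE; rewrite psumr_eq0; last by move=> *; exact: powR_ge0.
  by move=> /allP/(_ j); rewrite mem_index_enum => /(_ isT)/eqP/powR_eq0_eq0 ->; rewrite mulr0.
have pq1 : (p - 1) * q = p.
  have -> : q = (1 - p^-1)^-1 by rewrite -pq [p^-1 + _]addrC addrK invrK.
  by field; rewrite !gt_eqF//; lra.
have Nrho : 0 <= n%:R / rho by rewrite divr_ge0// ?ler0n// ltW.
have Nzeta : 0 <= n%:R / zeta by rewrite divr_ge0// ?ler0n// ltW.
(* Both vectors are rescaled so that their power sums are exactly [n]. For the second one this uses
   [(p - 1) * q = p]; for the first one it only helps, since [rho <= 1]. *)
have : bilin A (fun i => (n%:R / zeta) `^ q^-1 * z i `^ (p - 1))
    (fun j => (n%:R / rho) `^ r^-1 * `|x j 0|) <= n%:R * M.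
  apply: H; try by move=> i; rewrite mulr_ge0 ?powR_ge0.
    under eq_bigr do rewrite powRM ?powR_ge0//.
    by rewrite -mulr_sumr powR_inv_powR// -mulrA mulVf ?mulr1// gt_eqF.
  under eq_bigr do rewrite powRM ?powR_ge0// -(powRrM (z _)) pq1.
  by rewrite -mulr_sumr powR_inv_powR// -mulrA mulVf ?mulr1// gt_eqF.
have -> : bilin A (fun i => (n%:R / zeta) `^ q^-1 * z i `^ (p - 1))
    (fun j => (n%:R / rho) `^ r^-1 * `|x j 0|) =
    (n%:R / zeta) `^ q^-1 * (n%:R / rho) `^ r^-1 * zeta.
  rewrite /bilin /zeta mulr_sumr; apply: eq_bigr => i _.
  rewrite -[in RHS](mulr_powRB1 (z0 i) p0) {2}/z !mulr_suml mulr_sumr.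
  move: (_ `^ q^-1) (_ `^ r^-1) (z i `^ _) => s t u; clear.
  by apply: eq_bigr => j _; ring.
have -> : (n%:R / zeta) `^ q^-1 * (n%:R / rho) `^ r^-1 * zeta =
    n%:R * (c * zeta `^ p^-1) * rho `^ (- r^-1).
  rewrite !powRM ?invr_ge0 ?(ltW N0) ?(ltW rho_gt0) ?(ltW zeta_gt0)//.
  have powV (u s : R) : 0 < u -> u^-1 `^ s = u `^ (- s).
    by move=> u0; rewrite -mulN1r powRrM powR_inv1// ltW.
  rewrite !powV//.
  have -> : p^-1 = - q^-1 + 1 by lra.
  rewrite powR_addr_gt0// powRr1 ?(ltW zeta_gt0)//.
  have -> : n%:R * (c * (zeta `^ (- q^-1) * zeta)) =
    n%:R * c * (zeta `^ (- q^-1) * zeta) by ring.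
  have -> : n%:R * c = n%:R `^ q^-1 * n%:R `^ r^-1.
    rewrite -{1}(powRr1 (ler0n R n)) -!powR_addr_gt0//; congr (_ `^ _).
    by rewrite -pq; lra.
  move: (_ `^ q^-1) (_ `^ r^-1) (zeta `^ _) (rho `^ _) => s t u v; clear.
  by ring.
move=> B; rewrite -(ler_pM2l N0); apply: le_trans B.
rewrite ler_peMr//; first by rewrite !mulr_ge0 ?powR_ge0 ?ler0n// ltW.
rewrite powRN invf_ge1 ?powR_gt0//.
Qed.

End operator_norm.

(** * Upper bound for the bilinear form *)

Section cross_term.
Context {R : realType}.

Lemma le_expr_norm (z : R) (s : R) (m : nat) (K : R) : 1 <= K -> 0 <= s ->
  s <= 2 * m%:R -> z ^+ 2 <= K -> `|z| `^ s <= K ^+ m.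
Proof.
move=> K1 s0 sm zK; have [z1|/ltW z1] := leP `|z| 1.
  apply: (@le_trans _ _ 1); last exact: exprn_ege1.
  rewrite [leRHS](_ : 1 = 1 `^ s); last by rewrite powR1.
  by apply: ge0_ler_powR; rewrite ?nnegrE.
apply: (@le_trans _ _ (`|z| `^ (2 * m%:R))); first exact: ler_powR.
rewrite -natrM powR_mulrn// exprM real_normK ?num_real//.
by apply: lerXn2r; rewrite ?nnegrE ?sqr_ge0//; lra.
Qed.

Lemma mul_le_weighted_sqr (lam a b : R) : 0 < lam -> a * b <= lam * a ^+ 2 + b ^+ 2 / lam.
Proof.
move=> l0; rewrite -(ler_pM2r l0) mulrDl divfK ?gt_eqF//.
have : 0 <= (lam * a - b / 2) ^+ 2 by exact: sqr_ge0.
have : 0 <= b ^+ 2 by exact: sqr_ge0.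
rewrite !expr2; nra.
Qed.

Lemma sqr_sum_le (I : finType) (a b : I -> R) :
  (\sum_i a i * b i) ^+ 2 <= (\sum_i a i ^+ 2) * (\sum_i b i ^+ 2).
Proof.
set A := \sum_i a i ^+ 2; set B := \sum_i b i ^+ 2; set C := \sum_i a i * b i.
have A0 : 0 <= A by apply: sumr_ge0 => i _; exact: sqr_ge0.
have B0 : 0 <= B by apply: sumr_ge0 => i _; exact: sqr_ge0.
have quad s t : 0 <= s ^+ 2 * A - 2 * s * t * C + t ^+ 2 * B.
  have -> : s ^+ 2 * A - 2 * s * t * C + t ^+ 2 * B = \sum_i (s * a i - t * b i) ^+ 2.
    rewrite /A /B /C !mulr_sumr -sumrB -big_split/=; apply: eq_bigr => i _; ring.
  by apply: sumr_ge0 => i _; exact: sqr_ge0.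
have [A_eq0|A_neq0] := eqVneq A 0.
  have : forall i, a i = 0.
    move=> i; move/eqP: A_eq0; rewrite psumr_eq0; last by move=> *; exact: sqr_ge0.
    by move=> /allP/(_ i); rewrite mem_index_enum => /(_ isT)/eqP/eqP; rewrite sqrf_eq0 => /eqP.
  by move=> a0; rewrite /C big1 ?expr0n ?mulr_ge0// => i _; rewrite a0 mul0r.
have Agt : 0 < A by rewrite lt0r A_neq0.
(* At [(s, t) = (C, A)] the nonnegative quadratic form equals [A * (A * B - C^2)]. *)
have := quad C A; rewrite -(pmulr_rge0 _ Agt) => H.
rewrite -subr_ge0 -(pmulr_rge0 _ Agt).
have -> : A * (A * B - C ^+ 2) = C ^+ 2 * A - 2 * C * A * C + A ^+ 2 * B by ring.
exact: quad.
Qed.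

(* Weighted AM-GM for [t <= 1], Young with the exponent [min(r, 2)] for [t > 1]; the power
   [L ^+ m] pays for the part of the conjugate exponent that exceeds [2]. *)
Lemma cross_term_pointwise (r : R) : 1 < r -> exists m : nat,
  forall theta G : R, 0 < theta -> 1 <= G -> exists2 C : R, 0 < C &
  forall N L b t : R, 0 < N -> 1 <= L -> -1 <= t -> b ^+ 2 <= G * L * N ^+ 2 ->
    b * t <= theta * N * power_gap r (1 + t) + b ^+ 2 / N * (C * L ^+ m).
Proof.
move=> r1; have [k k0 Hk] := power_gap_ge_sqr r1.
have [l l0 Hl] := power_gap_ge_powR r1.
pose rho := Num.min r 2; have rho1 : 1 < rho by rewrite lt_min r1; lra.
have rho2 : rho <= 2 by rewrite ge_min lexx orbT.
have rhor : rho <= r by rewrite ge_min lexx.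
clearbody rho.
pose rho' := rho / (rho - 1).
have rho'E : rho^-1 + rho'^-1 = 1.
  by rewrite /rho' invfM invrK; field; rewrite !gt_eqF//; lra.
have rho'2 : 2 <= rho' by rewrite /rho' ler_pdivlMr; lra.
clearbody rho'.
have [m mE] : exists m : nat, rho' - 2 <= 2 * m%:R.
  exists (Num.bound (rho' - 2)).
  have := archi_boundP (_ : 0 <= rho' - 2); move=> /(_ ltac:(lra)).
  have : 0 <= (Num.bound (rho' - 2))%:R :> R by exact: ler0n.
  lra.
exists m => theta G th0 G1.
(* With [lam = theta * l * N] as below, [G' * L] bounds [(b / lam)^2]. The added 1 ensures
   [G' * L >= 1], as [le_expr_norm] requires. *)
pose G' := G / (theta * l) ^+ 2 + 1.
have tl0 : 0 < theta * l by rewrite mulr_gt0.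
have tk0 : 0 < theta * k by rewrite mulr_gt0.
have G'1 : 1 <= G' by rewrite lerDr divr_ge0 ?sqr_ge0//; lra.
exists ((theta * k)^-1 + (theta * l)^-1 * G' ^+ m).
  by rewrite addr_gt0 ?invr_gt0 ?mulr_gt0 ?invr_gt0 ?exprn_gt0//; lra.
move=> N L b t N0 L1 t1 bN; have Lm1 : 1 <= L ^+ m by exact: exprn_ege1.
have Lm0 : 0 <= L ^+ m by lra.
have bb : 0 <= b ^+ 2 / N by rewrite divr_ge0 ?sqr_ge0// ltW.
have [t2|/ltW t2] := leP t 1.
  have tkN : 0 < theta * k * N by rewrite mulr_gt0.
  rewrite mulrC; apply: le_trans (mul_le_weighted_sqr t b tkN) _.
  apply: lerD.
    have -> : theta * k * N * t ^+ 2 = theta * N * (k * t ^+ 2) by ring.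
    by rewrite ler_wpM2l ?Hk ?t1// mulr_ge0// ltW.
  have -> : b ^+ 2 / (theta * k * N) = b ^+ 2 / N * (theta * k)^-1.
    by field; rewrite !gt_eqF.
  rewrite ler_wpM2l//.
  rewrite mulrDl -[leLHS]mulr1 -[leLHS]addr0; apply: lerD.
    by rewrite ler_wpM2l// invr_ge0 ltW.
  by rewrite !mulr_ge0 ?invr_ge0 ?exprn_ge0//; lra.
have t0 : 0 <= t by lra.
pose lam := theta * l * N; have lam0 : 0 < lam by rewrite mulr_gt0.
apply: (@le_trans _ _ (`|b| * t)); first by rewrite ler_wpM2r// ler_norm.
have -> : `|b| * t = lam * (t * (`|b| / lam)) by field; rewrite gt_eqF.
have rho0 : 0 < rho by lra. have rho'0 : 0 < rho' by lra.
have B0 : 0 <= `|b| / lam by rewrite divr_ge0// ltW.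
apply: (@le_trans _ _ (lam * (t `^ rho + (`|b| / lam) `^ rho'))).
  rewrite ler_wpM2l ?(ltW lam0)//; apply: le_trans (conjugate_powR t0 B0 rho0 rho'0 rho'E) _.
  apply: lerD; rewrite ler_pdivrMr// ler_peMr ?powR_ge0//; lra.
rewrite mulrDr; apply: lerD.
  apply: (@le_trans _ _ (theta * N * (l * t `^ r))); last first.
    by rewrite ler_wpM2l ?Hl// mulr_ge0// ltW.
  have -> : lam * t `^ rho = theta * N * (l * t `^ rho) by rewrite /lam; ring.
  by rewrite !ler_wpM2l ?mulr_ge0 ?(ltW th0) ?(ltW N0) ?(ltW l0)// ler_powR.
have -> : rho' = 2%:R + (rho' - 2) by lra.
have -> : (`|b| / lam) `^ (2%:R + (rho' - 2)) =
    (b / lam) ^+ 2 * (`|b / lam|) `^ (rho' - 2).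
  have [->|b0] := eqVneq b 0.
    by rewrite normr0 !mul0r expr0n mul0r powR0// gt_eqF//; lra.
  have bl0 : 0 < `|b| / lam by rewrite divr_gt0// normr_gt0.
  rewrite powR_addr_gt0// powR_mulrn ?(ltW bl0)// normrM normfV (gtr0_norm lam0).
  by rewrite -[in RHS](real_normK (num_real (b / lam))) normrM normfV (gtr0_norm lam0).
have blam : (b / lam) ^+ 2 <= G' * L.
  rewrite expr_div_n /lam [(_ * N) ^+ 2]exprMn ler_pdivrMr; last first.
    by rewrite mulr_gt0// exprn_gt0.
  apply: le_trans bN _; rewrite [leRHS]mulrA ler_wpM2r ?sqr_ge0// mulrAC ler_wpM2r//; first lra.
  rewrite /G' mulrDl divfK ?gt_eqF ?exprn_gt0// mul1r lerDl sqr_ge0//.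
have := @le_expr_norm (b / lam) (rho' - 2) m (G' * L) _ _ mE blam.
have GL1 : 1 <= G' * L by rewrite -[1]mulr1 ler_pM//; lra.
move=> /(_ GL1 ltac:(lra)) H.
rewrite mulrA; apply: le_trans (ler_wpM2l _ H) _.
  by rewrite mulr_ge0 ?sqr_ge0// ltW.
have -> : lam * (b / lam) ^+ 2 * (G' * L) ^+ m =
    b ^+ 2 / N * ((theta * l)^-1 * G' ^+ m * L ^+ m).
  have -> : lam * (b / lam) ^+ 2 = b ^+ 2 / N * (theta * l)^-1.
    by rewrite /lam; field; rewrite !gt_eqF.
  by rewrite exprMn -!mulrA.
rewrite ler_wpM2l// ler_wpM2r// lerDr invr_ge0 ltW//.
Qed.

(* For [q >= 2] the sum of the [(y i - 1) ^+ 2] is controlled by that of the gaps of [y]. *)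
Lemma cross_term (r q : R) : 1 < r -> 2 <= q -> exists m : nat,
  forall theta : R, 0 < theta -> exists2 delta : R, 0 < delta &
  forall (n : nat) (E : 'I_n -> 'I_n -> R) (kappa L : R) (x y : 'I_n -> R),
  (0 < n)%N -> 0 <= kappa -> 1 <= L -> (forall i j, E i j ^+ 2 <= L) ->
  (forall v : 'I_n -> R,
     \sum_j (\sum_i v i * E i j) ^+ 2 <= kappa * \sum_i v i ^+ 2) ->
  kappa * L ^+ m <= delta * n%:R ^+ 2 ->
  (forall i, 0 <= x i) -> (forall i, 0 <= y i) ->
  \sum_i power_gap q (y i) <= n%:R ->
  \sum_i \sum_j (y i - 1) * E i j * (x j - 1) <=
  theta * n%:R * (\sum_i power_gap r (x i) + \sum_i power_gap q (y i)).
Proof.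
move=> r1 q2; have [m Hm] := cross_term_pointwise r1.
exists m => theta th0.
have [k k0 Hk] := power_gap_ge_sqr_global q2.
have k1 : 1 <= k^-1 + 1 by rewrite lerDr invr_ge0 ltW.
have [C C0 HC] := Hm theta (k^-1 + 1) th0 k1.
(* The total cost in [b] is at most [kappa * L ^+ m * (C / k) * D' / n]; with this [delta] it
   becomes at most [theta * n * D']. *)
exists (theta * k / C); first by rewrite divr_gt0// mulr_gt0.
move=> n E kappa L x y n0 ka0 L1 EL Eop kL x0 y0 Dn.
have N0 : 0 < n%:R :> R by rewrite ltr0n.
set D' := \sum_i power_gap q (y i) in Dn *.
pose b j := \sum_i (y i - 1) * E i j.
have eta2 : \sum_i (y i - 1) ^+ 2 <= D' / k.
  rewrite ler_pdivlMr// mulr_suml; apply: ler_sum => i _; rewrite mulrC.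
  by have := Hk (y i - 1); rewrite (addrC 1) subrK; apply; have := y0 i; lra.
have D'0 : 0 <= D'.
  have : 0 <= \sum_i (y i - 1) ^+ 2 by apply: sumr_ge0 => i _; exact: sqr_ge0.
  by move=> /le_trans/(_ eta2); rewrite pmulr_lge0 ?invr_gt0.
(* A crude bound by Cauchy-Schwarz with the entry bound [L] and [D' <= n]. It serves only to control
   the excess of the conjugate exponent over 2; the main saving comes from the operator bound
   [Eop]. *)
have bj j : b j ^+ 2 <= (k^-1 + 1) * L * n%:R ^+ 2.
  apply: le_trans (sqr_sum_le _ _) _.
  apply: (@le_trans _ _ (D' / k * (n%:R * L))).
    apply: ler_pM => //; try by apply: sumr_ge0 => i _; exact: sqr_ge0.
    apply: (@le_trans _ _ (\sum_(i < n) L)); first exact: ler_sum.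
    by rewrite sumr_const card_ord -[leLHS]mulr_natl.
  have nL : 0 <= n%:R * L by rewrite mulr_ge0// ?ltW//; lra.
  apply: (@le_trans _ _ (n%:R / k * (n%:R * L))).
    by rewrite ler_wpM2r// ler_wpM2r// invr_ge0 ltW.
  have -> : n%:R / k * (n%:R * L) = k^-1 * L * n%:R ^+ 2 by ring.
  by rewrite ler_wpM2r ?sqr_ge0// ler_wpM2r ?lerDl//; lra.
rewrite exchange_big/=; under eq_bigr do rewrite -mulr_suml -/(b _).
apply: (@le_trans _ _ (\sum_j (theta * n%:R * power_gap r (x j) +
    b j ^+ 2 / n%:R * (C * L ^+ m)))).
  apply: ler_sum => j _; have := HC n%:R L (b j) (x j - 1) N0 L1 _ (bj j).
  by rewrite (addrC 1) subrK; apply; have := x0 j; lra.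
rewrite big_split/= -mulr_sumr mulrDr lerD2l -!mulr_suml.
have Lm0 : 0 <= L ^+ m by rewrite exprn_ge0//; lra.
have b2 : \sum_i b i ^+ 2 <= kappa * (D' / k).
  by apply: le_trans (Eop _) _; rewrite ler_wpM2l.
apply: (@le_trans _ _ (kappa * (D' / k) / n%:R * (C * L ^+ m))).
  rewrite ler_wpM2r ?mulr_ge0 ?(ltW C0)// ler_wpM2r// invr_ge0 ltW//.
have -> : kappa * (D' / k) / n%:R * (C * L ^+ m) =
    kappa * L ^+ m * (D' * C / (k * n%:R)) by field; rewrite !gt_eqF.
apply: le_trans (ler_wpM2r _ kL) _.
  by rewrite divr_ge0 ?mulr_ge0 ?(ltW C0) ?(ltW k0) ?(ltW N0).
by rewrite le_eqVlt; apply/orP; left; apply/eqP; field; rewrite !gt_eqF.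
Qed.

End cross_term.

Section bilinear_upper_bound.
Context {R : realType}.

Lemma conjugate_gt0 (r q : R) : 1 < r -> r^-1 + q^-1 = 1 -> 1 < q /\ q - 1 = (r - 1)^-1.
Proof.
move=> r1 rq; have q0 : 0 < q.
  by rewrite -invr_gt0; have : r^-1 < 1 by [rewrite invf_lt1; lra]; lra.
have qE : q = r / (r - 1).
  have -> : q = (1 - r^-1)^-1 by rewrite -rq [r^-1 + _]addrC addrK invrK.
  by field; rewrite !gt_eqF//; lra.
split; first by rewrite qE ltr_pdivlMr; lra.
by rewrite qE; field; rewrite gt_eqF//; lra.
Qed.

(** One of [r], [q] is at least 2 because their inverses sum to at most 1. The symmetry of [E]
    allows the two vectors to be exchanged. *)
Lemma cross_term_sym (r q : R) : 1 < r -> 1 < q -> r^-1 + q^-1 <= 1 ->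
  exists m : nat, forall theta : R, 0 < theta -> exists2 delta : R, 0 < delta &
  forall (n : nat) (E : 'I_n -> 'I_n -> R) (kappa L : R) (x y : 'I_n -> R),
  (0 < n)%N -> 0 <= kappa -> 1 <= L -> (forall i j, E i j ^+ 2 <= L) ->
  (forall i j, E i j = E j i) ->
  (forall v : 'I_n -> R,
     \sum_j (\sum_i v i * E i j) ^+ 2 <= kappa * \sum_i v i ^+ 2) ->
  kappa * L ^+ m <= delta * n%:R ^+ 2 ->
  (forall i, 0 <= x i) -> (forall i, 0 <= y i) ->
  \sum_i power_gap r (x i) <= n%:R ->
  \sum_i power_gap q (y i) <= n%:R ->
  \sum_i \sum_j (y i - 1) * E i j * (x j - 1) <=
  theta * n%:R * (\sum_i power_gap r (x i) + \sum_i power_gap q (y i)).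
Proof.
move=> r1 q1 rq; have [q2|/ltW q2] := leP 2 q.
  have [m Hm] := cross_term r1 q2; exists m => theta /Hm[delta d0 H].
  exists delta => // n E kappa L x y n0 ka0 L1 EL _ Eop kL x0 y0 _ Dy.
  exact: (H n E kappa L x y).
have r2 : 2 <= r.
  have : 2^-1 <= q^-1 by rewrite lef_pV2 ?posrE//; lra.
  by move=> ?; rewrite -lef_pV2 ?posrE//; lra.
have [m Hm] := cross_term q1 r2; exists m => theta /Hm[delta d0 H].
exists delta => // n E kappa L x y n0 ka0 L1 EL Es Eop kL x0 y0 Dx Dy.
rewrite exchange_big/= [X in _ * X]addrC.
have := H n E kappa L y x n0 ka0 L1 EL Eop kL y0 x0 Dx.
apply: le_trans; rewrite le_eqVlt; apply/orP; left; apply/eqP.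
by apply: eq_bigr => i _; apply: eq_bigr => j _; rewrite (Es j i); ring.
Qed.

(** The gap is quadratic at 0, so it can dominate [|t|] only up to an additive [tau]. Summed over
    the coordinates this error is [tau * n], which is charged to the final [eps * n]. *)
Lemma norm_le_power_gap (r tau : R) : 1 < r -> 0 < tau -> exists2 C : R, 0 < C &
  forall t, -1 <= t -> `|t| <= C * power_gap r (1 + t) + tau.
Proof.
move=> r1 tau0; have [k k0 Hk] := power_gap_ge_sqr r1.
have [l l0 Hl] := power_gap_ge_powR r1.
exists ((k * tau)^-1 + l^-1); first by rewrite addr_gt0 ?invr_gt0 ?mulr_gt0.
move=> t t1; have g0 : 0 <= power_gap r (1 + t) by apply: power_gap_ge0 => //; lra.
rewrite mulrDl; have kt0 : 0 < k * tau by rewrite mulr_gt0.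
have A0 : 0 <= (k * tau)^-1 * power_gap r (1 + t) by rewrite mulr_ge0// invr_ge0 ltW.
have B0 : 0 <= l^-1 * power_gap r (1 + t) by rewrite mulr_ge0// invr_ge0 ltW.
have [t2|/ltW t2] := leP t 1.
  have ti0 : 0 < tau^-1 by rewrite invr_gt0.
  have := mul_le_weighted_sqr `|t| 1 ti0.
  rewrite mulr1 expr1n mul1r invrK real_normK ?num_real// => H.
  have : tau^-1 * t ^+ 2 <= (k * tau)^-1 * power_gap r (1 + t).
    rewrite invfM [k^-1 * _]mulrC -mulrA ler_wpM2l ?(ltW ti0)//.
    by rewrite ler_pdivlMl// Hk// t1.
  lra.
rewrite ger0_norm; last lra.
have : t <= l^-1 * power_gap r (1 + t).
  rewrite ler_pdivlMl//; apply: le_trans (Hl t t2).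
  by rewrite ler_wpM2l ?(ltW l0)// le1r_powR// ltW.
lra.
Qed.

(** Young's inequality for the gaps with slope [e j / k]: the part in [x j] is charged to the
    available loss [k], and the conjugate gap of a small slope is quadratic with coefficient
    [(r' - 1) / 2 = (r - 1)^-1 / 2]. *)
Lemma linear_term (r g : R) : 1 < r -> 0 < g -> exists2 d : R, 0 < d &
  forall n (e x : 'I_n -> R) (k : R), 0 < k -> (forall j, `|e j| <= d * k) ->
  (forall j, 0 <= x j) ->
  \sum_j e j * (x j - 1) <= k * \sum_j power_gap r (x j) +
     (r - 1)^-1 / 2 * (1 + g) * (\sum_j e j ^+ 2) / k.
Proof.
move=> r1 g0; pose r' := r / (r - 1).
have rr' : r^-1 + r'^-1 = 1.
  by rewrite /r' invfM invrK; field; rewrite !gt_eqF//; lra.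
have [r'1 r'E] := conjugate_gt0 r1 rr'.
have [d d0 H] := power_gap_near1 r'1 g0.
exists (Num.min d 1); first by rewrite lt_min d0 ltr01.
move=> n e x k k0 ek x0.
rewrite !mulr_sumr mulr_suml -big_split/=; apply: ler_sum => j _.
have tk : `|e j / k| <= Num.min d 1.
  by rewrite normrM normfV (gtr0_norm k0) ler_pdivrMr.
have [td t1] : `|e j / k| <= d /\ `|e j / k| <= 1.
  by move: tk; rewrite le_min => /andP[].
have t0 : 0 <= 1 + e j / k by move: t1; rewrite ler_norml; lra.
have Y := power_gap_young r1 rr' (x0 j) t0.
have -> : e j * (x j - 1) = k * (e j / k * (x j - 1)) by field; rewrite gt_eqF.
apply: le_trans (ler_wpM2l (ltW k0) Y) _.
rewrite mulrDr lerD2l; apply: le_trans (ler_wpM2l (ltW k0) (H _ td)) _.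
rewrite r'E le_eqVlt; apply/orP; left; apply/eqP; field.
by rewrite !gt_eqF//; lra.
Qed.

(* The matrix [mu (J - I) + E], with [J] the all-ones matrix. *)
Definition zero_diag_add n (mu : R) (E : 'I_n -> 'I_n -> R) : 'M[R]_n :=
  \matrix_(i, j) ((i != j)%:R * mu + E i j).

Lemma bilin_expand n (mu : R) (E : 'I_n -> 'I_n -> R) (x y : 'I_n -> R) :
  (forall i j, E i j = E j i) ->
  bilin (zero_diag_add mu E) y x =
  mu * (\sum_i y i) * (\sum_i x i) - mu * (\sum_i y i * x i) +
  \sum_i \sum_j E i j + \sum_i (\sum_j E i j) * (x i - 1) +
  \sum_i (\sum_j E i j) * (y i - 1) +
  \sum_i \sum_j (y i - 1) * E i j * (x j - 1).
Proof.
move=> Es.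
have -> : \sum_i (\sum_j E i j) * (x i - 1) = \sum_i \sum_j E i j * (x j - 1).
  under eq_bigr do rewrite mulr_suml.
  by rewrite exchange_big; apply: eq_bigr => i _; apply: eq_bigr => j _; rewrite Es.
rewrite /bilin -!addrA -mulrA big_distrlr/= !mulr_sumr -sumrN -!big_split/=.
apply: eq_bigr => i _.
rewrite mulr_suml !mulr_sumr (_ : - (mu * _) = \sum_j - ((i == j)%:R * mu * (y i * x j))).
  rewrite -!big_split/=; apply: eq_bigr => j _; rewrite mxE.
  by case: eqVneq => _ /=; ring.
rewrite (bigD1 i)//= eqxx mul1r big1 ?addr0// => j ji.
by rewrite eq_sym (negbTE ji) !mul0r oppr0.
Qed.

Lemma sum_power_gap (n : nat) (r : R) (x : 'I_n -> R) : 0 < r ->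
  \sum_i x i `^ r = n%:R -> \sum_i power_gap r (x i) = n%:R - \sum_i x i.
Proof.
move=> r0 xr; rewrite /power_gap sumrB -mulr_suml !sumrB xr sumr_const card_ord.
by rewrite subrr mul0r sub0r opprB.
Qed.

Lemma prod_le_avg (D D' N g : R) : 0 <= D <= N -> 0 <= D' <= N ->
  D + D' <= 4 * g * N -> D * D' <= g * N * (D + D').
Proof.
move=> /andP[D0 DN] /andP[D'0 D'N] H.
have : 0 <= (D - D') ^+ 2 by exact: sqr_ge0.
have : (D + D') * (D + D') <= 4 * g * N * (D + D') by rewrite ler_wpM2r//; lra.
rewrite expr2; lra.
Qed.

(** The difference [y * x - (y + x - 1)] is [(y - 1) * (x - 1)]; when it is negative, the factor
    below 0 has modulus at most 1. *)
Lemma mul_ge_sub_norm (x y : R) : 0 <= x -> 0 <= y ->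
  y + x - 1 - `|x - 1| - `|y - 1| <= y * x.
Proof.
move=> x0 y0; have [?|?] := ger0P (x - 1); have [?|?] := ger0P (y - 1); nra.
Qed.

Lemma sum_norm_le_gap n (r C tau : R) (x : 'I_n -> R) :
  (forall t, -1 <= t -> `|t| <= C * power_gap r (1 + t) + tau) ->
  (forall i, 0 <= x i) ->
  \sum_i `|x i - 1| <= C * \sum_i power_gap r (x i) + tau * n%:R.
Proof.
move=> H x0; rewrite mulr_sumr mulr_natr -[n in tau *+ n]card_ord -sumr_const.
rewrite -big_split/=; apply: ler_sum => i _.
have := H (x i - 1); rewrite (addrC 1) subrK; apply.
by rewrite -lerBlDr opprK addrC subrr.
Qed.

Lemma sum_mul_ge n (x y : 'I_n -> R) (a b : R) :
  (forall i, 0 <= x i) -> (forall i, 0 <= y i) ->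
  \sum_i `|x i - 1| <= a -> \sum_i `|y i - 1| <= b ->
  \sum_i y i + \sum_i x i - n%:R - a - b <= \sum_i y i * x i.
Proof.
move=> x0 y0 xa yb.
have : \sum_i (y i + x i - 1 - `|x i - 1| - `|y i - 1|) <= \sum_i y i * x i.
  by apply: ler_sum => i _; exact: mul_ge_sub_norm.
rewrite !sumrB big_split/= sumr_const card_ord; lra.
Qed.

(** Here the linear term is optimized with [k = mu * N * (1 - 2 * g)], what is left of the loss once
    [g] is spent on the product of the deficits and [g / 2] each on the cross term and on the
    correction from the scalar product. For [g <= 1/8] the quotient [(1 + g) / (1 - 2 * g)] is at
    most [1 + 4 * g]. *)
Lemma upper_small_deficit (m0 K c g delta mu N V P eps : R) :
  0 < m0 -> 0 < c -> 0 < g -> g <= 8^-1 ->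
  c / m0 * (g * (4 * K + 1)) <= eps / 2 -> 0 < eps -> 0 < delta <= g ->
  m0 <= mu -> 0 < N -> V <= K * N ^+ 2 -> P <= 2 * V + delta * N ^+ 2 ->
  0 <= P ->
  c / 2 * (1 + g) * P / (mu * N * (1 - 2 * g)) <= c * V / (N * mu) + eps / 2 * N.
Proof.
move=> m00 c0 g0 g8 geps eps0 /andP[delta0 deg] mu0 N0 VK P2 P0.
have mugt : 0 < mu by exact: lt_le_trans mu0.
have munP : 0 < mu * N by rewrite mulr_gt0.
have q1' : (1 + g) / (1 - 2 * g) <= 1 + 4 * g.
  by move: g0 g8; clear; move=> g0 g8; rewrite ler_pdivrMr; [nra|lra].
have -> : c / 2 * (1 + g) * P / (mu * N * (1 - 2 * g)) =
   (c / 2 / (mu * N) * P) * ((1 + g) / (1 - 2 * g)).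
  by field; rewrite !gt_eqF//; move: g8; clear; lra.
have cP : c / 2 / (mu * N) * P <= c / 2 / (mu * N) * (2 * V + delta * N ^+ 2).
  by rewrite ler_wpM2l// !divr_ge0// ltW.
apply: le_trans (ler_pM _ _ cP q1') _.
- by rewrite mulr_ge0// !divr_ge0// ltW.
- by rewrite divr_ge0//; move: g0 g8; clear; lra.
have -> : c / 2 / (mu * N) * (2 * V + delta * N ^+ 2) * (1 + 4 * g) =
  c * V / (N * mu) +
  c / (mu * N) * (4 * g * V + (1 + 4 * g) * (delta * N ^+ 2) / 2).
  by field; rewrite !gt_eqF.
rewrite lerD2l.
have N2 : 0 <= N ^+ 2 by exact: sqr_ge0.
have in1 : 4 * g * V + (1 + 4 * g) * (delta * N ^+ 2) / 2 <= g * (4 * K + 1) * N ^+ 2.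
  have : g * V <= g * (K * N ^+ 2) by rewrite ler_wpM2l ?(ltW g0).
  have : delta * N ^+ 2 <= g * N ^+ 2 by rewrite ler_wpM2r.
  have : 4 * g * (delta * N ^+ 2) <= 1 * (delta * N ^+ 2).
    have g4 : 4 * g <= 1 by move: g8; clear; lra.
    by apply: ler_wpM2r => //; rewrite mulr_ge0// ltW.
  clear; lra.
apply: (@le_trans _ _ (c / (mu * N) * (g * (4 * K + 1) * N ^+ 2))).
  by rewrite ler_wpM2l// divr_ge0// ltW.
have -> : c / (mu * N) * (g * (4 * K + 1) * N ^+ 2) =
   c * (g * (4 * K + 1)) * N / mu by field; rewrite !gt_eqF.
rewrite ler_pdivrMr//.
have := geps; rewrite mulrAC ler_pdivrMr// => geps'.
have := ler_wpM2r (ltW N0) geps'.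
have : eps / 2 * N * m0 <= eps / 2 * N * mu.
  by rewrite ler_wpM2l// mulr_ge0// ?divr_ge0// ltW.
clear; lra.
Qed.

(** A deficit of order [N] costs order [N^2], whereas the linear term gains only order [N]. The loss
    is budgeted as follows: one half for the product of the deficits, at most 1/8 for the terms in
    [g], one quarter for the linear term with [k = mu * N / 4]; the remaining 1/8 absorbs the
    gain. *)
Lemma upper_large_deficit (m0 K c g delta mu N V P S : R) :
  0 < m0 -> 0 <= K -> 0 < c -> 0 < g -> g <= 8^-1 ->
  0 < delta -> delta <= 1 -> delta * (4 * c / m0 * (2 * K + 1)) <= m0 * g / 2 ->
  m0 <= mu -> 0 < N -> 1 <= delta * N -> V <= K * N ^+ 2 ->
  P <= 2 * V + delta * N ^+ 2 -> 0 <= P -> 4 * g * N <= S ->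
  c / 2 * (1 + g) * P / (mu * N / 4) <= mu * N * S / 8.
Proof.
move=> m00 K0 c0 g0 g8 delta0 delta1; set B := _ * (2 * K + 1) => de5 mu0 N0 dn VK P2 P0 S4.
have B0 : 0 < B by rewrite /B !mulr_gt0 ?invr_gt0//; move: K0; clear; lra.
have mugt : 0 < mu by exact: lt_le_trans mu0.
have munP : 0 < mu * N by rewrite mulr_gt0.
have P2' : P <= (2 * K + 1) * N ^+ 2.
  have : delta * N ^+ 2 <= 1 * N ^+ 2 by rewrite ler_wpM2r ?sqr_ge0.
  by move: VK P2; clear; lra.
have gP : c / 2 * (1 + g) * P / (mu * N / 4) <= B * N.
  rewrite ler_pdivrMr ?divr_gt0//.
  have c2 : c / 2 * (1 + g) * P <= c * P.
    have g1 : g <= 1 by move: g8; clear; lra.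
    by rewrite ler_wpM2r//; have := ler_wpM2l (ltW c0) g1; clear; lra.
  have c3 : c * P <= c * ((2 * K + 1) * N ^+ 2) by rewrite ler_wpM2l// ltW.
  have c4 : c * ((2 * K + 1) * N ^+ 2) = B * N * (m0 * N / 4).
    by rewrite /B; field; rewrite gt_eqF.
  apply: (le_trans c2); apply: (le_trans c3); rewrite c4.
  apply: ler_wpM2l; first by rewrite mulr_ge0// ltW.
  by have := ler_wpM2r (ltW N0) mu0; clear; lra.
clearbody B.
have BN1 : B * N <= m0 * g / 2 * N * N.
  have : B * N * 1 <= B * N * (delta * N).
    by rewrite ler_wpM2l// mulr_ge0// ltW.
  have : delta * B * (N * N) <= m0 * g / 2 * (N * N).
    by rewrite ler_wpM2r// mulr_ge0// ltW.
  clear; lra.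
have : mu * N * (4 * g * N) <= mu * N * S by rewrite ler_wpM2l// ltW.
have : m0 * (g * N * N) <= mu * (g * N * N).
  by rewrite ler_wpM2r// !mulr_ge0// ltW.
move: BN1 gP; clear; lra.
Qed.

(* The real-number core of [bilin_upper]: [D] and [D'] are the gap sums of [x] and [y], [P] the
   sum of the squared row sums, [XY] the scalar product, [l] and [cr] the linear and the cross
   term of [bilin_expand]. If [D + D'] is small against [N] then [D * D'] is negligible in front
   of [N * (D + D')]; otherwise the loss [mu * N * (D + D')] dominates everything. *)
Lemma upper_arith (m0 M0 K c C1 C2 g tau eps delta mu N V P D D' XY l cr : R) :
  0 < m0 -> 0 <= K -> 0 < c -> 0 < C1 -> 0 < C2 -> 0 < g -> g <= 8^-1 ->
  c / m0 * (g * (4 * K + 1)) <= eps / 2 -> 0 < eps ->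
  0 < tau -> 2 * M0 * tau <= eps / 2 -> 0 < delta <= g ->
  delta * (2 * (1 + (C1 + C2))) <= g ->
  delta * (4 * c / m0 * (2 * K + 1)) <= m0 * g / 2 ->
  m0 <= mu <= M0 -> 0 < N -> 1 <= delta * N -> 0 <= V <= K * N ^+ 2 ->
  P <= 2 * V + delta * N ^+ 2 -> 0 <= P -> 0 <= D <= N -> 0 <= D' <= N ->
  (N - D') + (N - D) - N - (C1 * D + tau * N) - (C2 * D' + tau * N) <= XY ->
  cr <= g * m0 / 2 * N * (D + D') ->
  (forall k, 3 / 4 * (mu * N) <= 3 * k -> 0 < k ->
    l <= k * (D + D') + c / 2 * (1 + g) * P / k) ->
  mu * (N - D') * (N - D) - mu * XY + l + cr <=
  mu * N * (N - 1) + c * V / (N * mu) + eps * N.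
Proof.
move=> m00 K0 c0 C10 C20 g0 g8 geps eps0 tau0 tauE dg de4 de5 /andP[mu0 muM] N0 dn.
move=> /andP[V0 VK] P2 P0 DN D'N xy crossE lin.
have mugt : 0 < mu by exact: lt_le_trans mu0.
have [D0 D'0] : 0 <= D /\ 0 <= D' by case/andP: DN => ->; case/andP: D'N => ->.
have S0 : 0 <= D + D' by exact: addr_ge0.
have munP : 0 < mu * N by rewrite mulr_gt0.
have [delta0 deg] := andP dg.
have delta1 : delta <= 1 by move: g8 deg; clear; lra.
have crS : cr <= g / 2 * mu * N * (D + D').
  apply: le_trans crossE _; rewrite ler_wpM2r// ler_wpM2r ?(ltW N0)//.
  by rewrite mulrAC ler_wpM2l// divr_ge0// ltW.
have CS : mu * (1 + (C1 + C2)) * (D + D') <= g / 2 * mu * N * (D + D').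
  rewrite ler_wpM2r//; have -> : g / 2 * mu * N = mu * (g / 2 * N) by clear; ring.
  rewrite ler_wpM2l ?(ltW mugt)//.
  have : 1 * (1 + (C1 + C2)) <= delta * N * (1 + (C1 + C2)).
    by rewrite ler_wpM2r// !addr_ge0// ltW.
  have : delta * (2 * (1 + (C1 + C2))) * N <= g * N by rewrite ler_wpM2r// ltW.
  clear; lra.
have CD : mu * (C1 * D + C2 * D') <= mu * (C1 + C2) * (D + D').
  have : 0 <= mu * C1 * D' by rewrite !mulr_ge0// ltW.
  have : 0 <= mu * C2 * D by rewrite !mulr_ge0// ltW.
  clear; lra.
have tauN : 2 * mu * tau * N <= eps / 2 * N.
  have : mu * (2 * tau * N) <= M0 * (2 * tau * N).
    by rewrite ler_wpM2r// !mulr_ge0// ltW.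
  have := ler_wpM2r (ltW N0) tauE; clear; lra.
have muxy := ler_wpM2l (ltW mugt) xy.
have main : mu * (N - D') * (N - D) - mu * XY + l + cr <=
    mu * N * (N - 1) + (mu * (D * D') - mu * N * (1 - g) * (D + D')) +
    eps / 2 * N + l.
  by move: muxy tauN CD CS crS; clear; lra.
apply: le_trans main _.
have [S4|/ltW S4] := leP (D + D') (4 * g * N).
- have muDD := ler_wpM2l (ltW mugt) (prod_le_avg DN D'N S4).
  have k0 : 0 < mu * N * (1 - 2 * g) by rewrite mulr_gt0//; move: g8; clear; lra.
  have k1 : 3 / 4 * (mu * N) <= 3 * (mu * N * (1 - 2 * g)).
    by move: munP g8; clear; nra.
  have LL := lin _ k1 k0.
  have VP := upper_small_deficit m00 c0 g0 g8 geps eps0 dg mu0 N0 VK P2 P0.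
  by move: VP LL muDD; clear; lra.
- have S2 : D + D' <= 4 * 2^-1 * N.
    by case/andP: DN => _; case/andP: D'N => _; clear; lra.
  have muDD := ler_wpM2l (ltW mugt) (prod_le_avg DN D'N S2).
  have k0 : 0 < mu * N / 4 by rewrite divr_gt0.
  have k1 : 3 / 4 * (mu * N) <= 3 * (mu * N / 4) by clear; lra.
  have LL := lin _ k1 k0.
  have gP := upper_large_deficit m00 K0 c0 g0 g8 delta0 delta1 de5 mu0 N0 dn VK P2 P0 S4.
  have gS2 : g * (mu * N * (D + D')) <= 8^-1 * (mu * N * (D + D')).
    by rewrite ler_wpM2r// mulr_ge0// ltW.
  have cV : 0 <= c * V / (N * mu) by rewrite divr_ge0 ?mulr_ge0// ltW.
  have eN : 0 <= eps * N by rewrite mulr_ge0// ltW.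
  by move: gS2 cV eN gP LL muDD; clear; lra.
Qed.

(** The exponent [m] is chosen before [eps], so the order of the moments needed to control [L] is
    fixed once and for all. *)
Lemma bilin_upper (r q m0 M0 K : R) : 1 < r -> 1 < q -> r^-1 + q^-1 <= 1 ->
  0 < m0 -> 0 < M0 -> 0 <= K -> exists m : nat,
  forall eps : R, 0 < eps -> exists2 delta : R, 0 < delta &
  forall (n : nat) (E : 'I_n -> 'I_n -> R) (mu V kappa L : R) (x y : 'I_n -> R),
  (0 < n)%N -> 1 <= delta * n%:R -> m0 <= mu <= M0 -> 0 <= V <= K * n%:R ^+ 2 ->
  0 <= kappa -> 1 <= L -> (forall i j, E i j ^+ 2 <= L) ->
  (forall i j, E i j = E j i) ->
  (forall v : 'I_n -> R,
     \sum_j (\sum_i v i * E i j) ^+ 2 <= kappa * \sum_i v i ^+ 2) ->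
  kappa * L ^+ m <= delta * n%:R ^+ 2 ->
  (forall i, `|\sum_j E i j| <= delta * n%:R) ->
  \sum_i (\sum_j E i j) ^+ 2 <= 2 * V + delta * n%:R ^+ 2 ->
  (forall i, 0 <= x i) -> (forall i, 0 <= y i) ->
  \sum_i x i `^ r = n%:R -> \sum_i y i `^ q = n%:R ->
  bilin (zero_diag_add mu E) y x <=
  mu * n%:R * (n%:R - 1) + \sum_i \sum_j E i j +
  ((r - 1)^-1 + (q - 1)^-1) * V / (n%:R * mu) + eps * n%:R.
Proof.
move=> r1 q1 rq m00 M00 K0; have [m Hm] := cross_term_sym r1 q1 rq.
exists m => eps eps0.
pose c := (r - 1)^-1 + (q - 1)^-1.
have c0 : 0 < c by rewrite addr_gt0// invr_gt0; lra.
have [g [g0 g8 geps]] : exists g : R,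
    [/\ 0 < g, g <= 8^-1 & c / m0 * (g * (4 * K + 1)) <= eps / 2].
  have cK : 0 < c / m0 * (4 * K + 1) by rewrite mulr_gt0 ?divr_gt0//; lra.
  exists (Num.min 8^-1 (eps / 2 / (c / m0 * (4 * K + 1)))); split.
  - by rewrite lt_min divr_gt0//; lra.
  - by rewrite ge_min lexx.
  - by rewrite mulrCA -ler_pdivlMr// ge_min lexx orbT.
have [d1 d10 lin1] := linear_term r1 g0.
have [d2 d20 lin2] := linear_term q1 g0.
have [tau [tau0 tauE]] : exists tau : R, 0 < tau /\ 2 * M0 * tau <= eps / 2.
  exists (eps / (4 * M0)); split; first by rewrite divr_gt0//; lra.
  by rewrite le_eqVlt; apply/orP; left; apply/eqP; field; rewrite gt_eqF.
have [C1 C10 abs1] := norm_le_power_gap r1 tau0.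
have [C2 C20 abs2] := norm_le_power_gap q1 tau0.
have th0 : 0 < g * m0 / 2 by rewrite divr_gt0// mulr_gt0.
have [d3 d30 cross] := Hm _ th0.
pose d4 := g / (2 * (1 + (C1 + C2))); have d40 : 0 < d4.
  by rewrite divr_gt0//; move: C10 C20; clear; lra.
pose B := 4 * c / m0 * (2 * K + 1).
have B0 : 0 < B by rewrite /B !mulr_gt0 ?invr_gt0//; lra.
pose d5 := m0 * g / 2 / B; have d50 : 0 < d5 by rewrite !divr_gt0// ?mulr_gt0.
(* Every slope [k] to be used is at least [mu * n / 4], so row sums of size at most [d6 * n] stay
   within the ranges [d1 * k] and [d2 * k] of [linear_term]. *)
pose d6 := Num.min d1 d2 * m0 / 4.
have d60 : 0 < d6 by rewrite divr_gt0// mulr_gt0// lt_min d10.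
pose delta := Num.min (Num.min d3 d4) (Num.min (Num.min d5 d6) g).
have delta0 : 0 < delta by rewrite !lt_min d30 d40 d50 d60 g0.
have de3 : delta <= d3 by rewrite !ge_min lexx ?orbT.
have de4 : delta * (2 * (1 + (C1 + C2))) <= g.
  by rewrite -ler_pdivlMr ?ge_min ?lexx ?orbT//; move: C10 C20; clear; lra.
have de5 : delta * B <= m0 * g / 2 by rewrite -ler_pdivlMr// !ge_min lexx ?orbT.
have de6 : delta <= d6 by rewrite !ge_min lexx ?orbT.
have deg : delta <= g by rewrite !ge_min lexx ?orbT.
clearbody delta.
exists delta => // n E mu V kappa L x y n0 dn /andP[mu0 muM] /andP[V0 VK].
move=> ka0 L1 EL Es Eop kL eb P2 x0 y0 xr yq.
have N0 : 0 < n%:R :> R by rewrite ltr0n.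
have r0 : 0 < r by exact: lt_trans r1.
have q0 : 0 < q by exact: lt_trans q1.
set P := \sum_i (\sum_j E i j) ^+ 2 in P2.
pose D := \sum_i power_gap r (x i); pose D' := \sum_i power_gap q (y i).
have DE : D = n%:R - \sum_i x i by apply: sum_power_gap.
have D'E : D' = n%:R - \sum_i y i by apply: sum_power_gap.
have D0 : 0 <= D by apply: sumr_ge0 => i _; exact: power_gap_ge0.
have D'0 : 0 <= D' by apply: sumr_ge0 => i _; exact: power_gap_ge0.
have Dn : D <= n%:R by rewrite DE lerBlDr lerDl sumr_ge0.
have D'n : D' <= n%:R by rewrite D'E lerBlDr lerDl sumr_ge0.
have crossE := cross n E kappa L x y n0 ka0 L1 EL Es Eop
  (le_trans kL (ler_wpM2r (sqr_ge0 _) de3)) x0 y0 Dn D'n.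
rewrite -/D -/D' in crossE.
have P0 : 0 <= P by apply: sumr_ge0 => i _; exact: sqr_ge0.
have lin k : 3 / 4 * (mu * n%:R) <= 3 * k -> 0 < k ->
    \sum_i (\sum_j E i j) * (x i - 1) + \sum_i (\sum_j E i j) * (y i - 1) <=
    k * (D + D') + c / 2 * (1 + g) * P / k.
  move=> kmu k0.
  have ek i : `|\sum_j E i j| <= Num.min d1 d2 * k.
    apply: le_trans (eb i) _; apply: (@le_trans _ _ (d6 * n%:R)).
      by rewrite ler_wpM2r// ltW.
    rewrite /d6 -!mulrA ler_wpM2l ?le_min ?(ltW d10) ?(ltW d20)//.
    have : m0 * n%:R <= mu * n%:R by rewrite ler_wpM2r// ltW.
    by move: kmu; clear; lra.
  have ek1 i : `|\sum_j E i j| <= d1 * k.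
    by apply: le_trans (ek i) _; rewrite ler_wpM2r ?(ltW k0)// ge_min lexx.
  have ek2 i : `|\sum_j E i j| <= d2 * k.
    by apply: le_trans (ek i) _; rewrite ler_wpM2r ?(ltW k0)// ge_min lexx orbT.
  have := lin1 n _ x k k0 ek1 x0; have := lin2 n _ y k k0 ek2 y0.
  rewrite -/D -/D' -/P.
  have -> : c / 2 * (1 + g) * P / k =
    (r - 1)^-1 / 2 * (1 + g) * P / k + (q - 1)^-1 / 2 * (1 + g) * P / k.
    by rewrite /c; clear; ring.
  clear; lra.
have xy := sum_mul_ge x0 y0 (sum_norm_le_gap abs1 x0) (sum_norm_le_gap abs2 y0).
have sx : \sum_i x i = n%:R - D by rewrite DE subKr.
have sy : \sum_i y i = n%:R - D' by rewrite D'E subKr.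
rewrite bilin_expand// -/D -/D' sx sy in xy *.
have muMM : m0 <= mu <= M0 by rewrite mu0.
have dg : 0 < delta <= g by rewrite delta0.
have VV : 0 <= V <= K * n%:R ^+ 2 by rewrite V0.
have DD : 0 <= D <= n%:R by rewrite D0.
have DD' : 0 <= D' <= n%:R by rewrite D'0.
have := upper_arith m00 K0 c0 C10 C20 g0 g8 geps eps0 tau0 tauE dg de4 de5 muMM N0 dn VV P2 P0
  DD DD' xy crossE lin.
by rewrite /c; clear; lra.
Qed.

End bilinear_upper_bound.

(** * Lower bound for the operator norm *)

Section bilinear_lower_bound.
Context {R : realType}.

Lemma le_norm_of_sqr (a b : R) : 0 <= b -> a ^+ 2 <= b ^+ 2 -> `|a| <= b.
Proof. by move=> b0 ab; rewrite -(ger0_norm b0) -ler_sqr ?nnegrE// !real_normK ?num_real. Qed.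

(* The real-number core of [bilin_lower]: [T] is the sum of the row sums, [P] that of their
   squares, [R1] the remaining terms of the bilinear form [B] at the test vectors, and [expR w]
   bounds the product of their normalized norms. *)
Lemma lower_arith (m0 M0 c K1 C4 C3 C5 g delta eps mu N T P V R1 w B op : R) :
  0 < m0 -> 0 < c -> 0 <= K1 -> 0 <= C4 -> 0 < g <= 1 -> 0 < delta <= 1 ->
  C3 = c * K1 / m0 ^+ 2 + c / m0 -> C5 = M0 + 1 + c + c * K1 / m0 + C4 ->
  g * (c * K1 / m0) <= eps ->
  delta * (C4 + 4 * C3 * C5 + c / m0) <= eps / 2 ->
  m0 <= mu <= M0 -> 0 < N -> 1 <= delta * N ->
  T ^+ 2 <= delta * N ^+ 3 -> 0 <= P <= K1 * N ^+ 2 -> 2 * V - delta * N ^+ 2 <= P ->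
  `|R1| <= C4 * delta * N ->
  B = mu * N * (N - 1) + (1 + c) * T + c * P / (mu * N) + R1 -> 0 <= B ->
  w = (c / 2 * (1 + g) * P / (mu * N) ^+ 2 + c * T / (mu * N)) / N ->
  B <= N * expR w * op ->
  mu * N * (N - 1) + T + c * V / (N * mu) - eps * N <= N * op.
Proof.
move=> m00 c0 K10 C40 /andP[g0 g1] /andP[d0 d1] C3E C5E geps deps /andP[mu0 muM].
move=> N0 dN TT /andP[P0 PK] VP R1b BE B0 wE Bop.
have mugt : 0 < mu by exact: lt_le_trans mu0.
have munP : 0 < mu * N by rewrite mulr_gt0.
(* Dividing by the excess of the norms is replaced by multiplying by [1 - w <= expR (- w)], which is
   legitimate because [B >= 0]. *)
have Bw : B * (1 - w) <= N * op.
  have : B * expR (- w) <= N * op.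
    by rewrite expRN ler_pdivrMr ?expR_gt0// mulrAC.
  by apply: le_trans; rewrite ler_wpM2l// expR_ge1Dx.
apply: le_trans Bw.
pose R2 := - mu * N + (1 + c) * T + c * P / (mu * N) + R1.
have BE2 : B = mu * N ^+ 2 + R2 by rewrite BE /R2; clear; ring.
(* The normalization costs [mu * N^2 * w], that is [c * T] and slightly more than half of
   [c * P / (mu * N)]. What survives is one copy of [T] and almost half of the quadratic gain. *)
have -> : B * (1 - w) = mu * N * (N - 1) + T + c / 2 * (1 - g) * P / (mu * N) + R1 - R2 * w.
  have -> : B * (1 - w) = B - mu * N ^+ 2 * w - R2 * w by rewrite BE2; clear; ring.
  congr (_ - _); rewrite BE wE; field.
  by rewrite !gt_eqF.
have t0 : 0 <= `|T| by [].
have P1 : P / (mu * N) <= K1 / m0 * N.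
  rewrite ler_pdivrMr//; apply: le_trans PK _.
  have -> : K1 / m0 * N * (mu * N) = (K1 / m0 * N ^+ 2) * mu by clear; ring.
  have -> : K1 * N ^+ 2 = (K1 / m0 * N ^+ 2) * m0 by field; rewrite gt_eqF.
  by rewrite ler_wpM2l// mulr_ge0 ?sqr_ge0// divr_ge0// ltW.
have P1' : 0 <= P / (mu * N) by rewrite divr_ge0// ltW.
have imu : mu^-1 <= m0^-1 by rewrite lef_pV2.
have imu0 : 0 <= mu^-1 by rewrite invr_ge0 ltW.
have C30 : 0 <= C3.
  by rewrite C3E addr_ge0 ?divr_ge0 ?mulr_ge0 ?exprn_ge0// ltW.
have wb : `|w| <= C3 * (N^-1 + `|T| / N ^+ 2).
  have w1 : `|c / 2 * (1 + g) * P / (mu * N) ^+ 2 / N| <= c * K1 / m0 ^+ 2 / N.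
    rewrite ger0_norm; last first.
      have g3 : 0 <= 1 + g by rewrite addr_ge0// ltW.
      by rewrite !mulr_ge0 ?invr_ge0 ?exprn_ge0 ?(ltW munP) ?(ltW N0) ?(ltW c0).
    rewrite ler_wpM2r ?invr_ge0 ?(ltW N0)//.
    have -> : c / 2 * (1 + g) * P / (mu * N) ^+ 2 =
      c * ((1 + g) / 2) * (P / (mu * N)) * (mu^-1 / N).
      by field; rewrite !gt_eqF.
    have -> : c * K1 / m0 ^+ 2 = c * 1 * (K1 / m0 * N) * (m0^-1 / N).
      by field; rewrite !gt_eqF.
    have g2 : (1 + g) / 2 <= 1 by move: g1; clear; lra.
    have g3 : 0 <= (1 + g) / 2 by move: g0; clear; lra.
    apply: ler_pM => //.
    - by rewrite mulr_ge0// mulr_ge0// ltW.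
    - by rewrite divr_ge0 ?(ltW N0).
    - by apply: ler_pM => //; [rewrite mulr_ge0// ltW|rewrite ler_wpM2l// ltW].
    - by rewrite ler_wpM2r// invr_ge0 ltW.
  have w2 : `|c * T / (mu * N) / N| <= c / m0 * (`|T| / N ^+ 2).
    have -> : c * T / (mu * N) / N = c * mu^-1 * (T / N ^+ 2) by field; rewrite !gt_eqF.
    rewrite normrM [ `|T / _| ]normrM [ `|(N ^+ 2)^-1| ]ger0_norm ?invr_ge0 ?sqr_ge0//.
    rewrite ler_wpM2r ?divr_ge0 ?sqr_ge0// ger0_norm ?mulr_ge0 ?(ltW c0)//.
    by rewrite ler_wpM2l// ltW.
  have -> : w = c / 2 * (1 + g) * P / (mu * N) ^+ 2 / N + c * T / (mu * N) / N.
    by rewrite wE mulrDl.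
  apply: le_trans (ler_normD _ _) _; apply: le_trans (lerD w1 w2) _.
  rewrite C3E mulrDr; apply: lerD.
    by rewrite ler_wpM2r ?invr_ge0 ?(ltW N0)// lerDl divr_ge0// ltW.
  by rewrite ler_wpM2r ?divr_ge0 ?sqr_ge0// lerDr divr_ge0 ?mulr_ge0 ?sqr_ge0// ltW.
have C4d : C4 * delta * N <= C4 * N.
  by rewrite ler_wpM2r ?(ltW N0)// ler_piMr.
have R2b : `|R2| <= C5 * (N + `|T|).
  have cP : c * (P / (mu * N)) <= c * (K1 / m0 * N) by rewrite ler_wpM2l// ltW.
  have muN : mu * N <= M0 * N by rewrite ler_wpM2r// ltW.
  have cP0 : 0 <= c * (P / (mu * N)) by rewrite mulr_ge0// ltW.
  have b1 : `|R2| <= M0 * N + (1 + c) * `|T| + c * (K1 / m0 * N) + C4 * N.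
    rewrite /R2; apply: le_trans (ler_normD _ _) _; apply: lerD; last exact: le_trans C4d.
    apply: le_trans (ler_normD _ _) _; apply: lerD; last first.
      by rewrite -mulrA ger0_norm.
    apply: le_trans (ler_normD _ _) _; apply: lerD.
      by rewrite mulNr normrN ger0_norm// ltW.
    by rewrite normrM ger0_norm// addr_ge0// ltW.
  apply: le_trans b1 _; rewrite C5E.
  have M00 : 0 <= M0 by apply: le_trans muM; exact: ltW.
  have e1 : 0 <= (1 + c) * N by rewrite mulr_ge0 ?addr_ge0// ltW.
  have e2 : 0 <= (M0 + c * K1 / m0 + C4) * `|T|.
    by rewrite mulr_ge0// !addr_ge0// divr_ge0 ?mulr_ge0// ltW.
  by move: e1 e2; clear; lra.
(* The product is of order [(1 + |T| / N)^2], hence at most [2 + 2 * T^2 / N^2]; both terms are at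
   most [2 * delta * N] by [1 <= delta * N] and the bound on [T]. *)
have R2w : R2 * w <= 4 * C3 * C5 * delta * N.
  apply: le_trans (ler_norm _) _; rewrite normrM.
  apply: le_trans (ler_pM _ _ R2b wb) _ => //.
  have C50 : 0 <= C5.
    rewrite C5E !addr_ge0 ?divr_ge0 ?mulr_ge0 ?(ltW c0) ?(ltW m00)//.
    by apply: le_trans muM; exact: ltW.
  have -> : C5 * (N + `|T|) * (C3 * (N^-1 + `|T| / N ^+ 2)) =
     C3 * C5 * (1 + 2 * (`|T| / N) + `|T| ^+ 2 / N ^+ 2).
    by field; rewrite gt_eqF.
  have -> : 4 * C3 * C5 * delta * N = C3 * C5 * (4 * (delta * N)) by clear; ring.
  rewrite ler_wpM2l ?mulr_ge0//.
  have : `|T| ^+ 2 / N ^+ 2 <= delta * N.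
    rewrite real_normK ?num_real// ler_pdivrMr ?exprn_gt0//.
    by have -> : delta * N * N ^+ 2 = delta * N ^+ 3 by ring.
  have : 0 <= (`|T| / N - 1) ^+ 2 by exact: sqr_ge0.
  have -> : (`|T| / N - 1) ^+ 2 = `|T| ^+ 2 / N ^+ 2 - 2 * (`|T| / N) + 1.
    by field; rewrite gt_eqF.
  by move: dN; clear; lra.
have Pg : c / 2 * (1 - g) * P / (mu * N) >=
    c * V / (N * mu) - c / m0 * delta * N - eps / 2 * N.
  have -> : c / 2 * (1 - g) * P / (mu * N) =
    c / 2 * (P / (mu * N)) - g * (c / 2) * (P / (mu * N)) by clear; ring.
  have q1 : g * (c / 2) * (P / (mu * N)) <= eps / 2 * N.
    apply: (@le_trans _ _ (g * (c / 2) * (K1 / m0 * N))).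
      by rewrite ler_wpM2l// mulr_ge0// ?divr_ge0// ltW.
    have := ler_wpM2r (ltW N0) geps; clear; lra.
  have q2 : c / 2 * (P / (mu * N)) >= c / 2 * ((2 * V - delta * N ^+ 2) / (mu * N)).
    by rewrite ler_wpM2l ?divr_ge0 ?(ltW c0)// ler_wpM2r// invr_ge0 ltW.
  have q3 : c / 2 * ((2 * V - delta * N ^+ 2) / (mu * N)) =
     c * V / (N * mu) - c / 2 * delta * N * mu^-1 by field; rewrite !gt_eqF.
  have q4 : c / 2 * delta * N * mu^-1 <= c / 2 * delta * N * m0^-1.
    by rewrite ler_wpM2l// !mulr_ge0 ?invr_ge0// ltW.
  have q5 : 0 <= c * delta * N * m0^-1 by rewrite !mulr_ge0 ?invr_ge0// ltW.
  by move: q1 q2 q3 q4 q5; clear; lra.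
have := ler_wpM2r (ltW N0) deps.
have : - (C4 * delta * N) <= R1 by move: R1b; rewrite ler_norml => /andP[].
by move: Pg R2w; clear; lra.
Qed.

Lemma sqr_bilin_le n (E : 'I_n -> 'I_n -> R) (kappa : R) (u v : 'I_n -> R) :
  (forall v : 'I_n -> R,
     \sum_j (\sum_i v i * E i j) ^+ 2 <= kappa * \sum_i v i ^+ 2) ->
  (\sum_i \sum_j v i * E i j * u j) ^+ 2 <=
    kappa * (\sum_i v i ^+ 2) * (\sum_i u i ^+ 2).
Proof.
move=> Eop; rewrite exchange_big/=; under eq_bigr do rewrite -mulr_suml.
apply: le_trans (sqr_sum_le _ _) _.
by apply: ler_wpM2r (Eop v); apply: sumr_ge0 => i _; exact: sqr_ge0.
Qed.

Lemma bilin_lower (p r q m0 M0 K : R) : 1 < p -> p^-1 + q^-1 = 1 -> 1 < r ->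
  0 < m0 -> 0 < M0 -> 0 <= K ->
  forall eps : R, 0 < eps -> exists2 delta : R, 0 < delta &
  forall (n : nat) (E : 'I_n -> 'I_n -> R) (mu V kappa : R),
  (0 < n)%N -> 1 <= delta * n%:R -> m0 <= mu <= M0 -> 0 <= V <= K * n%:R ^+ 2 ->
  0 <= kappa -> (forall i j, E i j = E j i) ->
  (forall i j, 0 <= zero_diag_add mu E i j) ->
  (forall v : 'I_n -> R,
     \sum_j (\sum_i v i * E i j) ^+ 2 <= kappa * \sum_i v i ^+ 2) ->
  kappa <= (delta * n%:R) ^+ 2 ->
  (forall i, `|\sum_j E i j| <= delta * n%:R) ->
  (\sum_i \sum_j E i j) ^+ 2 <= delta * n%:R ^+ 3 ->
  `|\sum_i (\sum_j E i j) ^+ 2 - 2 * V| <= delta * n%:R ^+ 2 ->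
  mu * n%:R * (n%:R - 1) + \sum_i \sum_j E i j +
  ((r - 1)^-1 + (q - 1)^-1) * V / (n%:R * mu) - eps * n%:R <=
  n%:R * opnorm r p (n%:R `^ (- (p^-1 - r^-1)) *: zero_diag_add mu E).
Proof.
move=> p1 pq r1 m00 M00 K0 eps eps0.
have [q1 _] := conjugate_gt0 p1 pq.
have r0 : 0 < r by exact: lt_trans r1. have q0 : 0 < q by exact: lt_trans q1.
have [a [aE a0]] : exists a, a = (r - 1)^-1 /\ 0 < a.
  by exists (r - 1)^-1; rewrite invr_gt0 subr_gt0.
have [b [bE b0]] : exists b, b = (q - 1)^-1 /\ 0 < b.
  by exists (q - 1)^-1; rewrite invr_gt0 subr_gt0.
have [c [cE c0]] : exists c, c = a + b /\ 0 < c.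
  by exists (a + b); rewrite addr_gt0.
have [K1 [K1E K10]] : exists K1, K1 = 2 * K + 1 /\ 0 < K1.
  by exists (2 * K + 1); rewrite ltr_wpDl// mulr_ge0.
have [C4 [C4E C40]] : exists C4, C4 = a * b / m0 + 2 * c + a * b * K1 / m0 +
    a * b * K1 / m0 ^+ 2 /\ 0 < C4.
  by eexists; split; [reflexivity|]; rewrite !addr_gt0 ?divr_gt0 ?mulr_gt0 ?exprn_gt0.
have [C3 [C3E C30]] : exists C3, C3 = c * K1 / m0 ^+ 2 + c / m0 /\ 0 < C3.
  by eexists; split; [reflexivity|]; rewrite addr_gt0 ?divr_gt0 ?mulr_gt0 ?exprn_gt0.
have [C5 [C5E C50]] : exists C5, C5 = M0 + 1 + c + c * K1 / m0 + C4 /\ 0 < C5.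
  by eexists; split; [reflexivity|]; rewrite !addr_gt0 ?divr_gt0 ?mulr_gt0.
have cK0 : 0 < c * K1 / m0 by rewrite divr_gt0 ?mulr_gt0.
pose g := Num.min 1 (eps / (c * K1 / m0)).
have g0 : 0 < g by rewrite lt_min ltr01 divr_gt0.
have g01 : 0 < g <= 1 by rewrite g0 ge_min lexx.
have geps : g * (c * K1 / m0) <= eps by rewrite -ler_pdivlMr// ge_min lexx orbT.
have [d1 d10 h1] := power_gap_near1 r1 g0.
have [d2 d20 h2] := power_gap_near1 q1 g0.
pose C6 := C4 + 4 * C3 * C5 + c / m0.
have C60 : 0 < C6 by rewrite !addr_gt0 ?divr_gt0 ?mulr_gt0.
(* The 1 keeps the test vectors nonnegative; [d1] and [d2] keep their displacements within the range
   of the quadratic gap bounds. *)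
pose d3 := Num.min 1 (Num.min d1 d2).
have d30 : 0 < d3 by rewrite !lt_min ltr01 d10.
pose delta := Num.min 1 (Num.min (eps / 2 / C6) (d3 * m0 / c)).
have delta0 : 0 < delta by rewrite !lt_min ltr01 !divr_gt0 ?mulr_gt0//.
have delta1 : 0 < delta <= 1 by rewrite delta0 ge_min lexx.
have de6 : delta * C6 <= eps / 2 by rewrite -ler_pdivlMr// !ge_min lexx !orbT.
have de3 : delta * c <= d3 * m0 by rewrite -ler_pdivlMr// !ge_min lexx !orbT.
clearbody g delta.
exists delta => // n E mu V kappa n0 dN mub VK ka0 Es A0 Eop kd eb TT PV.
have N0 : 0 < n%:R :> R by rewrite ltr0n.
have [mu0 muM] := andP mub. have [V0 VKn] := andP VK.
have mugt : 0 < mu by exact: lt_le_trans mu0.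
have munP : 0 < mu * n%:R by rewrite mulr_gt0.
pose e i := \sum_j E i j.
pose P := \sum_i e i ^+ 2; pose T := \sum_i e i.
have P0 : 0 <= P by apply: sumr_ge0 => i _; exact: sqr_ge0.
move: PV; rewrite -/P ler_norml => /andP[PV1 PV2].
have dN2 : delta * n%:R ^+ 2 <= n%:R ^+ 2.
  by rewrite ler_piMl ?sqr_ge0//; case/andP: delta1.
have PK : 0 <= P <= K1 * n%:R ^+ 2.
  by rewrite P0/=; move: PV2 VKn dN2; rewrite K1E; clear; lra.
have PV : 2 * V - delta * n%:R ^+ 2 <= P by move: PV1; clear; lra.
(* The test vectors are [x i = 1 + a * t i] and [y i = 1 + b * t i], the critical point of the
   second-order expansion. *)
pose t i := e i / (mu * n%:R).
have te i : `|c * t i| <= d3.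
  rewrite /t normrM gtr0_norm// normrM normfV (gtr0_norm munP) mulrA ler_pdivrMr//.
  apply: (@le_trans _ _ (c * (delta * n%:R))); first by exact: (ler_wpM2l (ltW c0) (eb i)).
  rewrite [d3 * _]mulrA mulrA [c * _]mulrC; apply: (@le_trans _ _ (d3 * m0 * n%:R)).
    by rewrite ler_wpM2r// ltW.
  by apply: ler_wpM2r; [exact: ltW|apply: ler_wpM2l => //; exact: ltW].
have small s : 0 < s -> s <= c -> forall i, `|s * t i| <= d3.
  move=> s0 sc i; apply: le_trans (te i).
  by rewrite !normrM ler_wpM2r// !gtr0_norm.
have ta := small a a0 (_ : a <= c); have tb := small b b0 (_ : b <= c).
have {}ta i : `|a * t i| <= d3 by apply: ta; rewrite cE lerDl ltW.
have {}tb i : `|b * t i| <= d3 by apply: tb; rewrite cE lerDr ltW.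
have sumt : \sum_i t i = T / (mu * n%:R) by rewrite /T mulr_suml.
have sumt2 : \sum_i t i ^+ 2 = P / (mu * n%:R) ^+ 2.
  by rewrite /P mulr_suml; apply: eq_bigr => i _; rewrite expr_div_n.
(* Each power is [1 + z * (gap + displacement)]. For [s = (z - 1)^-1] the gap of [1 + s * t i] is at
   most [s / 2 * (1 + g) * t i ^+ 2], and [1 + x <= expR x] puts the sum in the form required by
   [opnorm_ge_bilin]. *)
have scaled (z s d : R) : 1 < z -> s = (z - 1)^-1 -> d3 <= d ->
    (forall u : R, `|u| <= d -> power_gap z (1 + u) <= (z - 1) / 2 * (1 + g) * u ^+ 2) ->
    (forall i, `|s * t i| <= d3) ->
    \sum_i (1 + s * t i) `^ z <= n%:R *
      expR (z * ((s / 2 * (1 + g) * P / (mu * n%:R) ^+ 2 + s * T / (mu * n%:R)) / n%:R)).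
  move=> z1 sE dd hz st.
  have z0 : 0 < z by exact: lt_trans z1.
  apply: le_trans (ler_wpM2l (ltW N0) (expR_ge1Dx _)).
  have -> : \sum_i (1 + s * t i) `^ z =
      \sum_i (1 + z * (power_gap z (1 + s * t i) + s * t i)).
    by apply: eq_bigr => i _; rewrite /power_gap; field; rewrite gt_eqF.
  rewrite big_split/= sumr_const card_ord mulrDr mulr1 lerD2l -mulr_sumr.
  have -> : n%:R * (z * ((s / 2 * (1 + g) * P / (mu * n%:R) ^+ 2 + s * T / (mu * n%:R)) / n%:R)) =
     z * (s / 2 * (1 + g) * P / (mu * n%:R) ^+ 2 + s * T / (mu * n%:R)).
    by field; rewrite !gt_eqF.
  rewrite ler_wpM2l ?(ltW z0)// big_split/=; apply: lerD; last first.
    by rewrite -mulr_sumr sumt mulrA.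
  apply: (@le_trans _ _ (\sum_i (s / 2 * (1 + g)) * t i ^+ 2)); last first.
    by rewrite -mulr_sumr sumt2 mulrA.
  apply: ler_sum => i _; apply: le_trans (hz _ (le_trans (st i) dd)) _.
  rewrite sE le_eqVlt; apply/orP; left; apply/eqP; field.
  by rewrite gt_eqF// subr_gt0.
have d3a : d3 <= d1 by rewrite !ge_min lexx !orbT.
have d3b : d3 <= d2 by rewrite !ge_min lexx !orbT.
have xr := scaled r a d1 r1 aE d3a h1 ta.
have yq := scaled q b d2 q1 bE d3b h2 tb.
have pos s : (forall i, `|s * t i| <= d3) -> forall i, 0 <= 1 + s * t i.
  move=> st i; have := st i; have : d3 <= 1 by rewrite ge_min lexx.
  by rewrite ler_norml; clear; lra.
have := opnorm_ge_bilin (zero_diag_add mu E) n0 p1 pq r0 (pos _ ta) (pos _ tb) xr yq.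
set B := bilin _ _ _; set op := opnorm _ _ _; set w := _ + _ => Bop.
pose R1 := a * b * T ^+ 2 / (mu * n%:R ^+ 2) - c * T / n%:R -
  a * b * P / (mu * n%:R ^+ 2) + \sum_i \sum_j (b * t i) * E i j * (a * t j).
rewrite -aE -bE -cE; apply: (@lower_arith m0 M0 c K1 C4 C3 C5 g delta eps mu n%:R T P V R1 w B op) => //.
- exact: ltW.
- exact: ltW.
- have ab0 : 0 < a * b by rewrite mulr_gt0.
  have imu : mu^-1 <= m0^-1 by rewrite lef_pV2.
  have imu0 : 0 <= mu^-1 by rewrite invr_ge0 ltW.
  have N2 : 0 <= n%:R ^+ 2 :> R by exact: sqr_ge0.
  have PN : P / n%:R ^+ 2 <= K1.
    by rewrite ler_pdivrMr ?exprn_gt0//; case/andP: PK.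
  have PN0 : 0 <= P / n%:R ^+ 2 by rewrite divr_ge0.
  have TN : T ^+ 2 / n%:R ^+ 2 <= delta * n%:R.
    rewrite ler_pdivrMr ?exprn_gt0//.
    by have -> : delta * n%:R * n%:R ^+ 2 = delta * n%:R ^+ 3 by ring.
  have TN0 : 0 <= T ^+ 2 / n%:R ^+ 2 by rewrite divr_ge0 ?sqr_ge0.
  have r1' : `|a * b * T ^+ 2 / (mu * n%:R ^+ 2)| <= a * b / m0 * (delta * n%:R).
    have -> : a * b * T ^+ 2 / (mu * n%:R ^+ 2) = a * b * mu^-1 * (T ^+ 2 / n%:R ^+ 2).
      by field; rewrite !gt_eqF.
    rewrite ger0_norm; last by rewrite mulr_ge0// mulr_ge0// ltW.
    apply: ler_pM => //; first by rewrite mulr_ge0// ltW.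
    by apply: ler_wpM2l => //; exact: ltW.
  have r2' : `|c * T / n%:R| <= 2 * c * (delta * n%:R).
    rewrite -mulrA normrM (gtr0_norm c0) [2 * c]mulrC -mulrA; apply: ler_wpM2l; first exact: ltW.
    have : 0 <= (`|T / n%:R| - 1) ^+ 2 by exact: sqr_ge0.
    rewrite sqrrB1 real_normK ?num_real// expr_div_n.
    by move: TN dN; clear; lra.
  have r3' : `|a * b * P / (mu * n%:R ^+ 2)| <= a * b * K1 / m0 * (delta * n%:R).
    have -> : a * b * P / (mu * n%:R ^+ 2) = a * b * (P / n%:R ^+ 2) * mu^-1.
      by field; rewrite !gt_eqF.
    rewrite ger0_norm; last by rewrite mulr_ge0// mulr_ge0// ltW.
    apply: (@le_trans _ _ (a * b * K1 / m0)).
      apply: ler_pM => //; first by rewrite mulr_ge0// ltW.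
      by apply: ler_wpM2l => //; exact: ltW.
    by rewrite ler_peMr// divr_ge0 ?mulr_ge0// ltW.
  have r4' : `|\sum_i \sum_j (b * t i) * E i j * (a * t j)| <=
      a * b * K1 / m0 ^+ 2 * (delta * n%:R).
    have Pm : P / (mu * n%:R) ^+ 2 <= K1 / m0 ^+ 2.
      have -> : P / (mu * n%:R) ^+ 2 = P / n%:R ^+ 2 * mu ^- 2 by field; rewrite !gt_eqF.
      apply: ler_pM => //; first by rewrite invr_ge0 sqr_ge0.
      by rewrite lef_pV2 ?posrE ?exprn_gt0// ler_sqr ?nnegrE// ltW.
    have Pm0 : 0 <= P / (mu * n%:R) ^+ 2 by rewrite divr_ge0 ?sqr_ge0.
    apply: le_norm_of_sqr.
      by rewrite !mulr_ge0 ?invr_ge0 ?sqr_ge0// ltW.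
    apply: le_trans (sqr_bilin_le _ _ Eop) _.
    have sq (s : R) : \sum_i (s * t i) ^+ 2 = s ^+ 2 * (P / (mu * n%:R) ^+ 2).
      by rewrite -sumt2 mulr_sumr; apply: eq_bigr => i _; rewrite exprMn.
    rewrite !sq; have -> : (a * b * K1 / m0 ^+ 2 * (delta * n%:R)) ^+ 2 =
      (delta * n%:R) ^+ 2 * (b ^+ 2 * (K1 / m0 ^+ 2)) * (a ^+ 2 * (K1 / m0 ^+ 2)).
      by field; rewrite gt_eqF.
    have sP (s : R) : 0 <= s ^+ 2 * (P / (mu * n%:R) ^+ 2).
      by rewrite mulr_ge0// sqr_ge0.
    have sK (s : R) : s ^+ 2 * (P / (mu * n%:R) ^+ 2) <= s ^+ 2 * (K1 / m0 ^+ 2).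
      by apply: ler_wpM2l => //; exact: sqr_ge0.
    by apply: ler_pM => //; [exact: mulr_ge0|apply: ler_pM].
  have -> : C4 * delta * n%:R = a * b / m0 * (delta * n%:R) +
      2 * c * (delta * n%:R) + a * b * K1 / m0 * (delta * n%:R) +
      a * b * K1 / m0 ^+ 2 * (delta * n%:R) by rewrite C4E; ring.
  rewrite /R1; apply: le_trans (ler_normD _ _) _; apply: lerD => //.
  apply: le_trans (ler_normB _ _) _; apply: lerD => //.
  by apply: le_trans (ler_normB _ _) _; apply: lerD.
- rewrite /B bilin_expand//.
  have s1 (s : R) : \sum_i (1 + s * t i) = n%:R + s * (T / (mu * n%:R)).
    by rewrite big_split/= sumr_const card_ord -mulr_sumr sumt.
  have s2 : \sum_i (1 + b * t i) * (1 + a * t i) =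
      n%:R + c * (T / (mu * n%:R)) + a * b * (P / (mu * n%:R) ^+ 2).
    rewrite -sumt -sumt2 !mulr_sumr.
    have -> : n%:R = \sum_(i < n) 1 :> R by rewrite sumr_const card_ord.
    rewrite -!big_split/=.
    by apply: eq_bigr => i _; rewrite cE; ring.
  have s3 (s : R) : \sum_i (\sum_j E i j) * (1 + s * t i - 1) = s * (P / (mu * n%:R)).
    rewrite /P mulr_suml mulr_sumr; apply: eq_bigr => i _.
    by rewrite -/(e i) /t expr2; field; rewrite !gt_eqF.
  have s4 : \sum_i \sum_j (1 + b * t i - 1) * E i j * (1 + a * t j - 1) =
      \sum_i \sum_j b * t i * E i j * (a * t j).
    apply: eq_bigr => i _; apply: eq_bigr => j _.
    by rewrite ![1 + _ - 1]addrAC subrr !add0r.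
  rewrite !s1 s2 !s3 s4 -/T /R1 cE; field.
  by rewrite !gt_eqF.
- apply: sumr_ge0 => i _; apply: sumr_ge0 => j _.
  by rewrite mulr_ge0 ?(pos _ ta)// mulr_ge0 ?(pos _ tb).
- by rewrite /w cE; field; rewrite !gt_eqF.
Qed.

End bilinear_lower_bound.

(** * Independence and moments *)

Section independence.
Context d (T : measurableType d) (R : realType) (P : probability T R).

(** The joint law agrees with the product of the marginals on rectangles, hence everywhere, and
    Fubini's theorem factors the integral. *)
Lemma Rintegral_mul_indep (X Y : {mfun T >-> R}) :
  (forall A B : set R, measurable A -> measurable B ->
     P (X @^-1` A `&` Y @^-1` B) = (P (X @^-1` A) * P (Y @^-1` B))%E) ->
  P.-integrable setT (EFin \o X) -> P.-integrable setT (EFin \o Y) ->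
  P.-integrable setT (EFin \o (fun w => X w * Y w)) ->
  \int[P]_w (X w * Y w) = (\int[P]_w X w) * (\int[P]_w Y w).
Proof.
move=> ind iX iY iXY.
have mXY : measurable_fun setT (fun w => (X w, Y w)).
  by apply: measurable_fun_pair.
pose XY : {mfun T >-> (R * R)%type} :=
  mfun_Sub (mem_set mXY).
pose f := EFin \o (fun z : (R * R)%type => z.1 * z.2).
have mf : measurable_fun setT f.
  by apply/measurable_EFinP; exact: measurable_funM.
pose PX := distribution P X; pose PY := distribution P Y.
pose PXY := distribution P XY.
have prodE A : measurable A -> (PX \x PY)%E A = PXY A.
  apply: product_measure_unique => A1 A2 mA1 mA2.
  rewrite /PXY /distribution /pushforward/= -ind//.
have iPXY : PXY.-integrable setT f.
  by apply: integrable_pushforward => //; exact: measurable_funPTI.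
have iprod : (PX \x PY)%E.-integrable setT f.
  apply/integrableP; split => //; have /integrableP[_] := iPXY.
  rewrite (@eq_measure_integral _ _ _ setT PXY (PX \x PY)%E)// => A mA _.
  exact: prodE.
have iPX : PX.-integrable setT (EFin : R -> \bar R).
  apply: integrable_pushforward => //; exact: measurable_funPTI.
have iPY : PY.-integrable setT (EFin : R -> \bar R).
  apply: integrable_pushforward => //; exact: measurable_funPTI.
have EX : (\int[PX]_x x%:E = (\int[P]_w X w)%:E)%E.
  by rewrite integral_distribution// fineK//; exact: integrable_fin_num.
have EY : (\int[PY]_x x%:E = (\int[P]_w Y w)%:E)%E.
  by rewrite integral_distribution// fineK//; exact: integrable_fin_num.
suff : (\int[P]_w (X w * Y w)%:E = (\int[P]_w X w)%:E * (\int[P]_w Y w)%:E)%E.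
  by rewrite -EFinM => /(congr1 fine).
have <- : (\int[PXY]_z f z = \int[P]_w (X w * Y w)%:E)%E.
  by rewrite integral_distribution.
rewrite -(@eq_measure_integral _ _ _ setT PXY (PX \x PY)%E); last first.
  by move=> A mA _; exact: prodE.
rewrite -integral12_prod_meas1// /fubini_F.
under eq_integral => x _.
  rewrite /f/=; under eq_integral do rewrite EFinM.
  rewrite integralZl// EY.
  over.
by rewrite integralZr// EX.
Qed.

End independence.

Section independent_family.
Context d (T : measurableType d) (R : realType) (P : probability T R).
Context (I : finType) (D : pred I) (X : I -> {RV P >-> R}).

(** A pi-system generating the sigma-algebra of the [X i], [i] in [J]: independence is checked here
    first and then extended by uniqueness of measures. *)
Definition cylinders (J : {set I}) : set (set T) :=
  [set A | exists2 B : I -> set R, (forall i, i \in J -> measurable (B i)) &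
     A = [set w | forall i, i \in J -> B i (X i w)]].

(* Measurability with respect to the sigma-algebra generated by the [X i], [i] in [J]. *)
Definition depends_on (J : {set I}) (Y : T -> R) :=
  @measurable_fun _ _ (g_sigma_algebraType (cylinders J)) R setT Y.

Lemma depends_on_cst J (c : R) : depends_on J (fun=> c).
Proof. exact: measurable_cst. Qed.

Lemma depends_on_coord (J : {set I}) i : i \in J -> depends_on J (X i).
Proof.
move=> iJ _ B mB; rewrite setTI; apply: sub_sigma_algebra.
exists (fun j => if j == i then B else setT).
  by move=> j _; case: ifP => // _; exact: measurableT.
apply/seteqP; split => w /=.
  by move=> Bw j _; case: eqP => [->|].
by move=> /(_ i iJ); rewrite eqxx.
Qed.

Lemma depends_on_add J Y Z : depends_on J Y -> depends_on J Z ->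
  depends_on J (fun w => Y w + Z w).
Proof. exact: measurable_funD. Qed.

Lemma depends_on_mul J Y Z : depends_on J Y -> depends_on J Z ->
  depends_on J (fun w => Y w * Z w).
Proof. exact: measurable_funM. Qed.

Lemma depends_on_comp J (g : R -> R) Y : measurable_fun setT g -> depends_on J Y ->
  depends_on J (fun w => g (Y w)).
Proof. by move=> mg; exact: measurableT_comp. Qed.

Lemma cylinders_measurable (J : {set I}) A : cylinders J A -> measurable A.
Proof.
move=> [B mB ->].
have -> : [set w | forall i, i \in J -> B i (X i w)] =
    \bigcap_(i in [set` J]) (X i @^-1` B i) by [].
apply: fin_bigcap_measurable => // i iJ; rewrite -[X in measurable X]setTI.
exact: (measurable_funPT (X i)) (mB i iJ).
Qed.

Hypothesis ind : mutually_independent D X.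

Lemma cylinders_indep (J : {set I}) e (A : set T) (B : set R) :
  (forall i, i \in J -> D i) -> D e -> e \notin J -> cylinders J A -> measurable B ->
  P (A `&` X e @^-1` B) = (P (X e @^-1` B) * P A)%E.
Proof.
move=> JD De eJ [C mC ->] mB.
pose C' i := if i == e then B else C i.
have C'J i : i \in J -> C' i = C i.
  by move=> iJ; rewrite /C'; case: eqP => // ie; rewrite -ie iJ in eJ.
have eqJ : [set w | forall i, i \in J -> C i (X i w)] =
    [set w | forall i, i \in J -> C' i (X i w)].
  by apply/seteqP; split => w /= H i iJ; have := H i iJ; rewrite C'J.
have -> : [set w | forall i, i \in J -> C i (X i w)] `&` X e @^-1` B =
    [set w | forall i, i \in e |: J -> C' i (X i w)].
  apply/seteqP; split => w /=.
    move=> [H Be] i; rewrite in_setU1 => /orP[/eqP ->|iJ].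
      by rewrite /C' eqxx.
    by rewrite C'J//; exact: H.
  move=> H; split; last by have := H e (setU11 _ _); rewrite /C' eqxx.
  by move=> i iJ; rewrite -C'J//; apply: H; rewrite in_setU1 iJ orbT.
rewrite eqJ ind; first last.
- by move=> i; rewrite in_setU1 /C'; case: eqP => //= _ /mC.
- by move=> i; rewrite in_setU1 => /orP[/eqP ->|/JD].
rewrite ind//; last by move=> i iJ; rewrite C'J//; exact: mC.
by rewrite big_setU1//= {1}/C' eqxx.
Qed.

(** With [A] fixed, [C] mapped to [P (X e @^-1] A [&] C)[and to]P (X e @^-1[A) * P C] are finite
    measures that agree on the cylinders, hence on the sigma-algebra they generate. *)
Lemma depends_on_indep (J : {set I}) e (Y : T -> R) (A B : set R) :
  (forall i, i \in J -> D i) -> D e -> e \notin J -> depends_on J Y ->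
  measurable A -> measurable B ->
  P (X e @^-1` A `&` Y @^-1` B) = (P (X e @^-1` A) * P (Y @^-1` B))%E.
Proof.
move=> JD De eJ YJ mA mB.
have mXA : measurable (X e @^-1` A).
  by rewrite -[X in measurable X]setTI; exact: (measurable_funPT (X e)).
have PA0 : 0 <= fine (P (X e @^-1` A)) by rewrite fine_ge0.
pose m1 := mrestr P mXA; pose m2 := mscale (NngNum PA0) P.
have PAE : (fine (P (X e @^-1` A)))%:E = P (X e @^-1` A).
  by rewrite fineK// fin_num_measure.
have m2E C : m2 C = (P (X e @^-1` A) * P C)%E by rewrite -[in RHS]PAE.
have -> : P (X e @^-1` A `&` Y @^-1` B) = m1 (Y @^-1` B).
  by rewrite /m1 /mrestr setIC.
rewrite -m2E.
apply: (@g_sigma_algebra_measure_unique _ _ _ (cylinders J) _ (fun=> setT)).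
- exact: cylinders_measurable.
- by move=> _; exists (fun=> setT) => //; apply/seteqP; split.
- by rewrite bigcup_const.
- move=> _ _ [C mC ->] [C' mC' ->]; exists (fun i => C i `&` C' i).
    by move=> i iJ; apply: measurableI; [exact: mC|exact: mC'].
  apply/seteqP; split => w /=; first by move=> [H1 H2] i iJ; split; [exact: H1|exact: H2].
  by move=> H; split => i iJ; case: (H i iJ).
- move=> C CJ; transitivity (P (X e @^-1` A) * P C)%E; last by rewrite -m2E.
  exact: (cylinders_indep JD De eJ CJ mA).
- move=> _; change (P (setT `&` X e @^-1` A) < +oo)%E.
  by rewrite setTI (le_lt_trans (probability_le1 _ _))// ltry.
- by have := YJ measurableT B mB; rewrite setTI.
Qed.

Lemma depends_on_measurable (J : {set I}) (Y : T -> R) :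
  depends_on J Y -> measurable_fun setT Y.
Proof.
move=> YJ _ B mB; have := YJ measurableT B mB; rewrite setTI => H.
apply: (smallest_sub (@sigma_algebra_measurable _ T) _ H).
exact: cylinders_measurable.
Qed.

Lemma Rintegral_mul_depends (J : {set I}) e (g : R -> R) (Y : T -> R) :
  (forall i, i \in J -> D i) -> D e -> e \notin J -> depends_on J Y ->
  measurable_fun setT g ->
  P.-integrable setT (EFin \o (fun w => g (X e w))) ->
  P.-integrable setT (EFin \o Y) ->
  P.-integrable setT (EFin \o (fun w => g (X e w) * Y w)) ->
  \int[P]_w (g (X e w) * Y w) = (\int[P]_w g (X e w)) * (\int[P]_w Y w).
Proof.
move=> JD De eJ YJ mg ig iY igY.
have mY := depends_on_measurable YJ.
have mgX : measurable_fun setT (fun w => g (X e w)) by exact: measurableT_comp.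
apply: (@Rintegral_mul_indep _ _ _ P (mfun_Sub (mem_set mgX)) (mfun_Sub (mem_set mY))) => //.
move=> A B mA mB /=.
have mgA : measurable (g @^-1` A) by rewrite -[X in measurable X]setTI; exact: mg.
exact: (depends_on_indep JD De eJ YJ mgA mB).
Qed.

End independent_family.

(** * Random variables with finite moments of all orders *)

Section all_moments.
Context d (T : measurableType d) (R : realType) (P : probability T R).
Implicit Types f g : T -> R.

(** This class is closed under sums, products and powers, so that integrability of the polynomials
    in the entries follows structurally. *)
Definition all_moments f := measurable_fun setT f /\
  forall k : nat, P.-integrable setT (EFin \o (fun w => `|f w| ^+ k)).

Lemma integrable_le (f g : T -> R) : measurable_fun setT f ->
  P.-integrable setT (EFin \o g) -> (forall w, `|f w| <= g w) ->
  P.-integrable setT (EFin \o f).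
Proof.
move=> mf ig fg; apply: (le_integrable measurableT _ _ ig).
  exact/measurable_EFinP.
by move=> w _ /=; rewrite lee_fin (le_trans (fg w))// ler_norm.
Qed.

Lemma integrable_add (f g : T -> R) : P.-integrable setT (EFin \o f) ->
  P.-integrable setT (EFin \o g) -> P.-integrable setT (EFin \o (fun w => f w + g w)).
Proof. by move=> fi gi; exact: (integrableD measurableT fi gi). Qed.

Lemma integrable_mull (c : R) (f : T -> R) : P.-integrable setT (EFin \o f) ->
  P.-integrable setT (EFin \o (fun w => c * f w)).
Proof. by move=> fi; exact: (integrableZl measurableT c fi). Qed.

Lemma integrable_cst_fun (c : R) : P.-integrable setT (EFin \o (fun _ : T => c)).
Proof. exact: finite_measure_integrable_cst. Qed.

Lemma all_moments_integrable f : all_moments f -> P.-integrable setT (EFin \o f).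
Proof.
by move=> [mf /(_ 1%N) fi]; apply: integrable_le fi _ => // w; rewrite expr1.
Qed.

Lemma all_moments_measurable f : all_moments f -> measurable_fun setT f.
Proof. by case. Qed.

Lemma all_moments_cst (c : R) : all_moments (fun=> c).
Proof. by split => // k; exact: integrable_cst_fun. Qed.

Lemma all_moments_mul f g : all_moments f -> all_moments g ->
  all_moments (fun w => f w * g w).
Proof.
move=> [mf fi] [mg gi]; have mfg := measurable_funM mf mg; split => // k.
apply: integrable_le (integrable_add (fi (k * 2)%N) (gi (k * 2)%N)) _.
  by apply: measurable_funX; exact: measurableT_comp.
move=> w; rewrite ger0_norm ?exprn_ge0// normrM exprMn !exprM.
have := sqr_ge0 (`|f w| ^+ k - `|g w| ^+ k); rewrite sqrrB.
have : 0 <= `|f w| ^+ k ^+ 2 by exact: sqr_ge0.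
have : 0 <= `|g w| ^+ k ^+ 2 by exact: sqr_ge0.
lra.
Qed.

Lemma norm_add_exp_le (a b : R) k :
  `|a + b| ^+ k <= 2 ^+ k * (`|a| ^+ k + `|b| ^+ k).
Proof.
have le1 : `|a + b| <= 2 * Num.max `|a| `|b|.
  apply: le_trans (ler_normD _ _) _; have [ab|ba] := leP `|a| `|b|.
    by move: ab; clear; lra.
  by move: ba; clear; lra.
apply: (@le_trans _ _ ((2 * Num.max `|a| `|b|) ^+ k)).
  by apply: lerXn2r; rewrite ?nnegrE// mulr_ge0// le_max normr_ge0.
rewrite exprMn ler_wpM2l ?exprn_ge0//; have [_|_] := leP `|a| `|b|.
  by rewrite lerDr exprn_ge0.
by rewrite lerDl exprn_ge0.
Qed.

Lemma all_moments_add f g : all_moments f -> all_moments g ->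
  all_moments (fun w => f w + g w).
Proof.
move=> [mf fi] [mg gi]; have mfg := measurable_funD mf mg; split => // k.
apply: integrable_le (integrable_mull (2 ^+ k) (integrable_add (fi k) (gi k))) _.
  by apply: measurable_funX; exact: measurableT_comp.
by move=> w; rewrite ger0_norm ?exprn_ge0// norm_add_exp_le.
Qed.

Lemma all_moments_opp f : all_moments f -> all_moments (fun w => - f w).
Proof.
by move=> mf; have := all_moments_mul (all_moments_cst (-1)) mf; under eq_fun do rewrite mulN1r.
Qed.

Lemma all_moments_sum (I : Type) (r : seq I) (Q : pred I) (F : I -> T -> R) :
  (forall i, Q i -> all_moments (F i)) ->
  all_moments (fun w => \sum_(i <- r | Q i) F i w).
Proof.
move=> FQ; elim: r => [|i r IH].
  by under eq_fun do rewrite big_nil; exact: all_moments_cst.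
under eq_fun do rewrite big_cons; case: (boolP (Q i)) => // Qi.
by apply: all_moments_add => //; exact: FQ.
Qed.

Lemma all_moments_exp f k : all_moments f -> all_moments (fun w => f w ^+ k).
Proof.
move=> mf; elim: k => [|k IH]; first exact: all_moments_cst.
by under eq_fun do rewrite exprS; exact: all_moments_mul.
Qed.

Lemma all_moments_norm f : all_moments f -> all_moments (fun w => `|f w|).
Proof.
move=> [mf fi]; split; first exact: measurableT_comp.
by move=> k; under eq_fun do rewrite normr_id; exact: fi.
Qed.

Lemma Rintegral_sum (I : Type) (r : seq I) (F : I -> T -> R) :
  (forall i, all_moments (F i)) ->
  \int[P]_w (\sum_(i <- r) F i w) = \sum_(i <- r) \int[P]_w F i w.
Proof.
move=> FQ; elim: r => [|i r IH].
  by under eq_Rintegral do rewrite big_nil; rewrite big_nil Rintegral_cst// mul0r.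
under eq_Rintegral do rewrite big_cons.
rewrite RintegralD// ?IH ?big_cons//; first exact: all_moments_integrable.
by apply: all_moments_integrable; exact: all_moments_sum.
Qed.

Lemma markov_ge0 (f : T -> R) (C t : R) : 0 < t -> (forall w, 0 <= f w) ->
  measurable_fun setT f -> P.-integrable setT (EFin \o f) ->
  \int[P]_w f w <= C -> (P [set w | (t <= f w)%R] <= (C / t)%:E)%E.
Proof.
move=> t0 f0 mf fi fC.
pose F : {RV P >-> R} := mfun_Sub (mem_set mf).
have : (t%:E * P [set x | t%:E <= `|(F x)%:E|]%E <= 'E_P[id \o (fun x => `|x|%R) \o F])%E.
  by apply: (@markov _ _ _ P F id t t0) => // x y _ _.
have -> : [set x | (t%:E <= `|(F x)%:E|)%E] = [set w | (t <= f w)%R].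
  by apply/seteqP; split => w /=; rewrite lee_fin ger0_norm.
have -> : ('E_P[id \o (fun x => `|x|%R) \o F] = (\int[P]_w f w)%:E)%E.
  rewrite unlock fineK; last exact: (integrable_fin_num _ fi).
  by apply: eq_integral => w _ /=; rewrite ger0_norm.
move=> H; have : (t%:E * P [set w | (t <= f w)%R] <= C%:E)%E.
  by apply: le_trans H _; rewrite lee_fin.
rewrite -(@fineK _ (P _)) ?fin_num_measure//; last first.
  have -> : [set w | (t <= f w)%R] = f @^-1` `[t, +oo[.
    by apply/seteqP; split => w /=; rewrite in_itv/= andbT.
  rewrite -[X in measurable X]setTI.
  exact: (mf measurableT _ (measurable_itv `[t, +oo[)).
by rewrite -EFinM !lee_fin ler_pdivlMr// mulrC.
Qed.

End all_moments.

Section second_moment.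
Context d (T : measurableType d) (R : realType) (P : probability T R).

Lemma Rintegral_cst_probability (c : R) : \int[P]_w c = c.
Proof.
rewrite Rintegral_cst// (_ : fine _ = 1) ?mulr1//.
by have /= -> := @probability_setT _ _ _ P.
Qed.

(** The list [s x] contains the indices whose variable may be correlated with that of [x]; only [c]
    pairs per index contribute to the expanded square. All variance bounds below count such
    lists. *)
Lemma Rintegral_sum_sqr_le (A : finType) (F : A -> T -> R) (s : A -> seq A) (C : R) (c : nat) :
  0 <= C -> (forall x, all_moments P (F x)) ->
  (forall x y, y \notin s x -> \int[P]_w (F x w * F y w) = 0) ->
  (forall x y, \int[P]_w (F x w * F y w) <= C) ->
  (forall x, (size (s x) <= c)%N) ->
  \int[P]_w ((\sum_x F x w) ^+ 2) <= C * c%:R * #|A|%:R.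
Proof.
move=> C0 mF F0 FC sc.
under eq_Rintegral do rewrite expr2 big_distrlr/=.
have mFF x y : all_moments P (fun w => F x w * F y w) by exact: all_moments_mul.
rewrite Rintegral_sum; last by move=> x; exact: all_moments_sum.
under eq_bigr do rewrite Rintegral_sum//.
rewrite mulr_natr -[#|A|]cardsT -sumr_const.
under [leRHS]eq_bigl do rewrite inE.
apply: ler_sum => x _.
rewrite (bigID (mem (s x)))/= [X in _ + X]big1 ?addr0; last by move=> y; exact: F0.
apply: (@le_trans _ _ (\sum_(y in s x) C)); first by apply: ler_sum => y _.
rewrite sumr_const -[leLHS]mulr_natr; apply: ler_wpM2l => //.
by rewrite ler_nat; apply: leq_trans (sc x); exact: card_size.
Qed.

Lemma Rintegral_sqr_sum_le (A : finType) (F : A -> T -> R) (C : R) :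
  (forall x, all_moments P (F x)) ->
  (forall x, \int[P]_w (F x w ^+ 2) <= C) ->
  \int[P]_w ((\sum_x F x w) ^+ 2) <= C * #|A|%:R ^+ 2.
Proof.
move=> mF FC.
apply: (@le_trans _ _ (\int[P]_w (#|A|%:R * \sum_x F x w ^+ 2))).
  apply: le_Rintegral => //.
  - by apply: all_moments_integrable; apply: all_moments_exp; exact: all_moments_sum.
  - apply: all_moments_integrable; apply: all_moments_mul; first exact: all_moments_cst.
    by apply: all_moments_sum => x _; exact: all_moments_exp.
  move=> w _.
  have -> : \sum_x F x w = \sum_x 1 * F x w by apply: eq_bigr => x _; rewrite mul1r.
  apply: le_trans (sqr_sum_le _ _) _.
  under eq_bigr do rewrite expr1n.
  by rewrite sumr_const.
rewrite RintegralZl//; last first.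
  apply: all_moments_integrable.
  by apply: all_moments_sum => x _; exact: all_moments_exp.
rewrite Rintegral_sum; last by move=> x; exact: all_moments_exp.
rewrite (_ : C * _ = #|A|%:R * (C * #|A|%:R)); last by ring.
apply: ler_wpM2l => //.
apply: (@le_trans _ _ (\sum_(x : A) C)); first exact: ler_sum.
by rewrite sumr_const mulr_natr.
Qed.

End second_moment.

Lemma ler_add_double (R : realFieldType) (x y c : R) : x <= c -> y <= c -> x + y <= 2 * c.
Proof. lra. Qed.

Lemma ler_of_eq (R : realFieldType) (x y : R) : x = y -> x <= y.
Proof. by move->. Qed.

Lemma sqr_add_le (R : realFieldType) (x y : R) : (x + y) ^+ 2 <= 2 * (x ^+ 2 + y ^+ 2).
Proof. by have := sqr_ge0 (x - y); lra. Qed.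

Lemma mul4_le (R : realFieldType) (x y z t : R) :
  (x * y) * (z * t) <= 4^-1 * ((x ^+ 4 + y ^+ 4) + (z ^+ 4 + t ^+ 4)).
Proof.
have H (u v : R) : u * v <= 2^-1 * (u ^+ 2 + v ^+ 2).
  by have := sqr_ge0 (u - v); rewrite !expr2; lra.
have := H (x * y) (z * t); rewrite !exprMn.
have := H (x ^+ 2) (y ^+ 2); have := H (z ^+ 2) (t ^+ 2).
rewrite -!exprM; lra.
Qed.

(** * Moments of the centered matrix *)

Section noise.
Context d (T : measurableType d) (R : realType) (P : probability T R) (n : nat).
Context (a : 'I_n -> 'I_n -> {RV P >-> R}) (m M : R).
Hypothesis asym : forall i j w, a i j w = a j i w.
Hypothesis adiag : forall i w, a i i w = 0.
Hypothesis aind : mutually_independent (fun e : 'I_n * 'I_n => (e.1 < e.2)%N)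
        (fun e => a e.1 e.2).
Hypothesis amom : forall i j : 'I_n, (i < j)%N -> all_moments P (fun w => a i j w - m).
Hypothesis amean : forall i j : 'I_n, (i < j)%N -> \int[P]_w (a i j w - m) = 0.
Hypothesis a4 : forall i j : 'I_n, (i < j)%N -> \int[P]_w ((a i j w - m) ^+ 4) <= M.
Hypothesis M0 : 0 <= M.

Definition noise i j w : R := a i j w - (i != j)%:R * m.

(** Independence is assumed only for indices [i < j]; [edge i j] is the index of the variable that
    carries the entry [(i, j)]. On the diagonal it is [(i, i)], which indexes no independent
    variable. *)
Definition edge (i j : 'I_n) := if (i < j)%N then (i, j) else (j, i).

Lemma edgeP i j k l : edge i j = edge k l -> (k, l) = (i, j) \/ (k, l) = (j, i).
Proof.
rewrite /edge; case: ifP => _; case: ifP => _ [-> ->]; by [left|right].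
Qed.

Lemma edge_lt i j : i != j -> ((edge i j).1 < (edge i j).2)%N.
Proof.
rewrite /edge; case: ifP => //= /negbT; rewrite -leqNgt leq_eqVlt.
by case/orP => // /eqP/val_inj ->; rewrite eqxx.
Qed.

Lemma noise_sym i j w : noise i j w = noise j i w.
Proof. by rewrite /noise asym eq_sym. Qed.

Lemma noise_diag i w : noise i i w = 0.
Proof. by rewrite /noise adiag eqxx mul0r subr0. Qed.

Lemma noise_edge i j w : i != j -> noise i j w = a (edge i j).1 (edge i j).2 w - m.
Proof.
by move=> ij; rewrite /noise ij mul1r /edge; case: ifP => //= _; rewrite asym.
Qed.

Lemma noise_moments i j : all_moments P (noise i j).
Proof.
have [<-|ij] := eqVneq i j.
  rewrite (_ : noise i i = fun=> 0); first exact: all_moments_cst.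
  by apply/funext => w; rewrite noise_diag.
rewrite (_ : noise i j = fun w => a (edge i j).1 (edge i j).2 w - m).
  by apply: amom; exact: edge_lt.
by apply/funext => w; rewrite noise_edge.
Qed.

Lemma noise_mean i j : \int[P]_w noise i j w = 0.
Proof.
have [<-|ij] := eqVneq i j.
  by under eq_Rintegral do rewrite noise_diag; rewrite Rintegral_cst// mul0r.
by under eq_Rintegral do rewrite noise_edge//; apply: amean; exact: edge_lt.
Qed.

Lemma noise_exp4 i j : \int[P]_w (noise i j w ^+ 4) <= M.
Proof.
have [<-|ij] := eqVneq i j.
  by under eq_Rintegral do rewrite noise_diag expr0n/=; rewrite Rintegral_cst// mul0r.
by under eq_Rintegral do rewrite noise_edge//; apply: a4; exact: edge_lt.
Qed.

Lemma noise_exp2 i j : 0 <= \int[P]_w (noise i j w ^+ 2) <= 1 + M.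
Proof.
rewrite Rintegral_ge0/=; last by move=> w _; exact: sqr_ge0.
have i4 : P.-integrable setT (EFin \o (fun w => noise i j w ^+ 4)).
  by apply: all_moments_integrable; apply: all_moments_exp; exact: noise_moments.
apply: (@le_trans _ _ (\int[P]_w (1 + noise i j w ^+ 4))).
  apply: le_Rintegral => //.
  - by apply: all_moments_integrable; apply: all_moments_exp; exact: noise_moments.
  - exact: integrable_add (integrable_cst_fun _ _) i4.
  move=> w _; have := sqr_ge0 (noise i j w ^+ 2 - 1).
  rewrite sqrrB1 -exprM; have := sqr_ge0 (noise i j w); lra.
rewrite RintegralD//; last exact: integrable_cst_fun.
by rewrite Rintegral_cst_probability lerD2l noise_exp4.
Qed.

(** The case [i = j] is allowed for any [J] because the diagonal noise is constantly zero. *)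
Definition noise_depends (J : {set 'I_n * 'I_n}) i j :
  i = j \/ edge i j \in J ->
  depends_on (fun e : 'I_n * 'I_n => a e.1 e.2) J (noise i j).
Proof.
move=> H; have [ij|ij] := eqVneq i j.
  rewrite (_ : noise i j = fun=> 0); first exact: depends_on_cst.
  by apply/funext => w; rewrite ij noise_diag.
rewrite (_ : noise i j = fun w => a (edge i j).1 (edge i j).2 w + (- m)).
  apply: depends_on_add; last exact: depends_on_cst.
  apply: (@depends_on_coord _ _ _ _ _ (fun e : 'I_n * 'I_n => a e.1 e.2) J (edge i j)).
  by case: H => // /eqP; rewrite (negbTE ij).
by apply/funext => w; rewrite noise_edge.
Qed.

Lemma noise_fun_mul (g : R -> R) (J : {set 'I_n * 'I_n}) i j (Y : T -> R) :
  measurable_fun setT g -> all_moments P (fun w => g (noise i j w)) ->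
  all_moments P Y -> i != j -> edge i j \notin J ->
  (forall e, e \in J -> (e.1 < e.2)%N) ->
  depends_on (fun e : 'I_n * 'I_n => a e.1 e.2) J Y ->
  \int[P]_w (g (noise i j w) * Y w) =
    (\int[P]_w g (noise i j w)) * (\int[P]_w Y w).
Proof.
move=> mg gm Ym ij eJ JD YJ.
under eq_Rintegral do rewrite noise_edge//.
under [in RHS]eq_Rintegral do rewrite noise_edge//.
have gE : (fun w => g (noise i j w)) = fun w => g (a (edge i j).1 (edge i j).2 w - m).
  by apply/funext => w; rewrite noise_edge.
rewrite gE in gm.
apply: (@Rintegral_mul_depends _ _ _ P _ _ (fun e : 'I_n * 'I_n => a e.1 e.2) aind J
  (edge i j) (fun x => g (x - m)) Y) => //.
- exact: edge_lt.
- by apply: measurableT_comp => //; exact: measurable_funB.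
- exact: all_moments_integrable.
- exact: all_moments_integrable.
- by apply: all_moments_integrable; exact: all_moments_mul.
Qed.

(** Diagonal pairs are filtered out, so that the set lies in the range where independence holds; by
    [noise_depends] they are not missed. *)
Definition edges (s : seq ('I_n * 'I_n)) : {set 'I_n * 'I_n} :=
  [set e in [seq edge x.1 x.2 | x <- s] | (e.1 < e.2)%N].

Lemma edges_lt s e : e \in edges s -> (e.1 < e.2)%N.
Proof. by rewrite inE => /andP[]. Qed.

Lemma mem_edges s i j : (i, j) \in s -> i = j \/ edge i j \in edges s.
Proof.
move=> ijs; have [->|ij] := eqVneq i j; [by left|right].
by rewrite inE edge_lt// andbT; apply/mapP; exists (i, j).
Qed.

(** A factor whose edge differs from all the others is independent of their product, and it is
    centered. *)
Lemma noise4_zero i1 j1 i2 j2 i3 j3 i4 j4 :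
  edge i1 j1 != edge i2 j2 -> edge i1 j1 != edge i3 j3 -> edge i1 j1 != edge i4 j4 ->
  \int[P]_w ((noise i1 j1 w * noise i2 j2 w) * (noise i3 j3 w * noise i4 j4 w)) = 0.
Proof.
move=> n2 n3 n4; have [e1|ij] := eqVneq i1 j1.
  under eq_Rintegral do rewrite e1 noise_diag !mul0r.
  by rewrite Rintegral_cst// mul0r.
pose s := [:: (i2, j2); (i3, j3); (i4, j4)].
under eq_Rintegral do rewrite -mulrA.
have mY : all_moments P (fun w => noise i2 j2 w * (noise i3 j3 w * noise i4 j4 w)).
  by do 2 (apply: all_moments_mul; first exact: noise_moments); exact: noise_moments.
rewrite (@noise_fun_mul id (edges s)) ?noise_mean ?mul0r//.
- exact: noise_moments.
- by rewrite inE /= !inE (negbTE n2) (negbTE n3) (negbTE n4).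
- by move=> e; exact: edges_lt.
- do 2 (apply: depends_on_mul; first by apply: noise_depends; apply: mem_edges;
    rewrite !inE eqxx ?orbT).
  by apply: noise_depends; apply: mem_edges; rewrite !inE eqxx ?orbT.
Qed.

Lemma noise4_le i1 j1 i2 j2 i3 j3 i4 j4 :
  \int[P]_w ((noise i1 j1 w * noise i2 j2 w) * (noise i3 j3 w * noise i4 j4 w)) <= M.
Proof.
have m4 i j : P.-integrable setT (EFin \o (fun w => noise i j w ^+ 4)).
  by apply: all_moments_integrable; apply: all_moments_exp; exact: noise_moments.
pose S w := 4^-1 * ((noise i1 j1 w ^+ 4 + noise i2 j2 w ^+ 4) +
                    (noise i3 j3 w ^+ 4 + noise i4 j4 w ^+ 4)).
apply: (@le_trans _ _ (\int[P]_w S w)).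
  apply: le_Rintegral => //.
  - apply: all_moments_integrable.
    by do 2 (apply: all_moments_mul); exact: noise_moments.
  - by apply: integrable_mull; apply: integrable_add; exact: integrable_add.
  by move=> w _; exact: mul4_le.
rewrite RintegralZl//; last by apply: integrable_add; exact: integrable_add.
rewrite !RintegralD//; try exact: integrable_add.
have := noise_exp4 i1 j1; have := noise_exp4 i2 j2.
have := noise_exp4 i3 j3; have := noise_exp4 i4 j4; lra.
Qed.

Lemma noise_fun2_zero (g h : R -> R) i j k l : measurable_fun setT g ->
  measurable_fun setT h ->
  all_moments P (fun w => g (noise i j w)) -> all_moments P (fun w => h (noise k l w)) ->
  i != j -> edge i j != edge k l -> \int[P]_w g (noise i j w) = 0 ->
  \int[P]_w (g (noise i j w) * h (noise k l w)) = 0.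
Proof.
move=> mg mh gm hm ij e0 g0.
rewrite (@noise_fun_mul g (edges [:: (k, l)])) ?g0 ?mul0r//.
- by rewrite inE /= !inE (negbTE e0).
- by move=> e; exact: edges_lt.
- by apply: depends_on_comp => //; apply: noise_depends; apply: mem_edges; rewrite inE.
Qed.

Lemma pair_swap_notin (x y : 'I_n * 'I_n) :
  y \notin [:: x; (x.2, x.1)] -> edge x.1 x.2 != edge y.1 y.2.
Proof.
case: x y => [x1 x2] [y1 y2] /=; rewrite !inE negb_or => /andP[/eqP n1 /eqP n2].
by apply/eqP => /edgeP[].
Qed.

Lemma Rintegral_mul_sqr_le (f g : T -> R) : all_moments P f -> all_moments P g ->
  \int[P]_w (f w * g w) <= \int[P]_w (f w ^+ 2) + \int[P]_w (g w ^+ 2).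
Proof.
move=> mf mg; rewrite -RintegralD//; try by apply: all_moments_integrable; exact: all_moments_exp.
apply: le_Rintegral => //.
- by apply: all_moments_integrable; exact: all_moments_mul.
- by apply: all_moments_integrable; apply: all_moments_add; exact: all_moments_exp.
move=> w _; have := sqr_ge0 (f w - g w); rewrite sqrrB.
have := sqr_ge0 (f w); have := sqr_ge0 (g w); lra.
Qed.

Lemma noise_sum_sqr :
  \int[P]_w ((\sum_i \sum_j noise i j w) ^+ 2) <= 4 * (1 + M) * n%:R ^+ 2.
Proof.
under eq_Rintegral do rewrite pair_bigA/=.
apply: le_trans (@Rintegral_sum_sqr_le _ _ _ P _
  (fun (x : 'I_n * 'I_n) w => noise x.1 x.2 w) (fun x => [:: x; (x.2, x.1)])
  (2 * (1 + M)) 2 _ _ _ _ _) _ => //.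
- by move: M0; lra.
- by move=> x; exact: noise_moments.
- move=> x y yx.
  have [e|xx] := eqVneq x.1 x.2.
    by under eq_Rintegral do rewrite e noise_diag mul0r; rewrite Rintegral_cst_probability.
  apply: (@noise_fun2_zero id id) => //; try exact: noise_moments.
    exact: pair_swap_notin.
  exact: noise_mean.
- move=> x y; apply: le_trans (Rintegral_mul_sqr_le _ _) _; try exact: noise_moments.
  have /andP[_] := noise_exp2 x.1 x.2; have /andP[_] := noise_exp2 y.1 y.2; lra.
- by rewrite card_prod card_ord natrM; apply: ler_of_eq; ring.
Qed.

Definition noise_dev i j w := noise i j w ^+ 2 - \int[P]_v (noise i j v ^+ 2).

Lemma noise_dev_diag i w : noise_dev i i w = 0.
Proof.
rewrite /noise_dev noise_diag expr0n.
by under eq_Rintegral do rewrite noise_diag expr0n; rewrite Rintegral_cst_probability subr0.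
Qed.

Lemma noise_dev_moments i j : all_moments P (noise_dev i j).
Proof.
apply: all_moments_add (all_moments_cst _ _).
by apply: all_moments_exp; exact: noise_moments.
Qed.

Lemma noise_dev_mean i j : \int[P]_w noise_dev i j w = 0.
Proof.
rewrite RintegralB//; last exact: integrable_cst_fun.
  by rewrite Rintegral_cst_probability subrr.
by apply: all_moments_integrable; apply: all_moments_exp; exact: noise_moments.
Qed.

Lemma noise_dev_exp2 i j : \int[P]_w (noise_dev i j w ^+ 2) <= 2 * (M + (1 + M) ^+ 2).
Proof.
have i4 : P.-integrable setT (EFin \o (fun w => noise i j w ^+ 4)).
  by apply: all_moments_integrable; apply: all_moments_exp; exact: noise_moments.
have := noise_exp4 i j; have := noise_exp2 i j.
rewrite /noise_dev; set S := \int[P]_v (noise i j v ^+ 2) => /andP[S0 S1] N4.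
apply: (@le_trans _ _ (\int[P]_w (2 * (noise i j w ^+ 4 + S ^+ 2)))).
  apply: le_Rintegral => //.
  - by apply: all_moments_integrable; apply: all_moments_exp; exact: noise_dev_moments.
  - by apply: integrable_mull; apply: integrable_add => //; exact: integrable_cst_fun.
  move=> w _; apply: le_trans (sqr_add_le _ _) _; rewrite sqrrN -exprM.
  by apply: ler_of_eq; ring.
rewrite RintegralZl//; last by apply: integrable_add => //; exact: integrable_cst_fun.
rewrite RintegralD//; last exact: integrable_cst_fun.
rewrite Rintegral_cst_probability.
apply: ler_wpM2l => //; apply: lerD => //.
by apply: lerXn2r; rewrite ?nnegrE// addr_ge0.
Qed.

Lemma noise_sum_dev_sqr :
  \int[P]_w ((\sum_i \sum_j noise_dev i j w) ^+ 2) <=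
  8 * (M + (1 + M) ^+ 2) * n%:R ^+ 2.
Proof.
under eq_Rintegral do rewrite pair_bigA/=.
apply: le_trans (@Rintegral_sum_sqr_le _ _ _ P _
  (fun (x : 'I_n * 'I_n) w => noise_dev x.1 x.2 w)
  (fun x => [:: x; (x.2, x.1)]) (4 * (M + (1 + M) ^+ 2)) 2 _ _ _ _ _) _ => //.
- by rewrite mulr_ge0// addr_ge0// sqr_ge0.
- by move=> x; exact: noise_dev_moments.
- move=> x y yx.
  have [e|xx] := eqVneq x.1 x.2.
    by under eq_Rintegral do rewrite e noise_dev_diag mul0r; rewrite Rintegral_cst_probability.
  apply: (@noise_fun2_zero (fun z => z ^+ 2 - \int[P]_v (noise x.1 x.2 v ^+ 2))
    (fun z => z ^+ 2 - \int[P]_v (noise y.1 y.2 v ^+ 2))) => //.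
  + by apply: measurable_funB => //; exact: measurable_funX.
  + by apply: measurable_funB => //; exact: measurable_funX.
  + exact: noise_dev_moments.
  + exact: noise_dev_moments.
  + exact: pair_swap_notin.
  + exact: noise_dev_mean.
- move=> x y; apply: le_trans (Rintegral_mul_sqr_le _ _) _; try exact: noise_dev_moments.
  apply: le_trans (ler_add_double (noise_dev_exp2 _ _) (noise_dev_exp2 _ _)) _.
  by apply: ler_of_eq; ring.
- by rewrite card_prod card_ord natrM; apply: ler_of_eq; ring.
Qed.

Lemma noise4_zero2 i1 j1 i2 j2 i3 j3 i4 j4 :
  edge i2 j2 != edge i1 j1 -> edge i2 j2 != edge i3 j3 -> edge i2 j2 != edge i4 j4 ->
  \int[P]_w ((noise i1 j1 w * noise i2 j2 w) * (noise i3 j3 w * noise i4 j4 w)) = 0.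
Proof.
by move=> *; under eq_Rintegral do rewrite (mulrC (noise i1 j1 _)); exact: noise4_zero.
Qed.

(** A summand is a path [j - i - k] with distinct edges. Its two edges determine the centre [i] and,
    up to order, the ends, so it is correlated only with itself and its reversal: the bound counts
    the [n^3] triples twice. *)
Lemma noise_sum_cross_sqr :
  \int[P]_w ((\sum_i \sum_j \sum_k (j != k)%:R * (noise i j w * noise i k w)) ^+ 2) <=
  2 * M * n%:R ^+ 3.
Proof.
under eq_Rintegral.
  move=> w _; under eq_bigr do rewrite pair_bigA/=; rewrite pair_bigA/=; over.
apply: le_trans (@Rintegral_sum_sqr_le _ _ _ P _
  (fun (x : 'I_n * ('I_n * 'I_n)) w =>
     (x.2.1 != x.2.2)%:R * (noise x.1 x.2.1 w * noise x.1 x.2.2 w))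
  (fun x => [:: x; (x.1, (x.2.2, x.2.1))]) M 2 _ _ _ _ _) _ => //.
- move=> x; apply: all_moments_mul; first exact: all_moments_cst.
  by apply: all_moments_mul; exact: noise_moments.
- move=> [i [j k]] [i' [j' k']]; rewrite /= !inE !xpair_eqE negb_or => /andP[y1 y2].
  have [_|jk] := eqVneq j k.
    by under eq_Rintegral do rewrite !mul0r; rewrite Rintegral_cst_probability.
  have [_|jk'] := eqVneq j' k'.
    by under eq_Rintegral do rewrite !mul0r mulr0; rewrite Rintegral_cst_probability.
  have [e|ij] := eqVneq i j.
    by under eq_Rintegral do rewrite e noise_diag mul0r mulr0 mul0r;
      rewrite Rintegral_cst_probability.
  under eq_Rintegral do rewrite !mul1r.
  have eijk : edge i j != edge i k.
    by apply: contra_neq jk => /edgeP[] [] // -> <-.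
  have [e1|n1] := eqVneq (edge i j) (edge i' j').
    have [e2|n2] := eqVneq (edge i k) (edge i' k').
      move/eqP: ij => ij; move/eqP: jk => jk; move/negP: y1 => y1.
      case/edgeP: e1 => -[? ?]; case/edgeP: e2 => -[? ?]; subst; try congruence;
      by case: y1; rewrite !eqxx.
    by apply: noise4_zero2; rewrite -?e1// eq_sym.
  have [e1|n2] := eqVneq (edge i j) (edge i' k'); last exact: noise4_zero.
  have [e2|n3] := eqVneq (edge i k) (edge i' j').
    move/eqP: ij => ij; move/eqP: jk => jk; move/negP: y2 => y2.
    case/edgeP: e1 => -[? ?]; case/edgeP: e2 => -[? ?]; subst; try congruence;
    by case: y2; rewrite !eqxx.
  by apply: noise4_zero2; rewrite -?e1// eq_sym.
- move=> [i [j k]] [i' [j' k']] /=.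
  case: eqVneq => _; first by under eq_Rintegral do rewrite !mul0r;
    rewrite Rintegral_cst_probability.
  case: eqVneq => _; first by under eq_Rintegral do rewrite !mul0r mulr0;
    rewrite Rintegral_cst_probability.
  by under eq_Rintegral do rewrite !mul1r; exact: noise4_le.
- by rewrite !card_prod !card_ord !natrM; apply: ler_of_eq; ring.
Qed.

(** The squared row sum is split into its diagonal and off-diagonal parts. The first is bounded
    trivially; in the second an ordered pair of columns is correlated only with itself and its swap.
    This gives [2 * (M + 2 * M)]. *)
Lemma noise_row_exp4 i : \int[P]_w ((\sum_j noise i j w) ^+ 4) <= 6 * M * n%:R ^+ 2.
Proof.
have mN := noise_moments.
have mS : all_moments P (fun w => \sum_j noise i j w ^+ 2).
  by apply: all_moments_sum => j _; exact: all_moments_exp.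
have mC : all_moments P (fun w => \sum_(x : 'I_n * 'I_n)
    (x.1 != x.2)%:R * (noise i x.1 w * noise i x.2 w)).
  apply: all_moments_sum => j _; apply: all_moments_mul; first exact: all_moments_cst.
  exact: all_moments_mul.
have sE w : (\sum_j noise i j w) ^+ 2 = \sum_j noise i j w ^+ 2 +
    \sum_(x : 'I_n * 'I_n) (x.1 != x.2)%:R * (noise i x.1 w * noise i x.2 w).
  rewrite expr2 big_distrlr/= pair_bigA/= (bigID (fun x : 'I_n * 'I_n => x.1 == x.2))/=.
  congr (_ + _); last first.
    rewrite [RHS](bigID (fun x : 'I_n * 'I_n => x.1 == x.2))/= [X in _ = X + _]big1 ?add0r.
      by apply: eq_bigr => x ->; rewrite mul1r.
    by move=> x ->; rewrite mul0r.
  rewrite (reindex_onto (fun j : 'I_n => (j, j)) (fun x => x.1))/=; last first.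
    by move=> [x y] /= /eqP ->.
  by apply: eq_big => [j|j _]; rewrite ?eqxx// expr2.
apply: (@le_trans _ _ (\int[P]_w (2 * ((\sum_j noise i j w ^+ 2) ^+ 2 +
  (\sum_(x : 'I_n * 'I_n) (x.1 != x.2)%:R * (noise i x.1 w * noise i x.2 w)) ^+ 2)))).
  apply: le_Rintegral => //.
  - by apply: all_moments_integrable; apply: all_moments_exp; exact: all_moments_sum.
  - apply: integrable_mull; apply: integrable_add; apply: all_moments_integrable;
    exact: all_moments_exp.
  by move=> w _; rewrite (_ : 4 = 2 * 2)%N// exprM sE sqr_add_le.
rewrite RintegralZl//; last first.
  by apply: integrable_add; apply: all_moments_integrable; exact: all_moments_exp.
rewrite RintegralD//; try by apply: all_moments_integrable; exact: all_moments_exp.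
have H1 : \int[P]_w ((\sum_j noise i j w ^+ 2) ^+ 2) <= M * n%:R ^+ 2.
  have := @Rintegral_sqr_sum_le _ _ _ P 'I_n (fun j w => noise i j w ^+ 2) M _ _.
  rewrite card_ord; apply; first by move=> j; exact: all_moments_exp.
  by move=> j; under eq_Rintegral do rewrite -exprM; exact: noise_exp4.
have H2 : \int[P]_w ((\sum_(x : 'I_n * 'I_n) (x.1 != x.2)%:R *
    (noise i x.1 w * noise i x.2 w)) ^+ 2) <= 2 * M * n%:R ^+ 2.
  apply: le_trans (@Rintegral_sum_sqr_le _ _ _ P _
    (fun (x : 'I_n * 'I_n) w => (x.1 != x.2)%:R * (noise i x.1 w * noise i x.2 w))
    (fun x => [:: x; (x.2, x.1)]) M 2 _ _ _ _ _) _ => //.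
  - move=> x; apply: all_moments_mul; first exact: all_moments_cst.
    exact: all_moments_mul.
  - move=> [j k] [j' k']; rewrite /= !inE !xpair_eqE negb_or => /andP[y1 y2].
    have [_|jk] := eqVneq j k.
      by under eq_Rintegral do rewrite !mul0r; rewrite Rintegral_cst_probability.
    have [_|jk'] := eqVneq j' k'.
      by under eq_Rintegral do rewrite !mul0r mulr0; rewrite Rintegral_cst_probability.
    under eq_Rintegral do rewrite !mul1r.
    have inj u v : edge i u = edge i v -> v = u.
      by move=> /edgeP[] [] // -> <-.
    have nE u v : v != u -> edge i u != edge i v by apply: contra_neq => /inj.
    have [e1|n1] := eqVneq j' j.
      have [e2|n2] := eqVneq k' k; first by rewrite e1 e2 !eqxx in y1.
      by apply: noise4_zero2; apply: nE; rewrite // e1.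
    have [e1|n2] := eqVneq k' j.
      have [e2|n3] := eqVneq j' k; first by rewrite e1 e2 !eqxx in y2.
      by apply: noise4_zero2; apply: nE; rewrite // e1.
    by apply: noise4_zero; apply: nE => //; rewrite eq_sym.
  - move=> [j k] [j' k'] /=.
    case: eqVneq => _; first by under eq_Rintegral do rewrite !mul0r;
      rewrite Rintegral_cst_probability.
    case: eqVneq => _; first by under eq_Rintegral do rewrite !mul0r mulr0;
      rewrite Rintegral_cst_probability.
    by under eq_Rintegral do rewrite !mul1r; exact: noise4_le.
  - by rewrite !card_prod !card_ord !natrM; apply: ler_of_eq; ring.
apply: le_trans (ler_wpM2l _ (lerD H1 H2)) _ => //; apply: ler_of_eq; ring.
Qed.

(** The sum is the squared Frobenius norm of the squared noise matrix, which dominates the fourth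
    power of the operator norm. Off the diagonal each entry is a sum of [n] uncorrelated terms,
    contributing [n^2 * (M * n)]; the [n] diagonal entries are bounded trivially by [M * n^2]. *)
Lemma noise_square_frobenius :
  \int[P]_w (\sum_i \sum_j (\sum_k noise i k w * noise k j w) ^+ 2) <=
  2 * M * n%:R ^+ 3.
Proof.
have mN := noise_moments.
have mF i j k : all_moments P (fun w => noise i k w * noise k j w).
  exact: all_moments_mul.
have mS i j : all_moments P (fun w => (\sum_k noise i k w * noise k j w) ^+ 2).
  by apply: all_moments_exp; apply: all_moments_sum => k _; exact: mF.
rewrite Rintegral_sum; last by move=> i; apply: all_moments_sum => j _; exact: mS.
under eq_bigr do rewrite Rintegral_sum//.
have MN : 0 <= M * n%:R by rewrite mulr_ge0.
apply: (@le_trans _ _ (\sum_i \sum_(j < n) (M * n%:R + (j == i)%:R * (M * n%:R ^+ 2)))).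
  apply: ler_sum => i _; apply: ler_sum => j _; case: eqVneq => [->|ji].
    rewrite mul1r; apply: ler_wpDl => //.
    have := @Rintegral_sqr_sum_le _ _ _ P 'I_n (fun k w => noise i k w * noise k i w) M _ _.
    rewrite card_ord; apply; first by move=> k; exact: mF.
    by move=> k; under eq_Rintegral do rewrite expr2; exact: noise4_le.
  rewrite mul0r addr0.
  apply: le_trans (@Rintegral_sum_sqr_le _ _ _ P _
    (fun k w => noise i k w * noise k j w) (fun x => [:: x]) M 1 _ _ _ _ _) _ => //.
  - move=> k l; rewrite inE => lk.
    have [e|ik] := eqVneq i k.
      by under eq_Rintegral do rewrite e noise_diag !mul0r; rewrite Rintegral_cst_probability.
    have [e|il] := eqVneq i l.
      by under eq_Rintegral do rewrite [noise i l _]/noise e adiag eqxx mul0r subr0 mul0r mulr0;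
        rewrite Rintegral_cst_probability.
    apply: noise4_zero; apply/eqP => /edgeP [] [].
    + by move=> e _; rewrite e eqxx in ik.
    + by move=> e; rewrite e eqxx in ji.
    + by move=> e; rewrite e eqxx in lk.
    + by move=> e; rewrite e eqxx in ik.
    + by move=> e; rewrite e eqxx in il.
    + by move=> e; rewrite e eqxx in lk.
  - by move=> k l; exact: noise4_le.
  - by rewrite mulr1 card_ord.
rewrite le_eqVlt; apply/orP; left; apply/eqP.
under eq_bigr.
  move=> i _; rewrite big_split/= sumr_const card_ord (bigD1 i)//= eqxx mul1r big1 ?addr0.
    over.
  by move=> j /negbTE ->; rewrite mul0r.
by rewrite sumr_const card_ord -[LHS]mulr_natr -[X in X + _]mulr_natr; ring.
Qed.

End noise.

(** * A quantitative central limit theorem *)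

Section gaussian_cdf.
Context {R : realType}.
Implicit Types (x y z : R).

(** Variance 2 is that of the limit law; with it, [u(t, z) = gauss_cdf (z / sqrt t)] satisfies
    [u_t = u_zz] without a constant. *)
Let sd : R := Num.sqrt 2.

Let sd0 : sd != 0. Proof. by rewrite gt_eqF// sqrtr_gt0. Qed.

Definition gauss_cdf x : R := fine (normal_prob 0 sd `]-oo, x]).

Definition gauss_pdf x : R := normal_pdf 0 sd x.

Lemma gauss_cdfE x : normal_prob 0 sd `]-oo, x] = (gauss_cdf x)%:E.
Proof. by rewrite fineK// fin_num_measure. Qed.

Lemma gauss_cdf_ge0 x : 0 <= gauss_cdf x.
Proof. by rewrite -lee_fin -gauss_cdfE. Qed.

Lemma gauss_cdf_le1 x : gauss_cdf x <= 1.
Proof. by rewrite -lee_fin -gauss_cdfE probability_le1. Qed.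

Lemma gauss_cdf_homo x y : x <= y -> gauss_cdf x <= gauss_cdf y.
Proof.
move=> xy; rewrite -lee_fin -!gauss_cdfE; apply: le_measure; rewrite ?inE//.
by apply: subset_itvl; rewrite bnd_simp.
Qed.

Lemma gauss_cdf_limits (e : R) : 0 < e -> exists2 k : R, 0 < k &
  1 - e <= gauss_cdf k /\ gauss_cdf (- k) <= e.
Proof.
move=> e0.
have mid : @measurable_fun _ _ (measurableTypeR R) R setT idfun by exact: measurable_id.
pose X : {RV (normal_prob 0 sd) >-> R} :=
  @mfun_Sub _ _ (measurableTypeR R) R idfun (mem_set mid).
have cE : fine \o cdf X = gauss_cdf.
  by apply/funext => x; rewrite /= -[RHS]/(fine (gauss_cdf x)%:E) -gauss_cdfE.
have [k1 H1] : exists k1, forall x, k1 < x -> 1 - e <= gauss_cdf x.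
  have /fine_cvgP[_] := @cvg_cdfy1 _ _ _ _ X.
  rewrite cE => /cvgrPdist_le/(_ e e0)[k1 [_ H]]; exists k1 => x /H.
  by rewrite ler_norml => /andP[_]; lra.
have [k2 H2] : exists k2, forall x, x < k2 -> gauss_cdf x <= e.
  have /fine_cvgP[_] := @cvg_cdfNy0 _ _ _ _ X.
  rewrite cE => /cvgrPdist_le/(_ e e0)[k2 [_ H]]; exists k2 => x /H.
  by rewrite ler_norml => /andP[]; lra.
exists (`|k1| + `|k2| + 1); first by rewrite ltr_wpDl// addr_ge0.
have := ler_norm k1; have := ler_norm (- k2); rewrite normrN => ? ?.
by split; [apply: H1|apply: H2]; have := normr_ge0 k1; have := normr_ge0 k2; lra.
Qed.

Lemma gauss_pdfE x : gauss_pdf x = normal_peak sd * expR (- (x ^+ 2 / 4)).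
Proof.
rewrite /gauss_pdf normal_pdfE// /normal_fun subr0 /sd sqr_sqrtr// mulNr.
by congr (_ * expR (- (_ / _))); rewrite -mulr_natr; ring.
Qed.

Lemma gauss_pdf_ge0 x : 0 <= gauss_pdf x. Proof. exact: normal_pdf_ge0. Qed.

Lemma is_derive_gauss_cdf x : is_derive x 1 gauss_cdf (gauss_pdf x).
Proof.
have int : lebesgue_measure.-integrable setT (EFin \o gauss_pdf).
  exact: integrable_normal_pdf.
have := @continuous_FTC1 R gauss_pdf -oo%O x (x + 1) _ _ _ _.
rewrite ltrDl ltr01 => /(_ isT).
have int2 : lebesgue_measure.-integrable `]-oo, (x + 1)] (EFin \o gauss_pdf).
  by apply: integrableS int.
move=> /(_ int2); rewrite ltNyr => /(_ isT (@continuous_normal_pdf _ 0 sd sd0 x))[d1 d2].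
apply: DeriveDef; first exact: d1.
by rewrite -derive1E.
Qed.

Lemma is_derive_gauss_pdf x : is_derive x 1 gauss_pdf (- (x / 2) * gauss_pdf x).
Proof.
have -> : gauss_pdf = fun x => normal_peak sd * expR ((- 4^-1) * x ^+ 2).
  by apply/funext => y; rewrite gauss_pdfE; congr (_ * expR _); ring.
have D1 := is_derive_mull_fun (- 4^-1) (is_derive_sqr_fun x).
have D2 := @is_derive_comp_fun _ expR (fun t => - 4^-1 * t ^+ 2) x _ _
  (is_derive_expR _) D1.
have D3 := is_derive_mull_fun (normal_peak sd) D2.
by apply: (is_derive_eq D3); field.
Qed.

Lemma gauss_pdf_decay : exists2 B : R, 0 < B &
  forall x, (1 + x ^+ 4) * gauss_pdf x <= B.
Proof.
(* The exponential of [x^2 / 4] is the square of that of [x^2 / 8], hence at least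
   [(1 + x^2 / 8)^2], in which [x^4] has coefficient 1/64. *)
exists (65 * normal_peak sd); first by rewrite mulr_gt0 ?normal_peak_gt0.
move=> x; rewrite gauss_pdfE mulrCA mulrC ler_wpM2r ?normal_peak_ge0//.
rewrite expRN ler_pdivrMr ?expR_gt0//.
have -> : x ^+ 2 / 4 = x ^+ 2 / 8 + x ^+ 2 / 8 by field.
rewrite expRD; set E := expR _.
have x20 : 0 <= x ^+ 2 by exact: sqr_ge0.
have E1 : 1 + x ^+ 2 / 8 <= E by exact: expR_ge1Dx.
have E2 : (1 + x ^+ 2 / 8) * (1 + x ^+ 2 / 8) <= E * E.
  by apply: ler_pM => //; lra.
have -> : x ^+ 4 = x ^+ 2 * x ^+ 2 by ring.
by move: E2 x20; clear; nra.
Qed.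

(** The functions that occur in the Taylor remainders: the density, the factor [z * gauss_pdf z] of
    the first time derivative of the heat flow, the second derivative of the density, and the factor
    of the second time derivative. *)
Lemma gauss_pdf_bounds : exists2 B : R, 0 < B & forall z,
  [/\ `|gauss_pdf z| <= B, `|z * gauss_pdf z| <= B,
      `|(z ^+ 2 / 4 - 2^-1) * gauss_pdf z| <= B &
      `|(3 * z - z ^+ 3 / 2) * gauss_pdf z| <= B].
Proof.
have [B B0 H] := gauss_pdf_decay; exists (4 * B); first by rewrite mulr_gt0.
move=> z; have p0 := gauss_pdf_ge0 z; have Hz := H z.
have poly (q : R) : `|q| <= 4 * (1 + z ^+ 4) -> `|q * gauss_pdf z| <= 4 * B.
  move=> qz; rewrite normrM (ger0_norm p0).
  by apply: le_trans (ler_wpM2r p0 qz) _; rewrite -mulrA ler_wpM2l.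
have z4 : z ^+ 4 = (z ^+ 2) ^+ 2 by rewrite -exprM.
have s0 := sqr_ge0 (z ^+ 2 - 1); have s1 := sqr_ge0 z; have s2 := sqr_ge0 (z ^+ 2).
have s3 := sqr_ge0 (z - 1); have s4 := sqr_ge0 (z + 1).
have s5 := sqr_ge0 (z ^+ 2 - z); have s6 := sqr_ge0 (z ^+ 2 + z).
split.
- by rewrite -[gauss_pdf z]mul1r; apply: poly; rewrite normr1; lra.
- by apply: poly; rewrite ler_norml; lra.
- by apply: poly; rewrite ler_norml; lra.
- by apply: poly; rewrite ler_norml; lra.
Qed.

Lemma taylor2_bound (G g g' : R -> R) (a h B : R) :
  (forall x, `|x - a| <= `|h| -> is_derive x 1 G (g x)) ->
  (forall x, `|x - a| <= `|h| -> is_derive x 1 g (g' x)) ->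
  (forall x, `|x - a| <= `|h| -> `|g' x| <= B) ->
  `|G (a + h) - G a - g a * h| <= B * h ^+ 2.
Proof.
move=> Gg gg' g'B.
have H := @MVT_bound R (fun x => G x - g a * x) (fun x => g x - g a) a h (B * `|h|) _ _.
rewrite (_ : G (a + h) - G a - g a * h =
  G (a + h) - g a * (a + h) - (G a - g a * a)); last by ring.
rewrite -[h ^+ 2]real_normK ?num_real// expr2 mulrA; apply: H.
  move=> x xa; apply: is_derive_sub_fun; first exact: Gg.
  have D := is_derive_mull_fun (g a) (is_derive_id x (1 : R)).
  by apply: (is_derive_eq D); rewrite mulr1.
move=> x xa; have -> : x = a + (x - a) by rewrite addrC subrK.
apply: le_trans (@MVT_bound R g g' a (x - a) B _ _) _.
- by move=> y ya; apply: gg'; exact: le_trans xa.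
- by move=> y ya; apply: g'B; exact: le_trans xa.
rewrite ler_wpM2l//; apply: le_trans (g'B a _); first exact: normr_ge0.
by rewrite subrr normr0.
Qed.

Lemma taylor3_bound (G g g' g'' : R -> R) (a h B : R) :
  (forall x, is_derive x 1 G (g x)) -> (forall x, is_derive x 1 g (g' x)) ->
  (forall x, is_derive x 1 g' (g'' x)) -> (forall x, `|g'' x| <= B) ->
  `|G (a + h) - G a - g a * h - g' a * h ^+ 2 / 2| <= B * `|h| ^+ 3.
Proof.
move=> Gg gg' g'g'' g''B.
have B0 : 0 <= B by apply: le_trans (g''B 0); exact: normr_ge0.
have H := @MVT_bound R (fun x => G x - (g a * x + g' a / 2 * (x - a) ^+ 2))
  (fun x => g x - (g a + g' a * (x - a))) a h (B * h ^+ 2) _ _.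
rewrite (_ : G (a + h) - G a - g a * h - g' a * h ^+ 2 / 2 =
  G (a + h) - (g a * (a + h) + g' a / 2 * (a + h - a) ^+ 2) -
  (G a - (g a * a + g' a / 2 * (a - a) ^+ 2))); last by field.
have -> : B * `|h| ^+ 3 = B * h ^+ 2 * `|h|.
  by rewrite -[h ^+ 2]real_normK ?num_real//; ring.
apply: H => x xa.
  apply: is_derive_sub_fun => //; apply: is_derive_add_fun.
    have D := is_derive_mull_fun (g a) (is_derive_id x (1 : R)).
    by apply: (is_derive_eq D); rewrite mulr1.
  have D1 := is_derive_sub_fun (is_derive_id x (1 : R)) (is_derive_cst_fun a x).
  have D2 := @is_derive_comp_fun _ (fun t => t ^+ 2) (fun t => t - a) x _ _
    (is_derive_sqr_fun _) D1.
  have D3 := is_derive_mull_fun (g' a / 2) D2.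
  by apply: (is_derive_eq D3); field.
have := @taylor2_bound g g' g'' a (x - a) B _ _ _.
rewrite [a + (x - a)]addrC subrK.
have -> : g x - (g a + g' a * (x - a)) = g x - g a - g' a * (x - a) by ring.
move=> /(_ (fun x _ => gg' x) (fun x _ => g'g'' x) (fun x _ => g''B x)) T.
apply: le_trans T _; rewrite ler_wpM2l//.
rewrite -[leLHS]real_normK ?num_real// -[leRHS]real_normK ?num_real//.
by apply: lerXn2r; rewrite ?nnegrE.
Qed.

End gaussian_cdf.

(** * Time derivatives and time expansion of the heat flow *)

Section heat_flow.
Context {R : realType}.
Implicit Types t v h : R.

(** Written as a real power so that the differentiation rule for powers applies directly. *)
Definition inv_sqrt (t : R) := t `^ (- 2^-1).

Lemma inv_sqrt_gt0 t : 0 < t -> 0 < inv_sqrt t.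
Proof. exact: powR_gt0. Qed.

Lemma sqr_inv_sqrt t : 0 < t -> inv_sqrt t ^+ 2 = t^-1.
Proof.
move=> t0; rewrite /inv_sqrt -powR_mulrn ?powR_ge0// -powRrM.
by rewrite (_ : - 2^-1 * 2 = -1); [rewrite powR_inv1// ltW|lra].
Qed.

Lemma is_derive_inv_sqrt t : 0 < t ->
  is_derive t 1 inv_sqrt (- 2^-1 * inv_sqrt t / t).
Proof.
move=> t0; apply: (is_derive_eq (is_derive1_powR (- 2^-1) t0)).
by rewrite powR_addr_gt0// powR_inv1 ?(ltW t0)// mulrA.
Qed.

Lemma heat_time_derivative1 (v t : R) : 0 < t ->
  is_derive t 1 (fun t => gauss_cdf (v * inv_sqrt t))
    (- 2^-1 * ((v * inv_sqrt t) * gauss_pdf (v * inv_sqrt t)) / t).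
Proof.
move=> t0; have D1 := is_derive_mull_fun v (is_derive_inv_sqrt t0).
have D2 := @is_derive_comp_fun _ gauss_cdf (fun t => v * inv_sqrt t) t _ _
  (is_derive_gauss_cdf _) D1.
by apply: (is_derive_eq D2); field; rewrite gt_eqF.
Qed.

Lemma heat_time_derivative2 (v t : R) : 0 < t ->
  is_derive t 1 (fun t => - 2^-1 * ((v * inv_sqrt t) * gauss_pdf (v * inv_sqrt t)) / t)
    (4^-1 * ((3 * (v * inv_sqrt t) - (v * inv_sqrt t) ^+ 3 / 2) *
       gauss_pdf (v * inv_sqrt t)) / t ^+ 2).
Proof.
move=> t0; have D1 := is_derive_mull_fun v (is_derive_inv_sqrt t0).
have D2 := @is_derive_comp_fun _ gauss_pdf (fun t => v * inv_sqrt t) t _ _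
  (is_derive_gauss_pdf _) D1.
have D3 := is_derive_mull_fun (- 2^-1) (is_derive_mul_fun D1 D2).
have tN0 : t != 0 by rewrite gt_eqF.
have D4 := is_deriveV tN0 (is_derive_id t (1 : R)).
have D5 := is_derive_mul_fun D3 D4.
apply: (is_derive_eq D5); rewrite /GRing.scale/=.
by field.
Qed.

Lemma heat_time_taylor (e : R) : 0 < e -> exists2 C : R, 0 < C &
  forall v t h, e <= t -> 0 <= h ->
  `|gauss_cdf (v * inv_sqrt (t + h)) - gauss_cdf (v * inv_sqrt t) -
    (- 2^-1 * ((v * inv_sqrt t) * gauss_pdf (v * inv_sqrt t)) / t) * h| <= C * h ^+ 2.
Proof.
move=> e0; have [B B0 HB] := @gauss_pdf_bounds R.
pose C1 := 4^-1 * B / (e / 2) ^+ 2.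
have C10 : 0 < C1 by rewrite divr_gt0 ?mulr_gt0 ?exprn_gt0// divr_gt0.
pose C2 := 4 / e ^+ 2 + B / e ^+ 2.
have C20 : 0 < C2 by rewrite addr_gt0// divr_gt0 ?exprn_gt0.
exists (C1 + C2); first by rewrite addr_gt0.
move=> v t h et h0; have t0 : 0 < t by exact: lt_le_trans et.
rewrite mulrDl; have h20 : 0 <= h ^+ 2 by exact: sqr_ge0.
(* For small [h] the symmetric neighbourhood used by [taylor2_bound] stays above [e / 2], where the
   second time derivative is bounded. For large [h] the left side grows at most linearly in [h], and
   [h^2] dominates it. *)
have [he|/ltW he] := leP h (e / 2).
  apply: (@le_trans _ _ (C1 * h ^+ 2)); last by rewrite lerDl mulr_ge0// ltW.
  have near x : `|x - t| <= `|h| -> e / 2 <= x.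
    by rewrite (ger0_norm h0) ler_norml => /andP[]; move: he et; clear; lra.
  have e20 : 0 < e / 2 by rewrite divr_gt0.
  have pos x : `|x - t| <= `|h| -> 0 < x by move=> /near; exact: lt_le_trans.
  apply: (@taylor2_bound R (fun t => gauss_cdf (v * inv_sqrt t))
    (fun t => - 2^-1 * ((v * inv_sqrt t) * gauss_pdf (v * inv_sqrt t)) / t)
    (fun t => 4^-1 * ((3 * (v * inv_sqrt t) - (v * inv_sqrt t) ^+ 3 / 2) *
       gauss_pdf (v * inv_sqrt t)) / t ^+ 2) t h C1).
  - by move=> x /pos; exact: heat_time_derivative1.
  - by move=> x /pos; exact: heat_time_derivative2.
  move=> x xt; have x0 := pos _ xt; have := near _ xt => xe.
  rewrite normrM [ `|4^-1 * _| ]normrM gtr0_norm// [ `|_^-1| ]gtr0_norm ?invr_gt0 ?exprn_gt0//.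
  have [_ _ _ H1] := HB (v * inv_sqrt x).
  have H2 : (x ^+ 2)^-1 <= (e / 2) ^- 2.
    by rewrite lef_pV2 ?posrE ?exprn_gt0//; apply: lerXn2r; rewrite ?nnegrE// ltW.
  have q0 : 0 <= 4^-1 :> R by rewrite invr_ge0.
  apply: ler_pM (ler_wpM2l q0 H1) H2; first by rewrite mulr_ge0.
  by rewrite invr_ge0 sqr_ge0.
apply: (@le_trans _ _ (C2 * h ^+ 2)); last by rewrite lerDr mulr_ge0// ltW.
set z := v * inv_sqrt t; have [_ zB _ _] := HB z.
have two : `|gauss_cdf (v * inv_sqrt (t + h)) - gauss_cdf z| <= 1.
  have := gauss_cdf_ge0 (v * inv_sqrt (t + h)); have := gauss_cdf_le1 (v * inv_sqrt (t + h)).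
  have := gauss_cdf_ge0 z; have := gauss_cdf_le1 z.
  move: (gauss_cdf z) (gauss_cdf _) => A A'.
  by rewrite ler_norml; clear; lra.
apply: le_trans (ler_normB _ _) _.
have he2 : 1 <= 4 / e ^+ 2 * h ^+ 2.
  have -> : 4 / e ^+ 2 * h ^+ 2 = (2 * h / e) ^+ 2 by field; rewrite gt_eqF.
  by rewrite exprn_ege1// ler_pdivlMr// mul1r; move: he; clear; lra.
rewrite mulrDl; apply: lerD; first exact: le_trans he2.
move: (z * _) zB => zf zB.
rewrite mulNr mulNr mulNr normrN 3!normrM (ger0_norm h0).
rewrite [ `|t^-1| ]gtr0_norm ?invr_gt0// [ `|2^-1| ]gtr0_norm ?invr_gt0//.
apply: (@le_trans _ _ (2^-1 * B / e * h)).
  have q0 : 0 <= 2^-1 :> R by rewrite invr_ge0.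
  have H2 : t^-1 <= e^-1 by rewrite lef_pV2 ?posrE.
  apply: ler_wpM2r => //; apply: ler_pM (ler_wpM2l q0 zB) H2; first by rewrite mulr_ge0.
  by rewrite invr_ge0 ltW.
have -> : B / e ^+ 2 * h ^+ 2 = B / e * h * (h / e) by field; rewrite gt_eqF.
have -> : 2^-1 * B / e * h = B / e * h * 2^-1 by ring.
apply: ler_wpM2l; first by rewrite mulr_ge0// divr_ge0// ltW.
by rewrite ler_pdivlMr//; move: he; clear; lra.
Qed.

Lemma measurable_gauss_cdf : measurable_fun setT (@gauss_cdf R).
Proof.
apply: continuous_measurable_fun => x.
apply: differentiable_continuous; apply/derivable1_diffP.
exact: (@ex_derive _ _ _ _ _ _ _ (is_derive_gauss_cdf x)).
Qed.

Lemma measurable_gauss_pdf : measurable_fun setT (@gauss_pdf R).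
Proof. exact: measurable_normal_pdf. Qed.

End heat_flow.

(** * Lindeberg's replacement argument *)

Section lindeberg.
Context {R : realType}.

Lemma inv_sqrt_le (e t : R) : 0 < e -> e <= t -> inv_sqrt t <= inv_sqrt e.
Proof.
move=> e0 et; have t0 : 0 < t by exact: lt_le_trans et.
rewrite /inv_sqrt !powRN lef_pV2 ?posrE ?powR_gt0//.
by apply: ge0_ler_powR; rewrite ?nnegrE ?invr_ge0 ?(ltW e0) ?(ltW t0).
Qed.

Lemma all_moments_bounded d (T : measurableType d) (P : probability T R)
    (f : T -> R) (B : R) : measurable_fun setT f -> (forall w, `|f w| <= B) ->
  all_moments P f.
Proof.
move=> mf fB; split => // k; apply: integrable_le (integrable_cst_fun P (B ^+ k)) _.
  by apply: measurable_funX; exact: measurableT_comp.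
move=> w; rewrite ger0_norm ?exprn_ge0//; apply: lerXn2r => //; rewrite nnegrE//.
exact: le_trans (fB w).
Qed.

(* [u(t, z) = gauss_cdf (z * inv_sqrt t)] solves the heat equation, so that replacing a centered
   variable of variance [v] by the time increment [v / 2] costs only third-order terms. *)
Lemma heat_pointwise (e : R) : 0 < e -> exists2 C : R, 0 < C &
  forall s x t v : R, e <= t -> 0 <= v ->
  `|gauss_cdf ((s - x) * inv_sqrt t) - gauss_cdf (s * inv_sqrt (t + v / 2)) +
    inv_sqrt t * (x * gauss_pdf (s * inv_sqrt t)) +
    (4 * t)^-1 * ((x ^+ 2 - v) * (s * inv_sqrt t * gauss_pdf (s * inv_sqrt t)))| <=
  C * (`|x| ^+ 3 + v ^+ 2).
Proof.
move=> e0; have [B B0 HB] := @gauss_pdf_bounds R.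
have [C1 C10 H1] := heat_time_taylor e0.
have r0 := inv_sqrt_gt0 e0.
exists (B * inv_sqrt e ^+ 3 + C1); first by rewrite addr_gt0// mulr_gt0// exprn_gt0.
move=> s x t v et v0; have t0 : 0 < t by exact: lt_le_trans et.
have h0 : 0 <= v / 2 by rewrite divr_ge0.
have T1 := H1 s t (v / 2) et h0.
have T2 := @taylor3_bound R gauss_cdf gauss_pdf (fun z => - (z / 2) * gauss_pdf z)
  (fun z => (z ^+ 2 / 4 - 2^-1) * gauss_pdf z) (s * inv_sqrt t) (- (x * inv_sqrt t)) B
  (@is_derive_gauss_cdf R) (@is_derive_gauss_pdf R) _ _.
have {}T2 := T2 _ (fun z => let: And4 _ _ H _ := HB z in H).
have DD (z : R) : is_derive z 1 (fun z => - (z / 2) * gauss_pdf z)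
    ((z ^+ 2 / 4 - 2^-1) * gauss_pdf z).
  have D1 := is_derive_mull_fun (- 2^-1) (is_derive_id z (1 : R)).
  have D2 := is_derive_mul_fun D1 (is_derive_gauss_pdf z).
  rewrite (_ : (fun z => _) = fun t => - 2^-1 * id t * gauss_pdf t); last first.
    by apply/funext => y; rewrite /=; congr (_ * _); ring.
  by apply: (is_derive_eq D2); rewrite /=; field.
move/(_ DD): T2.
have -> : s * inv_sqrt t + - (x * inv_sqrt t) = (s - x) * inv_sqrt t by ring.
rewrite normrN normrM exprMn (gtr0_norm (inv_sqrt_gt0 t0)) => T2.
have r3 : inv_sqrt t ^+ 3 <= inv_sqrt e ^+ 3.
  apply: lerXn2r; rewrite ?nnegrE ?(ltW r0) ?(ltW (inv_sqrt_gt0 t0))//.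
  exact: inv_sqrt_le.
have B1 : B * (`|x| ^+ 3 * inv_sqrt t ^+ 3) <= B * inv_sqrt e ^+ 3 * `|x| ^+ 3.
  rewrite -mulrA; apply: ler_wpM2l; first exact: ltW.
  by rewrite mulrC; apply: ler_wpM2r.
have sq := sqr_inv_sqrt t0.
move: (gauss_cdf ((s - x) * inv_sqrt t)) (gauss_cdf (s * inv_sqrt (t + v / 2))) T1 T2 => G1 G2.
move: (inv_sqrt t) sq B1 => rt sq B1.
move: (gauss_cdf _) (gauss_pdf _) => G0 f0 T1 T2.
(* The heat equation in algebraic form: the second-order space term and the first-order time term
   have the same coefficient and combine into [x^2 - v], leaving the difference of the two Taylor
   remainders. *)
have -> : G1 - G2 + rt * (x * f0) + (4 * t)^-1 * ((x ^+ 2 - v) * (s * rt * f0)) =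
  (G1 - G0 - f0 * - (x * rt) - - (s * rt / 2) * f0 * (- (x * rt)) ^+ 2 / 2) -
  (G2 - G0 - - 2^-1 * (s * rt * f0) / t * (v / 2)).
  have -> : (- (x * rt)) ^+ 2 = x ^+ 2 * t^-1 by rewrite sqrrN exprMn sq.
  by field; rewrite gt_eqF.
apply: le_trans (ler_normB _ _) _; rewrite mulrDr.
have x3 : 0 <= `|x| ^+ 3 by rewrite exprn_ge0.
have v2 : 0 <= v ^+ 2 by exact: sqr_ge0.
have e1 : 0 <= C1 * `|x| ^+ 3 by rewrite mulr_ge0// ltW.
have e2 : 0 <= B * inv_sqrt e ^+ 3 * v ^+ 2.
  by rewrite !mulr_ge0 ?exprn_ge0 ?(ltW B0) ?(ltW r0).
have e3 : 0 <= C1 * v ^+ 2 by rewrite mulr_ge0// ltW.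
have e4 : C1 * (v / 2) ^+ 2 = C1 * v ^+ 2 / 4 by field.
move: (inv_sqrt e ^+ 3) B1 e1 e2 => r B1 e1 e2.
rewrite e4 in T1; move: (`|G1 - _ - _ - _|) (`|G2 - _ - _|) T1 T2 => A1 A2 T1 T2.
move: (`|x| ^+ 3) (rt ^+ 3) B1 e1 T2 x3 => X3 r3' B1 e1 T2 x3.
by move: T1 T2 B1 e1 e2 e3; clear; lra.
Qed.

(** [S] is independent of [X i], so the first-order term vanishes by centering and the term in
    [x^2 - v] by the choice of [v]; the pointwise remainder is then integrated. *)
Lemma lindeberg_step (e : R) : 0 < e -> exists2 C : R, 0 < C &
  forall d (T : measurableType d) (P : probability T R) (I : finType) (D : pred I)
    (X : I -> {RV P >-> R}) (J : {set I}) (i : I) (g : R -> R) (S : T -> R)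
    (y t v b : R),
  mutually_independent D X -> (forall j, j \in J -> D j) -> D i -> i \notin J ->
  depends_on X J S -> measurable_fun setT g -> all_moments P (fun w => g (X i w)) ->
  \int[P]_w g (X i w) = 0 -> \int[P]_w (g (X i w) ^+ 2) = v ->
  \int[P]_w (`|g (X i w)| ^+ 3) <= b -> e <= t ->
  `|(\int[P]_w gauss_cdf ((y - (g (X i w) + S w)) * inv_sqrt t)) -
    \int[P]_w gauss_cdf ((y - S w) * inv_sqrt (t + v / 2))| <= C * (b + v ^+ 2).
Proof.
move=> e0; have [C C0 HC] := heat_pointwise e0; have [B B0 HB] := @gauss_pdf_bounds R.
exists C => // d T P I D X J i g S y t v b ind JD Di iJ SJ mg mgX g1 g2 g3 et.
have t0 : 0 < t by exact: lt_le_trans et.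
have v0 : 0 <= v by rewrite -g2; apply: Rintegral_ge0 => w _; exact: sqr_ge0.
pose z w := (y - S w) * inv_sqrt t.
have zJ : depends_on X J z.
  apply: depends_on_mul; last exact: depends_on_cst.
  apply: depends_on_add; first exact: depends_on_cst.
  by apply: (depends_on_comp (g := fun x => - x)) SJ; exact: oppr_measurable.
have fJ : depends_on X J (fun w => gauss_pdf (z w)).
  exact: depends_on_comp (@measurable_gauss_pdf R) zJ.
have zfJ : depends_on X J (fun w => z w * gauss_pdf (z w)) by exact: depends_on_mul.
have mS := depends_on_measurable SJ.
have mf : all_moments P (fun w => gauss_pdf (z w)).
  by apply: (@all_moments_bounded _ _ _ _ B) => [|w];
    [exact: depends_on_measurable fJ|case: (HB (z w))].
have mzf : all_moments P (fun w => z w * gauss_pdf (z w)).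
  by apply: (@all_moments_bounded _ _ _ _ B) => [|w];
    [exact: depends_on_measurable zfJ|case: (HB (z w))].
have mF (h : T -> R) : measurable_fun setT h -> all_moments P (fun w => gauss_cdf (h w)).
  move=> mh; apply: (@all_moments_bounded _ _ _ _ 1) => [|w].
    by apply: measurableT_comp mh; exact: measurable_gauss_cdf.
  by rewrite ger0_norm ?gauss_cdf_ge0// gauss_cdf_le1.
have mF1 : all_moments P (fun w => gauss_cdf ((y - (g (X i w) + S w)) * inv_sqrt t)).
  apply: mF; apply: measurable_funM => //; apply: measurable_funB => //.
  by apply: measurable_funD => //; exact: all_moments_measurable mgX.
have mF2 : all_moments P (fun w => gauss_cdf ((y - S w) * inv_sqrt (t + v / 2))).
  by apply: mF; apply: measurable_funM => //; exact: measurable_funB.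
have mg2 : all_moments P (fun w => g (X i w) ^+ 2 - v).
  by apply: all_moments_add (all_moments_cst _ _); exact: all_moments_exp.
have I1 : \int[P]_w (g (X i w) * gauss_pdf (z w)) = 0.
  rewrite (Rintegral_mul_depends ind JD Di iJ fJ mg) ?g1 ?mul0r//;
  by apply: all_moments_integrable => //; exact: all_moments_mul.
have I2 : \int[P]_w ((g (X i w) ^+ 2 - v) * (z w * gauss_pdf (z w))) = 0.
  rewrite (Rintegral_mul_depends (g := fun x => g x ^+ 2 - v) ind JD Di iJ zfJ).
  - rewrite RintegralB//; last exact: integrable_cst_fun.
      by rewrite g2 Rintegral_cst_probability subrr mul0r.
    by apply: all_moments_integrable; exact: all_moments_exp.
  - by apply: measurable_funB => //; exact: measurable_funX.
  - exact: all_moments_integrable.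
  - exact: all_moments_integrable.
  - by apply: all_moments_integrable; exact: all_moments_mul.
pose A w := gauss_cdf ((y - (g (X i w) + S w)) * inv_sqrt t) -
  gauss_cdf ((y - S w) * inv_sqrt (t + v / 2)).
pose A1 w := inv_sqrt t * (g (X i w) * gauss_pdf (z w)).
pose A2 w := (4 * t)^-1 * ((g (X i w) ^+ 2 - v) * (z w * gauss_pdf (z w))).
have mA : all_moments P A by apply: all_moments_add => //; exact: all_moments_opp.
have mA1 : all_moments P A1.
  by apply: all_moments_mul; [exact: all_moments_cst|exact: all_moments_mul].
have mA2 : all_moments P A2.
  by apply: all_moments_mul; [exact: all_moments_cst|exact: all_moments_mul].
have iA1 : \int[P]_w A1 w = 0.
  rewrite RintegralZl ?I1 ?mulr0//.
  by apply: all_moments_integrable; exact: all_moments_mul.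
have iA2 : \int[P]_w A2 w = 0.
  rewrite RintegralZl ?I2 ?mulr0//.
  by apply: all_moments_integrable; exact: all_moments_mul.
have mAA1 := all_moments_add mA mA1; have mAA := all_moments_add mAA1 mA2.
rewrite -RintegralB//; [|exact: all_moments_integrable..].
have -> : \int[P]_w (gauss_cdf ((y - (g (X i w) + S w)) * inv_sqrt t) -
   gauss_cdf ((y - S w) * inv_sqrt (t + v / 2))) = \int[P]_w (A w + A1 w + A2 w).
  have D1 := RintegralD measurableT (all_moments_integrable mAA1)
    (all_moments_integrable mA2).
  have D2 := RintegralD measurableT (all_moments_integrable mA)
    (all_moments_integrable mA1).
  rewrite [RHS]D1 D2.
  by rewrite iA1 iA2 !addr0.
apply: le_trans (le_normr_Rintegral measurableT (all_moments_integrable mAA)) _.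
have m3 : all_moments P (fun w => `|g (X i w)| ^+ 3).
  by apply: all_moments_exp; exact: all_moments_norm.
apply: (@le_trans _ _ (\int[P]_w (C * (`|g (X i w)| ^+ 3 + v ^+ 2)))).
  apply: le_Rintegral => //.
  - by apply: all_moments_integrable; exact: all_moments_norm.
  - apply: integrable_mull; apply: integrable_add; last exact: integrable_cst_fun.
    exact: all_moments_integrable.
  move=> w _; have := HC (y - S w) (g (X i w)) t v et v0.
  by rewrite /A /A1 /A2 /z opprD addrA addrAC.
rewrite RintegralZl//; last first.
  by apply: integrable_add; [exact: all_moments_integrable|exact: integrable_cst_fun].
rewrite RintegralD//; [|exact: all_moments_integrable|exact: integrable_cst_fun].
by rewrite Rintegral_cst_probability ler_wpM2l ?(ltW C0)// lerD2r.
Qed.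

(** The variables are replaced one at a time by induction on the list. Each replacement increases
    the time by [v i / 2], so it remains at least [e] and the same constant serves every step. *)
Lemma lindeberg_sum (e : R) : 0 < e -> exists2 C : R, 0 < C &
  forall d (T : measurableType d) (P : probability T R) (I : finType) (D : pred I)
    (X : I -> {RV P >-> R}) (g : I -> R -> R) (v b : I -> R),
  mutually_independent D X ->
  (forall i, measurable_fun setT (g i)) ->
  (forall i, D i -> all_moments P (fun w => g i (X i w))) ->
  (forall i, D i -> \int[P]_w g i (X i w) = 0) ->
  (forall i, D i -> \int[P]_w (g i (X i w) ^+ 2) = v i) ->
  (forall i, D i -> \int[P]_w (`|g i (X i w)| ^+ 3) <= b i) ->
  forall (l : seq I) (y t : R), uniq l -> all D l -> e <= t ->
  `|(\int[P]_w gauss_cdf ((y - \sum_(i <- l) g i (X i w)) * inv_sqrt t)) -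
    gauss_cdf (y * inv_sqrt (t + (\sum_(i <- l) v i) / 2))| <=
  C * \sum_(i <- l) (b i + v i ^+ 2).
Proof.
move=> e0; have [C C0 HC] := lindeberg_step e0; exists C => //.
move=> d T P I D X g v b ind mg mgX g1 g2 g3; elim=> [|i l IH] y t.
  move=> _ _ et; under eq_Rintegral do rewrite big_nil subr0.
  by rewrite Rintegral_cst_probability !big_nil mul0r addr0 subrr normr0 mulr0.
move=> /= /andP[il lu] /andP[Di Dl] et.
have v0 : 0 <= v i by rewrite -g2//; apply: Rintegral_ge0 => w _; exact: sqr_ge0.
pose J : {set I} := [set j in l].
have JD j : j \in J -> D j by rewrite inE; move/allP: Dl => Dl /Dl.
have iJ : i \notin J by rewrite inE.
have SJ : depends_on X J (fun w => \sum_(j <- l) g j (X j w)).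
  have : {subset l <= J} by move=> j; rewrite inE.
  elim: (l) => [|j k IHk] kJ.
    by under eq_fun do rewrite big_nil; exact: depends_on_cst.
  under eq_fun do rewrite big_cons; apply: depends_on_add.
    by apply: depends_on_comp => //; apply: depends_on_coord; apply: kJ; rewrite inE eqxx.
  by apply: IHk => x xk; apply: kJ; rewrite inE xk orbT.
have H1 := HC d T P I D X J i (g i) _ y t (v i) (b i) ind JD Di iJ SJ (mg i) (mgX i Di)
  (g1 i Di) (g2 i Di) (g3 i Di) et.
have et' : e <= t + v i / 2 by rewrite (le_trans et)// lerDl divr_ge0.
have H2 := IH y (t + v i / 2) lu Dl et'.
under eq_Rintegral do rewrite big_cons.
rewrite !big_cons mulrDl addrA mulrDr.
exact: le_trans (ler_distD _ _ _) (lerD H1 H2).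
Qed.

Lemma inv_sqrt_near1 (e : R) : 0 <= e -> `|inv_sqrt (1 + e) - 1| <= e.
Proof.
move=> e0; have e1 : 0 < 1 + e by rewrite ltr_pwDl.
have i1 : inv_sqrt (1 + e) <= 1.
  have inv1 : inv_sqrt 1 = 1 :> R by rewrite /inv_sqrt powR1.
  apply: le_trans (@inv_sqrt_le 1 (1 + e) ltr01 _) _; first by rewrite lerDl.
  by rewrite inv1.
have i2 : 1 - e <= inv_sqrt (1 + e).
  have := sqr_inv_sqrt e1; have := inv_sqrt_gt0 e1.
  move: (inv_sqrt _) i1 => r r1 r0 rE.
  apply: (@le_trans _ _ (r ^+ 2)); last first.
    by rewrite expr2 ler_piMl// ltW.
  rewrite rE -[leRHS]mul1r ler_pdivlMr//; move: e0; clear; nra.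
by rewrite ler_norml; move: i1 i2 e0; clear; lra.
Qed.

(** The indicator of [W <= y] is compared with the heat flow at a small time [e], centred at
    [y + de] and at [y - de]. Total variance 2 corresponds to time 1, so [lindeberg_sum] arrives at
    time [1 + e]. *)
Lemma lindeberg_clt (y eta : R) : 0 < eta -> exists2 kappa : R, 0 < kappa &
  forall d (T : measurableType d) (P : probability T R) (I : finType) (D : pred I)
    (X : I -> {RV P >-> R}) (g : I -> R -> R) (v b : I -> R),
  mutually_independent D X ->
  (forall i, measurable_fun setT (g i)) ->
  (forall i, D i -> all_moments P (fun w => g i (X i w))) ->
  (forall i, D i -> \int[P]_w g i (X i w) = 0) ->
  (forall i, D i -> \int[P]_w (g i (X i w) ^+ 2) = v i) ->
  (forall i, D i -> \int[P]_w (`|g i (X i w)| ^+ 3) <= b i) ->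
  \sum_(i | D i) v i = 2 -> \sum_(i | D i) (b i + v i ^+ 2) <= kappa ->
  `|fine (P [set w | \sum_(i | D i) g i (X i w) <= y]) - gauss_cdf y| <= eta.
Proof.
move=> eta0; have q0 : 0 < eta / 4 by rewrite divr_gt0.
have : {for y, continuous (@gauss_cdf R)}.
  apply: differentiable_continuous; apply/derivable1_diffP.
  exact: (@ex_derive _ _ _ _ _ _ _ (is_derive_gauss_cdf y)).
move=> /cvgrPdist_le/(_ _ q0)/nbhs_ballP[d0/= d00 Hd].
pose de := d0 / 4; have de0 : 0 < de by rewrite divr_gt0.
have near x : `|x - y| <= 2 * de -> `|gauss_cdf y - gauss_cdf x| <= eta / 4.
  move=> xy; apply: Hd; rewrite /ball/= distrC; apply: le_lt_trans xy _.
  by rewrite /de; move: d00; clear; lra.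
have [k k0 [Hk1 Hk2]] := gauss_cdf_limits q0.
(* The first bound makes [de / sqrt e] at least [k], beyond which the Gaussian tails are below
   [eta / 4]. The second makes time [1 + e] instead of 1 move the argument by at most [de]. *)
pose e := Num.min ((de / k) ^+ 2) (de / (`|y| + de)).
have yd : 0 < `|y| + de by rewrite ltr_wpDl.
have e0 : 0 < e by rewrite lt_min exprn_gt0 ?divr_gt0.
have ek : k <= de * inv_sqrt e.
  rewrite -ler_pdivrMl// -(ler_sqr (x := de^-1 * k)) ?nnegrE; first last.
  - by rewrite ltW// inv_sqrt_gt0.
  - by rewrite mulr_ge0 ?invr_ge0// ltW.
  rewrite sqr_inv_sqrt// -[leLHS]invrK lef_pV2 ?posrE//; last first.
    by rewrite invr_gt0 exprn_gt0// mulr_gt0 ?invr_gt0.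
  have -> : ((de^-1 * k) ^+ 2)^-1 = (de / k) ^+ 2 by field; rewrite !gt_eqF.
  by rewrite ge_min lexx.
have ey (s : R) : `|s| <= de -> `|(y + s) * inv_sqrt (e + 2 / 2) - y| <= 2 * de.
  move=> sd; rewrite divff// [e + 1]addrC.
  have H := inv_sqrt_near1 (ltW e0).
  have -> : (y + s) * inv_sqrt (1 + e) - y = (y + s) * (inv_sqrt (1 + e) - 1) + s by ring.
  apply: le_trans (ler_normD _ _) _; rewrite mulr_natl mulr2n; apply: lerD => //.
  rewrite normrM; apply: (@le_trans _ _ ((`|y| + de) * e)).
    by apply: ler_pM => //; apply: le_trans (ler_normD _ _) _; rewrite lerD2l.
  by rewrite mulrC -ler_pdivlMr// ge_min lexx orbT.
have [C C0 HC] := lindeberg_sum e0.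
exists (eta / 4 / C); first by rewrite divr_gt0.
move=> d T P I D X g v b ind mg mgX g1 g2 g3 vs bs.
pose W w := \sum_(i | D i) g i (X i w).
have WE w : W w = \sum_(i <- [seq i <- index_enum I | D i]) g i (X i w).
  by rewrite big_filter.
have main s : `|s| <= de ->
    `|(\int[P]_w gauss_cdf ((y + s - W w) * inv_sqrt e)) - gauss_cdf y| <= eta / 2.
  move=> sd.
  have := HC d T P I D X g v b ind mg mgX g1 g2 g3 [seq i <- index_enum I | D i] (y + s) e.
  rewrite filter_uniq ?index_enum_uniq// filter_all lexx => /(_ isT isT isT).
  rewrite !big_filter vs.
  under eq_Rintegral do rewrite -WE.
  move=> H1; have H2 : C * \sum_(i | D i) (b i + v i ^+ 2) <= eta / 4.
    by rewrite mulrC -ler_pdivlMr.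
  have := near _ (ey s sd); have := le_trans H1 H2.
  move: (\int[P]_w _) (gauss_cdf y) (gauss_cdf _) => a1 a2 a3.
  by rewrite !ler_norml => /andP[? ?] /andP[? ?]; apply/andP; split; lra.
have mW : measurable_fun setT W.
  by apply: (@all_moments_measurable _ _ _ P); apply: all_moments_sum => i Di; exact: mgX.
have mA : measurable [set w | W w <= y].
  rewrite (_ : [set w | W w <= y] = W @^-1` `]-oo, y]); last first.
    by apply/seteqP; split => w /=; rewrite in_itv.
  by rewrite -[X in measurable X]setTI; exact: (mW measurableT _ (measurable_itv `]-oo, y])).
set A := [set w | W w <= y] in mA *.
have PA : \int[P]_w (\1_A w) = fine (P A).
  by rewrite /Rintegral integral_indic// setIT.
have iA : P.-integrable setT (EFin \o \1_A) by exact: integrable_indic.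
have iF s : P.-integrable setT (EFin \o (fun w => gauss_cdf ((y + s - W w) * inv_sqrt e))).
  apply: all_moments_integrable; apply: (@all_moments_bounded _ _ _ _ 1) => [|w].
    apply: measurableT_comp; first exact: measurable_gauss_cdf.
    by apply: measurable_funM => //; exact: measurable_funB.
  by rewrite ger0_norm ?gauss_cdf_ge0// gauss_cdf_le1.
have re0 : 0 < inv_sqrt e by exact: inv_sqrt_gt0.
have PA1 : 0 <= fine (P A) <= 1.
  by rewrite fine_ge0//= -lee_fin fineK ?fin_num_measure// probability_le1.
have up : (1 - eta / 4) * fine (P A) <= \int[P]_w gauss_cdf ((y + de - W w) * inv_sqrt e).
  rewrite -PA -RintegralZl//; apply: le_Rintegral => //; first exact: integrable_mull.
  move=> w _; rewrite indicE; have [wA|wA] := boolP (w \in A); last first.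
    by rewrite mulr0 gauss_cdf_ge0.
  rewrite mulr1; apply: le_trans Hk1 _; apply: gauss_cdf_homo.
  apply: le_trans ek _; rewrite ler_wpM2r ?(ltW re0)//.
  have {wA} : W w <= y by move: wA; rewrite inE.
  by move: (W w) => c; clear; lra.
have lo : \int[P]_w gauss_cdf ((y - de - W w) * inv_sqrt e) <= fine (P A) + eta / 4.
  have -> : fine (P A) + eta / 4 = \int[P]_w (\1_A w + eta / 4).
    by rewrite RintegralD// ?PA ?Rintegral_cst_probability//; exact: integrable_cst_fun.
  apply: le_Rintegral => //.
    by apply: integrable_add => //; exact: integrable_cst_fun.
  move=> w _; rewrite indicE; have [wA|wA] := boolP (w \in A).
    by apply: le_trans (gauss_cdf_le1 _) _; rewrite lerDl ltW.
  rewrite add0r; apply: le_trans _ Hk2; apply: gauss_cdf_homo.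
  apply: (@le_trans _ _ (- de * inv_sqrt e)); last by rewrite mulNr lerN2.
  rewrite ler_wpM2r ?(ltW re0)//.
  have {wA} : y <= W w by move: wA; rewrite notin_setE /A/= => /negP; rewrite -ltNge => /ltW.
  by move: (W w) => c; clear; lra.
have dn1 : `|de| <= de by rewrite gtr0_norm.
have dn2 : `|- de| <= de by rewrite normrN.
move: (main _ dn1) (main _ dn2) up lo PA1; rewrite -/A.
move: (fine (P A)) (\int[P]_w _) (\int[P]_w _) (gauss_cdf y) => a1 a2 a3 a4.
rewrite !ler_norml => /andP[? ?] /andP[? ?] up lo /andP[? ?].
have : eta / 4 * a1 <= eta / 4 by rewrite ler_piMr// ltW.
move=> ?; apply/andP; split; lra.
Qed.

End lindeberg.

(** * Measurability of the operator norm *)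

Section opnorm_measurable.
Context {R : realType}.

Lemma vec_norm_dual n (p q : R) (w : 'cV[R]_n) : 1 < p -> p^-1 + q^-1 = 1 ->
  exists2 y : 'I_n -> R, \sum_i `|y i| `^ q <= 1 & \sum_i y i * w i 0 = vec_norm p w.
Proof.
move=> p1 pq; have p0 : 0 < p by lra.
have [q1 qE] := conjugate_gt0 p1 pq; have q0 : 0 < q by lra.
have [W0|W0] := eqVneq (\sum_i `|w i 0| `^ p) 0.
  exists (fun=> 0); first by rewrite big1// => i _; rewrite normr0 powR0// gt_eqF.
  rewrite /vec_norm W0 powR0 ?invr_eq0 ?gt_eqF//.
  by rewrite big1// => i _; rewrite mul0r.
set W := vec_norm p w; have Wgt0 : 0 < W by rewrite powR_gt0 ?lt0r ?W0 ?powR_sum_ge0.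
have Wp : W `^ p = \sum_i `|w i 0| `^ p by rewrite powR_inv_powR ?powR_sum_ge0.
have pq1 : (p - 1) * q = p.
  have -> : q = 1 + (p - 1)^-1 by rewrite -qE; lra.
  by field; rewrite gt_eqF//; lra.
exists (fun i => Num.sg (w i 0) * (`|w i 0| / W) `^ (p - 1)).
  have E : \sum_i (`|w i 0| / W) `^ p = 1.
    under eq_bigr do rewrite powRM ?invr_ge0 ?(ltW Wgt0)//.
    rewrite -mulr_suml -Wp -powRM ?invr_ge0 ?(ltW Wgt0)//.
    by rewrite divff ?gt_eqF// powR1.
  rewrite -[leRHS]E; apply: ler_sum => i _.
  rewrite normrM (ger0_norm (powR_ge0 _ _)) normr_sg.
  have [->|w0] := eqVneq (w i 0) 0 => /=.
    by rewrite mul0r powR0 ?gt_eqF// powR_ge0.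
  by rewrite mul1r -powRrM pq1.
transitivity (W `^ p * W `^ (1 - p)); last first.
  by rewrite -powR_addr_gt0// addrCA subrr addr0 powRr1// ltW.
rewrite Wp mulr_suml; apply: eq_bigr => i _.
rewrite mulrAC -normrEsg powRM ?invr_ge0 ?(ltW Wgt0)//.
rewrite mulrA mulr_powRB1//. congr (_ * _).
by rewrite -[W^-1](powR_inv1 (ltW Wgt0)) -powRrM mulN1r opprB.
Qed.

(** In the dual form of the p-norm, the coordinates of both vectors have modulus at most 1, so a
    change of the entries is felt at most in their l1 distance. *)
Lemma opnorm_lipschitz n (p r : R) (A B : 'M[R]_n) : 1 < p -> 0 < r ->
  opnorm r p A <= opnorm r p B + \sum_i \sum_j `|A i j - B i j|.
Proof.
move=> p1 r0; have p0 : 0 < p by lra.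
pose q := p / (p - 1).
have pq : p^-1 + q^-1 = 1.
  by rewrite /q invfM invrK; field; rewrite !gt_eqF//; lra.
have [q1 _] := conjugate_gt0 p1 pq; have q0 : 0 < q by lra.
have le1 (s : R) (z : 'I_n -> R) i : 0 < s -> \sum_i `|z i| `^ s <= 1 -> `|z i| <= 1.
  move=> s0 zs; have H : `|z i| `^ s <= 1.
    by apply: le_trans zs; rewrite (bigD1 i)//= lerDl sumr_ge0// => k _; exact: powR_ge0.
  rewrite -(powR_powR_inv s0 (normr_ge0 (z i))) [leRHS](_ : 1 = 1 `^ s^-1); last by rewrite powR1.
  by apply: ge0_ler_powR; rewrite ?nnegrE ?powR_ge0 ?invr_ge0 ?(ltW s0).
apply: opnorm_le => // x x1; have [y y1 <-] := vec_norm_dual (A *m x) p1 pq.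
have xr := vec_norm_le1 r0 x1.
have -> : \sum_i y i * (A *m x) i 0 = \sum_i y i * (B *m x) i 0 +
    \sum_i \sum_j y i * (A i j - B i j) * x j 0.
  rewrite -big_split/=; apply: eq_bigr => i _; rewrite !mxE !mulr_sumr -big_split/=.
  by apply: eq_bigr => j _; ring.
apply: lerD.
  apply: le_trans (vec_norm_opnorm B p0 r0 x1).
  apply: (@le_trans _ _ (\sum_i `|y i| * (\col_i `|(B *m x) i 0|) i 0)).
    by apply: ler_sum => i _; rewrite mxE -normrM ler_norm.
  have H := @sum_holder R n p q (fun i => `|y i|) (\col_i `|(B *m x) i 0|) p1 pq
    (fun i => normr_ge0 (y i)) y1.
  apply: (le_trans H); rewrite le_eqVlt; apply/orP; left; apply/eqP.
  by congr (_ `^ _); apply: eq_bigr => i _; rewrite mxE normr_id.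
apply: ler_sum => i _; apply: ler_sum => j _; apply: le_trans (ler_norm _) _.
rewrite !normrM -[leRHS]mulr1; apply: ler_pM => //.
  by rewrite ler_piMl// (le1 q).
exact: (le1 r (fun j => x j 0)).
Qed.

(** By the Lipschitz property, [F < c] holds at a matrix exactly when some rational matrix [M z]
    within rational distance [e] satisfies [F (M z) + e < c]. The set is therefore a countable union
    of measurable sets. *)
Lemma measurable_lipschitz d (T : measurableType d) (n : nat) (F : 'M[R]_n -> R)
    (a : 'I_n -> 'I_n -> T -> R) :
  (forall A B, F A <= F B + \sum_i \sum_j `|A i j - B i j|) ->
  (forall i j, measurable_fun setT (a i j)) ->
  measurable_fun setT (fun w => F (\matrix_(i, j) a i j w)).
Proof.
move=> Flip ma.
pose dist (z : {ffun 'I_n * 'I_n -> rat}) w := \sum_i \sum_j `|a i j w - ratr (z (i, j))|.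
pose M (z : {ffun 'I_n * 'I_n -> rat}) : 'M[R]_n := \matrix_(i, j) ratr (z (i, j)).
have mdist z : measurable_fun setT (dist z).
  apply: measurable_sum => i; apply: measurable_sum => j.
  by apply: measurableT_comp => //; exact: measurable_funB.
apply: (measurability _ (RGenInftyO.measurableE R)).
move=> _ [_ [c ->] <-]; rewrite setTI.
have -> : (fun w => F (\matrix_(i, j) a i j w)) @^-1` `]-oo, c[ =
  \bigcup_(zq : {ffun 'I_n * 'I_n -> rat} * rat)
    [set w | (dist zq.1 w < ratr zq.2) && (F (M zq.1) + ratr zq.2 < c)].
  have symd (A B : 'M[R]_n) : \sum_i \sum_j `|A i j - B i j| = \sum_i \sum_j `|B i j - A i j|.
    by apply: eq_bigr => i _; apply: eq_bigr => j _; rewrite distrC.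
  have distE z w : \sum_i \sum_j `|(\matrix_(i, j) a i j w) i j - M z i j| = dist z w.
    by apply: eq_bigr => i _; apply: eq_bigr => j _; rewrite !mxE.
  apply/seteqP; split => w /=; rewrite ?in_itv/=; last first.
    move=> [[z e] _ /= /andP[H1 H2]]; apply: le_lt_trans H2.
    by apply: le_trans (Flip _ (M z)) _; rewrite lerD2l distE ltW.
  move=> Fc; set A := \matrix_(i, j) a i j w in Fc.
  (* Half of the margin, since the distance is spent twice: once to pass from [A] to the rational
     matrix and once as the radius [e]. *)
  have : 0 < (c - F A) / 2 by rewrite divr_gt0// subr_gt0.
  move=> /rat_in_itvoo[e]; rewrite in_itv/= => /andP[e0 ec].
  (* The 1 avoids a zero denominator for [n = 0] and makes the total distance strictly smaller than
     [e]. *)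
  pose h : R := ratr e / (n%:R ^+ 2 + 1).
  have n1 : 0 < n%:R ^+ 2 + 1 :> R by rewrite ltr_wpDl// sqr_ge0.
  have h0 : 0 < h by rewrite divr_gt0.
  have approx i j : exists q : rat, `|a i j w - ratr q| < h.
    have : a i j w < a i j w + h by rewrite ltrDl.
    move=> /rat_in_itvoo[q]; rewrite in_itv/= => /andP[q1 q2]; exists q.
    by rewrite ltr_norml; move: q1 q2 h0; clear; lra.
  have [z zP] := choice (fun ij : 'I_n * 'I_n => approx ij.1 ij.2).
  have dz : dist (finfun z) w < ratr e.
    apply: (@le_lt_trans _ _ (n%:R ^+ 2 * h)).
      rewrite /dist; apply: (@le_trans _ _ (\sum_(i < n) \sum_(j < n) h)).
        apply: ler_sum => i _; apply: ler_sum => j _; rewrite ffunE ltW//.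
        exact: (zP (i, j)).
      by rewrite !sumr_const !card_ord -!mulrnA -[leLHS]mulr_natl natrM expr2.
    have -> : ratr e = (n%:R ^+ 2 + 1) * h by rewrite /h mulrC divfK// gt_eqF.
    by rewrite mulrDl mul1r ltrDl.
  exists (finfun z, e) => //=; rewrite dz/=.
  have := Flip (M (finfun z)) A; rewrite symd distE.
  by move: dz ec; clear; lra.
apply: countable_bigcupT_measurable => //.
move=> [z e] /=; case: (F (M z) + ratr e < c); last first.
  by rewrite (_ : [set _ | _] = set0)//; apply/seteqP; split => w //=; rewrite andbF.
rewrite (_ : [set _ | _] = dist z @^-1` `]-oo, (ratr e)[); last first.
  by apply/seteqP; split => w /=; rewrite andbT in_itv.
rewrite -[X in measurable X]setTI; exact: (mdist z measurableT _ (measurable_itv _)).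
Qed.

Lemma measurable_opnorm d (T : measurableType d) (n : nat) (p r c : R)
    (a : 'I_n -> 'I_n -> T -> R) : 1 < p -> 0 < r ->
  (forall i j, measurable_fun setT (a i j)) ->
  measurable_fun setT (fun w => opnorm r p (c *: \matrix_(i, j) a i j w)).
Proof.
move=> p1 r0 ma.
have -> : (fun w => opnorm r p (c *: \matrix_(i, j) a i j w)) =
    (fun w => opnorm r p (\matrix_(i, j) (c * a i j w))).
  by apply/funext => w; congr opnorm; apply/matrixP => i j; rewrite !mxE.
apply: (@measurable_lipschitz _ _ n (opnorm r p) (fun i j w => c * a i j w)).
  by move=> A B; exact: opnorm_lipschitz.
by move=> i j; exact: measurable_funM.
Qed.

End opnorm_measurable.

(** * The good event *)

Section union_bound.
Context d (T : measurableType d) (R : realType) (P : probability T R).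

Lemma measurable_ge_set (f : T -> R) (t : R) : measurable_fun setT f ->
  measurable [set w | t <= f w].
Proof.
move=> mf; rewrite (_ : [set w | t <= f w] = f @^-1` `[t, +oo[); last first.
  by apply/seteqP; split => w /=; rewrite in_itv/= andbT.
rewrite -[X in measurable X]setTI; exact: (mf measurableT _ (measurable_itv `[t, +oo[)).
Qed.

Lemma union_markov (s : seq ((T -> R) * R)) (c : R) : 0 <= c ->
  (forall i, (i < size s)%N -> let z := nth (fun=> 0, 0) s i in
    [/\ forall w, 0 <= z.1 w, all_moments P z.1, 0 < z.2 &
        \int[P]_w z.1 w <= c * z.2]) ->
  measurable [set w | ~~ all (fun z : (T -> R) * R => z.1 w < z.2)%R s] /\
  (P [set w | ~~ all (fun z : (T -> R) * R => z.1 w < z.2)%R s] <= (c * (size s)%:R)%:E)%E.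
Proof.
move=> c0; elim: s => [_|z s IH H] /=.
  by rewrite (_ : [set _ | _] = set0) ?measure0 ?mulr0//; apply/seteqP; split.
have /= [z0 mz t0 zc] := H 0%N isT.
have [ms Ps] := IH (fun i => H i.+1).
have -> : [set w | ~~ ((z.1 w < z.2) && all (fun z : (T -> R) * R => z.1 w < z.2)%R s)] =
    [set w | z.2 <= z.1 w] `|` [set w | ~~ all (fun z : (T -> R) * R => z.1 w < z.2)%R s].
  apply/seteqP; split => w /=; rewrite negb_and -leNgt; first by move/orP.
  by move=> H'; apply/orP.
have mz1 := measurable_ge_set z.2 (all_moments_measurable mz).
split; first exact: measurableU.
apply: (le_trans (measureU2 P mz1 ms)).
rewrite -natr1 mulrDr mulr1 addrC EFinD; apply: leeD => //.
have := markov_ge0 t0 z0 (all_moments_measurable mz) (all_moments_integrable mz) zc.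
by rewrite mulfK// gt_eqF.
Qed.

End union_bound.

Section concentration.
Context d (T : measurableType d) (R : realType) (P : probability T R) (n : nat).
Context (a : 'I_n -> 'I_n -> {RV P >-> R}) (m M : R) (k : nat).
Hypothesis asym : forall i j w, a i j w = a j i w.
Hypothesis adiag : forall i w, a i i w = 0.
Hypothesis aind : mutually_independent (fun e : 'I_n * 'I_n => (e.1 < e.2)%N)
        (fun e => a e.1 e.2).
Hypothesis amom : forall i j : 'I_n, (i < j)%N -> all_moments P (fun w => a i j w - m).
Hypothesis amean : forall i j : 'I_n, (i < j)%N -> \int[P]_w (a i j w - m) = 0.
Hypothesis a4 : forall i j : 'I_n, (i < j)%N -> \int[P]_w ((a i j w - m) ^+ 4) <= M.
Hypothesis a2k : forall i j : 'I_n, (i < j)%N -> \int[P]_w ((a i j w - m) ^+ (2 * k)) <= M.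
Hypothesis k0 : (0 < k)%N.
Hypothesis M0 : 0 <= M.

Local Notation N := (noise a m).

(* With [g = n `^ (1 / 8)], the expectation of each statistic is smaller than its threshold
   by a factor of order at least [g]. *)
Definition statistics (g : R) : seq ((T -> R) * R) :=
  [:: (fun w => \sum_i \sum_j (\sum_l N i l w * N l j w) ^+ 2, g ^+ 28);
      (fun w => \sum_i \sum_j N i j w ^+ (2 * k), g ^+ 24);
      (fun w => (\sum_i \sum_j N i j w) ^+ 2, g ^+ 20);
      (fun w => (\sum_i \sum_j noise_dev a m i j w) ^+ 2, g ^+ 20);
      (fun w => (\sum_i \sum_j \sum_l (j != l)%:R * (N i j w * N i l w)) ^+ 2, g ^+ 28);
      (fun w => \sum_i (\sum_j N i j w) ^+ 4, g ^+ 28)].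

Lemma noise_exp2k i j : \int[P]_w (N i j w ^+ (2 * k)) <= M.
Proof.
have [<-|ij] := eqVneq i j.
  under eq_Rintegral do rewrite (noise_diag _ adiag) expr0n muln_eq0/= eqn0Ngt k0.
  by rewrite Rintegral_cst_probability.
under eq_Rintegral do rewrite (noise_edge _ asym)//.
by apply: a2k; exact: edge_lt.
Qed.

Lemma statistics_bad (g : R) : 1 <= g -> g ^+ 8 = n%:R ->
  let C := 8 * (M + (1 + M) ^+ 2) in
  measurable [set w | ~~ all (fun z : (T -> R) * R => z.1 w < z.2)%R (statistics g)] /\
  (P [set w | ~~ all (fun z : (T -> R) * R => z.1 w < z.2)%R (statistics g)] <= (C / g * 6)%:E)%E.
Proof.
move=> g1 gn C; have mN := noise_moments asym adiag amom.
have g0 : 0 < g by lra.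
have M2 : 0 <= (1 + M) ^+ 2 by exact: sqr_ge0.
have C0 : 0 <= C by rewrite /C mulr_ge0// addr_ge0.
have Cg0 : 0 <= C / g by rewrite divr_ge0// ltW.
(* Each expectation is at most [c * n^e = c * g^(8 e)], and [8 e] is below the exponent of the
   threshold; a gap of one power of [g] already gives probability [C / g]. *)
have bound (c : R) (u v : nat) : 0 <= c -> c <= C -> (u < v)%N ->
    c * g ^+ u <= C / g * g ^+ v.
  move=> c0 cC uv; rewrite -(subnK uv) addnS exprS mulrA divfK ?gt_eqF//.
  rewrite exprD; apply: ler_pM => //; rewrite ?exprn_ge0 ?(ltW g0)//.
  by rewrite ler_peMl ?exprn_ege1// exprn_ge0// ltW.
have gE e : n%:R ^+ e = g ^+ (8 * e) by rewrite -gn exprM.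
have [MC MC2 MC6 MC4] : [/\ M <= C, 2 * M <= C, 6 * M <= C & 4 * (1 + M) <= C].
  have : 1 <= (1 + M) ^+ 2 by rewrite exprn_ege1// lerDl.
  by rewrite /C; move: (_ ^+ 2) M0 => u; split; lra.
have ms (I J : finType) (F : I -> J -> T -> R) : (forall i j, all_moments P (F i j)) ->
    all_moments P (fun w => \sum_i \sum_j F i j w).
  by move=> FF; apply: all_moments_sum => i _; apply: all_moments_sum => j _.
apply: union_markov => //; case=> [_|[_|[_|[_|[_|[_|//]]]]]].
- split => /=.
  + by move=> w; apply: sumr_ge0 => i _; apply: sumr_ge0 => j _; exact: sqr_ge0.
  + apply: ms => i j; apply: all_moments_exp; apply: all_moments_sum => l _.
    exact: all_moments_mul.
  + by rewrite exprn_gt0.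
  apply: le_trans (noise_square_frobenius asym adiag aind amom amean a4 M0) _.
  by rewrite gE; apply: bound => //; rewrite mulr_ge0.
- split => /=.
  + move=> w; apply: sumr_ge0 => i _; apply: sumr_ge0 => j _.
    by rewrite exprM exprn_ge0// sqr_ge0.
  + by apply: ms => i j; exact: all_moments_exp.
  + by rewrite exprn_gt0.
  rewrite Rintegral_sum; last first.
    by move=> i; apply: all_moments_sum => j _; exact: all_moments_exp.
  apply: (@le_trans _ _ (\sum_(i < n) \sum_(j < n) M)).
    apply: ler_sum => i _; rewrite Rintegral_sum; last by move=> j; exact: all_moments_exp.
    by apply: ler_sum => j _; exact: noise_exp2k.
  rewrite !sumr_const !card_ord -!mulrnA -[leLHS]mulr_natr natrM -expr2 gE.
  exact: bound.
- split => /=; [by move=> w; exact: sqr_ge0| |by rewrite exprn_gt0|].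
    by apply: all_moments_exp; apply: ms.
  apply: le_trans (noise_sum_sqr asym adiag aind amom amean a4 M0) _.
  by rewrite gE; apply: bound => //; rewrite mulr_ge0// addr_ge0.
- split => /=; [by move=> w; exact: sqr_ge0| |by rewrite exprn_gt0|].
    by apply: all_moments_exp; apply: ms => i j; exact: noise_dev_moments.
  apply: le_trans (noise_sum_dev_sqr asym adiag aind amom a4 M0) _.
  by rewrite gE; apply: bound.
- split => /=; [by move=> w; exact: sqr_ge0| |by rewrite exprn_gt0|].
    apply: all_moments_exp; apply: ms => i j; apply: all_moments_sum => l _.
    by apply: all_moments_mul; [exact: all_moments_cst|exact: all_moments_mul].
  apply: le_trans (noise_sum_cross_sqr asym adiag aind amom amean a4 M0) _.
  by rewrite gE; apply: bound => //; rewrite mulr_ge0.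
- split => /=.
  + by move=> w; apply: sumr_ge0 => i _; rewrite (_ : 4 = 2 * 2)%N// exprM sqr_ge0.
  + by apply: all_moments_sum => i _; apply: all_moments_exp; exact: all_moments_sum.
  + by rewrite exprn_gt0.
  rewrite Rintegral_sum; last first.
    by move=> i; apply: all_moments_exp; exact: all_moments_sum.
  apply: (@le_trans _ _ (\sum_(i < n) 6 * M * n%:R ^+ 2)).
    by apply: ler_sum => i _; exact: (noise_row_exp4 asym adiag aind amom amean a4 M0).
  rewrite sumr_const card_ord -[leLHS]mulr_natr -mulrA -exprSr gE.
  by apply: bound => //; rewrite mulr_ge0.
Qed.

End concentration.

Section good_event.
Context (R : realType) (n : nat) (E S : 'I_n -> 'I_n -> R) (g : R) (m : nat).
Hypothesis Es : forall i j, E i j = E j i.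
Hypothesis g1 : 1 <= g.
Hypothesis gn : g ^+ 8 = n%:R.
(** With this order, [E i j ^+ (2 * k) < g ^+ 24] gives [E i j ^+ 2 <= L] with [L ^+ m.+1 = g], so
    that the factor [L ^+ m] costs at most one power of [g]. *)
Let k := (24 * m.+1)%N.
Hypothesis Z1 : \sum_i \sum_j (\sum_l E i l * E l j) ^+ 2 < g ^+ 28.
Hypothesis Z2 : \sum_i \sum_j E i j ^+ (2 * k) < g ^+ 24.
Hypothesis Z3 : (\sum_i \sum_j E i j) ^+ 2 < g ^+ 20.
Hypothesis Z4 : (\sum_i \sum_j (E i j ^+ 2 - S i j)) ^+ 2 < g ^+ 20.
Hypothesis Z5 : (\sum_i \sum_j \sum_l (j != l)%:R * (E i j * E i l)) ^+ 2 < g ^+ 28.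
Hypothesis Z6 : \sum_i (\sum_j E i j) ^+ 4 < g ^+ 28.

Let g0 : 0 < g. Proof. exact: lt_le_trans g1. Qed.

Lemma sqr_lt_norm_le (x : R) e : x ^+ 2 < g ^+ (2 * e) -> `|x| <= g ^+ e.
Proof.
move=> /ltW H; apply: le_norm_of_sqr; first by rewrite exprn_ge0// ltW.
by rewrite -exprM mulnC.
Qed.

(** The left side is the pairing of [v v^T] with the square of [E]. By Cauchy-Schwarz it is at most
    the squared norm of [v] times the Frobenius norm of that square, whence half of the exponent
    28. *)
Lemma good_operator (v : 'I_n -> R) :
  \sum_j (\sum_i v i * E i j) ^+ 2 <= g ^+ 14 * \sum_i v i ^+ 2.
Proof.
have -> : \sum_j (\sum_i v i * E i j) ^+ 2 =
    \sum_(x : 'I_n * 'I_n) (v x.1 * v x.2) * \sum_l E x.1 l * E l x.2.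
  under eq_bigr do rewrite expr2 big_distrlr/= pair_bigA/=.
  rewrite exchange_big/=; apply: eq_bigr => x _; rewrite mulr_sumr.
  by apply: eq_bigr => j _; rewrite (Es j x.2); ring.
have v0 : 0 <= \sum_i v i ^+ 2 by apply: sumr_ge0 => i _; exact: sqr_ge0.
apply: le_trans (ler_norm _) _; apply: le_norm_of_sqr.
  by rewrite mulr_ge0// exprn_ge0// ltW.
apply: le_trans (sqr_sum_le _ _) _.
rewrite exprMn mulrC -exprM; apply: ler_pM.
- by apply: sumr_ge0 => x _; exact: sqr_ge0.
- by apply: sumr_ge0 => x _; exact: sqr_ge0.
- by apply: ltW; move: Z1; rewrite pair_bigA.
rewrite expr2 big_distrlr/= pair_bigA/=.
by under eq_bigr do rewrite exprMn.
Qed.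

Lemma sum_term_le (F : 'I_n -> R) i : (forall j, 0 <= F j) -> F i <= \sum_j F j.
Proof. by move=> F0; rewrite (bigD1 i)//= lerDl sumr_ge0. Qed.

Lemma good_entries i j : E i j ^+ 2 <= g `^ m.+1%:R^-1.
Proof.
set L := _ `^ _; have LE : L ^+ m.+1 = g by rewrite -powR_mulrn ?powR_ge0// powR_inv_powR// ltW.
have L0 : 0 <= L by exact: powR_ge0.
rewrite -(@ler_pXn2r _ k) ?nnegrE ?sqr_ge0//.
rewrite -exprM [leRHS](_ : _ = g ^+ 24); last by rewrite /k mulnC exprM LE.
apply: ltW; apply: le_lt_trans Z2.
have p0 i' j' : 0 <= E i' j' ^+ (2 * k) by rewrite exprM exprn_ge0// sqr_ge0.
apply: le_trans (@sum_term_le (fun i => \sum_j E i j ^+ (2 * k)) i _).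
  exact: (@sum_term_le (fun j => E i j ^+ (2 * k))).
by move=> i'; apply: sumr_ge0.
Qed.

Lemma good_row i : `|\sum_j E i j| <= g ^+ 7.
Proof.
apply: le_norm_of_sqr; first by rewrite exprn_ge0// ltW.
rewrite -(@ler_pXn2r _ 2) ?nnegrE ?sqr_ge0// -!exprM; apply: ltW.
apply: le_lt_trans Z6; apply: (@sum_term_le (fun i => (\sum_j E i j) ^+ 4)) => j.
by rewrite (_ : 4 = 2 * 2)%N// exprM sqr_ge0.
Qed.

Lemma good_rows : `|\sum_i (\sum_j E i j) ^+ 2 - \sum_i \sum_j S i j| <= 2 * g ^+ 14.
Proof.
have -> : \sum_i (\sum_j E i j) ^+ 2 - \sum_i \sum_j S i j =
  \sum_i \sum_j (E i j ^+ 2 - S i j) +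
  \sum_i \sum_j \sum_l (j != l)%:R * (E i j * E i l).
  rewrite -sumrB -big_split/=; apply: eq_bigr => i _.
  rewrite expr2 big_distrlr/= sumrB addrAC; congr (_ - _).
  rewrite -big_split/=; apply: eq_bigr => j _.
  rewrite (bigD1 j)//= [X in _ = _ + X](bigD1 j)//= eqxx mul0r add0r expr2.
  by congr (_ + _); apply: eq_bigr => l lj; rewrite eq_sym lj mul1r.
apply: le_trans (ler_normD _ _) _; rewrite mulr_natl mulr2n; apply: lerD.
  apply: (@le_trans _ _ (g ^+ 10)); first exact: (@sqr_lt_norm_le _ 10).
  by apply: ler_weXn2l.
exact: (@sqr_lt_norm_le _ 14).
Qed.

End good_event.

Section expansion.
Context (R : realType).

(** A deterministic statement: besides symmetry and nonnegativity of the matrix, the noise enters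
    only through the six inequalities that define the good event. *)
Lemma opnorm_expansion (p r m0 M0 K : R) : 1 < p -> p <= r ->
  0 < m0 -> 0 < M0 -> 0 <= K -> exists m : nat,
  forall eps : R, 0 < eps -> exists2 delta : R, 0 < delta &
  forall (n : nat) (E S : 'I_n -> 'I_n -> R) (g mu V : R),
  (0 < n)%N -> 1 <= g -> g ^+ 8 = n%:R -> 2 <= delta * g ->
  m0 <= mu <= M0 -> 0 <= V <= K * n%:R ^+ 2 ->
  \sum_i \sum_j S i j = 2 * V ->
  (forall i j, E i j = E j i) -> (forall i j, 0 <= zero_diag_add mu E i j) ->
  \sum_i \sum_j (\sum_l E i l * E l j) ^+ 2 < g ^+ 28 ->
  \sum_i \sum_j E i j ^+ (2 * (24 * m.+1)) < g ^+ 24 ->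
  (\sum_i \sum_j E i j) ^+ 2 < g ^+ 20 ->
  (\sum_i \sum_j (E i j ^+ 2 - S i j)) ^+ 2 < g ^+ 20 ->
  (\sum_i \sum_j \sum_l (j != l)%:R * (E i j * E i l)) ^+ 2 < g ^+ 28 ->
  \sum_i (\sum_j E i j) ^+ 4 < g ^+ 28 ->
  `|n%:R * opnorm r p (n%:R `^ (- (p^-1 - r^-1)) *: zero_diag_add mu E) -
    (mu * n%:R * (n%:R - 1) + \sum_i \sum_j E i j +
     (p - 1 + (r - 1)^-1) * V / (n%:R * mu))| <= eps * n%:R.
Proof.
move=> p1 pr m00 M00 K0.
have r1 : 1 < r by exact: lt_le_trans pr.
have [p0 r0] : 0 < p /\ 0 < r by split; lra.
pose q := (1 - p^-1)^-1.
have pq : p^-1 + q^-1 = 1 by rewrite /q invrK addrC subrK.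
have [q1 qE] := conjugate_gt0 p1 pq.
have rq : r^-1 + q^-1 <= 1 by rewrite -pq lerD2r lef_pV2.
have qV : (q - 1)^-1 = p - 1 by rewrite qE invrK.
clearbody q.
have [m Hup] := bilin_upper r1 q1 rq m00 M00 K0.
have Hlow := bilin_lower p1 pq r1 m00 M00 K0.
exists m => eps eps0.
have [du du0 {}Hup] := Hup _ eps0; have [dl dl0 {}Hlow] := Hlow _ eps0.
exists (Num.min du dl); first by rewrite lt_min du0.
move=> n E S g mu V n0 g1 gn dg muE VE SV Es Ap Z1 Z2 Z3 Z4 Z5 Z6.
have g0 : 0 < g by exact: lt_le_trans g1.
have [dug dlg] : 2 <= du * g /\ 2 <= dl * g.
  by split; apply: le_trans dg _; rewrite ler_pM2r// ge_min lexx ?orbT.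
have row := good_row g1 Z6.
have opr := good_operator Es g1 Z1.
have rows := good_rows g1 Z4 Z5; rewrite SV in rows.
have ent := good_entries g1 Z2.
set L := g `^ _ in ent.
have L1 : 1 <= L by rewrite /L -[leLHS](powRr0 g) ler_powR// invr_ge0.
have Lm : L ^+ m <= g.
  have LE : L ^+ m.+1 = g by rewrite /L -powR_mulrn ?powR_ge0// powR_inv_powR// ltW.
  by rewrite -[leRHS]LE ler_weXn2l.
have pw (c : R) i : 0 < c -> 2 <= c * g -> 2 * g ^+ i <= c * g ^+ i.+1.
  by move=> c0 cg; rewrite exprS mulrA ler_wpM2r// exprn_ge0// ltW.
have pw1 (c : R) i : 0 < c -> 2 <= c * g -> g ^+ i <= c * g ^+ i.+1.
  move=> c0 cg; apply: le_trans (pw _ _ c0 cg).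
  by rewrite ler_peMl ?exprn_ge0 ?ler1n// ltW.
have pwle (c : R) i j : 0 < c -> 2 <= c * g -> (i < j)%N -> 2 * g ^+ i <= c * g ^+ j.
  move=> c0 cg ij; apply: le_trans (pw _ _ c0 cg) _.
  by rewrite ler_wpM2l ?(ltW c0)// ler_weXn2l.
have pw1le (c : R) i j : 0 < c -> 2 <= c * g -> (i < j)%N -> g ^+ i <= c * g ^+ j.
  move=> c0 cg ij; apply: le_trans (pwle _ _ _ c0 cg ij).
  by rewrite ler_peMl ?exprn_ge0 ?ler1n// ltW.
have nE e : n%:R ^+ e = g ^+ (8 * e) by rewrite -gn exprM.
have n1 (c : R) : 0 < c -> 2 <= c * g -> 1 <= c * n%:R.
  by move=> c0 cg; rewrite -gn -(expr0 g); exact: pw1le.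
have rown (c : R) : 0 < c -> 2 <= c * g -> forall i, `|\sum_j E i j| <= c * n%:R.
  by move=> c0 cg i; apply: le_trans (row i) _; rewrite -gn; exact: pw1.
have rowsn (c : R) : 0 < c -> 2 <= c * g ->
    `|\sum_i (\sum_j E i j) ^+ 2 - 2 * V| <= c * n%:R ^+ 2.
  by move=> c0 cg; apply: le_trans rows _; rewrite nE; exact: pwle.
have k0 : 0 <= g ^+ 14 by rewrite exprn_ge0// ltW.
have up x y := Hup n E mu V (g ^+ 14) L x y n0 (n1 _ du0 dug) muE VE k0 L1 ent Es opr.
have low := Hlow n E mu V (g ^+ 14) n0 (n1 _ dl0 dlg) muE VE k0 Es Ap opr.
have {}low := low _ (rown _ dl0 dlg) _ (rowsn _ dl0 dlg).
have {}low : mu * n%:R * (n%:R - 1) + \sum_i \sum_j E i j +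
    ((r - 1)^-1 + (q - 1)^-1) * V / (n%:R * mu) - eps * n%:R <=
    n%:R * opnorm r p (n%:R `^ (- (p^-1 - r^-1)) *: zero_diag_add mu E).
  apply: low.
    rewrite -gn exprMn -exprM [leLHS](_ : _ = 1 * g ^+ 14) ?mul1r//.
    rewrite -[(8 * 2)%N]/(2 + 14)%N exprD mulrA -exprMn ler_peMl//.
    by rewrite exprn_ege1//; apply: le_trans dlg; rewrite ler1n.
  by apply: le_trans (ltW Z3) _; rewrite nE; exact: pw1le.
(* The exponents meet here: the operator bound [g^14] and the factor [L ^+ m <= g] give [g^15], one
   power below [n^2 = g^16]. *)
have kL : g ^+ 14 * L ^+ m <= du * n%:R ^+ 2.
  apply: (@le_trans _ _ (g ^+ 15)); last by rewrite nE; exact: pw1le.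
  by rewrite [leRHS]exprSr ler_wpM2l.
have rs : \sum_i (\sum_j E i j) ^+ 2 <= 2 * V + du * n%:R ^+ 2.
  by have := le_trans (ler_norm _) (rowsn _ du0 dug); rewrite lerBlDl.
have {}up x y := up x y kL (rown _ du0 dug) rs.
set B := mu * n%:R * (n%:R - 1) + _ + _ + _ in up.
have N0 : 0 < n%:R :> R by rewrite ltr0n.
(* The upper bound at the all-ones vectors dominates the sum of the nonnegative entries;
   [opnorm_le_bilin] requires this sign. *)
have B0 : 0 <= B.
  have := up (fun=> 1) (fun=> 1) (fun=> ler01) (fun=> ler01).
  have S1 (t : R) : \sum_(i < n) 1 `^ t = n%:R.
    by under eq_bigr do rewrite powR1; rewrite sumr_const card_ord.
  move=> /(_ (S1 _) (S1 _)); apply: le_trans.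
  by apply: sumr_ge0 => i _; apply: sumr_ge0 => j _; rewrite mul1r mulr1.
have upn : opnorm r p (n%:R `^ (- (p^-1 - r^-1)) *: zero_diag_add mu E) <= B / n%:R.
  apply: (opnorm_le_bilin (q := q)) => //; first by rewrite divr_ge0.
  move=> x y x0 y0 xr yq; rewrite mulrC divfK ?gt_eqF//; exact: up.
move: upn; rewrite ler_pdivlMr// mulrC => upn.
move: low upn; rewrite /B qV [(r - 1)^-1 + _]addrC.
move: (n%:R * opnorm _ _ _) (mu * n%:R * _ + _ + _) => X C; clear.
by rewrite ler_norml; lra.
Qed.

End expansion.

(** * The limit law *)

Section slutsky.
Context d (T : measurableType d) (R : realType) (P : probability T R).

Lemma measure_bigsetU_null (I : Type) (s : seq I) (D : pred I) (F : I -> set T) :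
  (forall i, D i -> measurable (F i)) -> (forall i, D i -> P (F i) = 0%E) ->
  measurable (\big[setU/set0]_(i <- s | D i) F i) /\
  P (\big[setU/set0]_(i <- s | D i) F i) = 0%E.
Proof.
move=> mF F0; elim: s => [|i s [ms s0]]; first by rewrite big_nil measure0.
rewrite big_cons; case: ifPn => // Di.
have mi := mF _ Di; split; first exact: measurableU.
apply/eqP; rewrite eq_le measure_ge0 andbT.
have z : (P (F i) + P (\big[setU/set0]_(j <- s | D j) F j) = 0)%E by rewrite (F0 _ Di) s0 adde0.
by rewrite -[leRHS]z; exact: (measureU2 P mi ms).
Qed.

Lemma fine_probability_le_add (A B N : set T) (b : R) :
  measurable A -> measurable B -> measurable N -> (P N <= b%:E)%E ->
  A `<=` B `|` N -> fine (P A) <= fine (P B) + b.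
Proof.
move=> mA mB mN Nb AB; rewrite -lee_fin EFinD !fineK ?fin_num_measure//.
apply: (@le_trans _ _ (P (B `|` N))); first by apply: le_measure; rewrite ?inE//; exact: measurableU.
by apply: (le_trans (measureU2 P mB mN)); exact: leeD.
Qed.

Lemma measurable_le_set (f : T -> R) (t : R) : measurable_fun setT f ->
  measurable [set w | f w <= t].
Proof.
move=> mf; rewrite (_ : [set w | f w <= t] = f @^-1` `]-oo, t]); last first.
  by apply/seteqP; split => w /=; rewrite in_itv.
rewrite -[X in measurable X]setTI; exact: (mf measurableT _ (measurable_itv `]-oo, t])).
Qed.

(** Outside [N], the event [X <= y] lies between [W <= y - e] and [W <= y + e]. *)
Lemma distribution_close (X W : T -> R) (N : set T) (y e b A B c eta : R) :
  measurable_fun setT X -> measurable_fun setT W -> measurable N ->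
  (P N <= b%:E)%E -> (forall w, ~ N w -> `|X w - W w| <= e) ->
  `|fine (P [set w | W w <= y + e]) - A| <= eta ->
  `|fine (P [set w | W w <= y - e]) - B| <= eta ->
  `|A - c| <= eta -> `|B - c| <= eta ->
  `|fine (P [set w | X w <= y]) - c| <= 2 * eta + b.
Proof.
move=> mX mW mN Nb XW WA WB Ac Bc.
have mXy := measurable_le_set y mX.
have up := fine_probability_le_add mXy (measurable_le_set (y + e) mW) mN Nb.
have lo := fine_probability_le_add (measurable_le_set (y - e) mW) mXy mN Nb.
have {}up : fine (P [set w | X w <= y]) <= fine (P [set w | W w <= y + e]) + b.
  apply: up => w /= Xy; have [Nw|Nw] := pselect (N w); [by right|left => /=].
  by move: (XW _ Nw) Xy; rewrite ler_norml; clear; lra.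
have {}lo : fine (P [set w | W w <= y - e]) <= fine (P [set w | X w <= y]) + b.
  apply: lo => w /= Xy; have [Nw|Nw] := pselect (N w); [by right|left => /=].
  by move: (XW _ Nw) Xy; rewrite ler_norml; clear; lra.
move: up lo WA WB Ac Bc; rewrite !ler_norml.
by move: (fine _) (fine _) (fine _) => u v w; clear; lra.
Qed.

End slutsky.

Lemma sum_sym_offdiag (R : comNzRingType) n (F : 'I_n -> 'I_n -> R) :
  (forall i j, F i j = F j i) -> (forall i, F i i = 0) ->
  \sum_i \sum_j F i j = 2 * \sum_(i < n) \sum_(j < n | (i < j)%N) F i j.
Proof.
move=> Fs F0.
have -> : \sum_i \sum_j F i j = \sum_(i < n) \sum_(j < n | (i < j)%N) F i j +
    \sum_(i < n) \sum_(j < n | (j < i)%N) F i j.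
  rewrite -big_split/=; apply: eq_bigr => i _.
  rewrite (bigID (fun j : 'I_n => (i < j)%N))/=; congr (_ + _).
  rewrite (bigD1 i)/= ?ltnn// F0 add0r; apply: eq_bigl => j.
  by rewrite -leqNgt ltn_neqAle andbC.
rewrite mulr_natl mulr2n; congr (_ + _).
rewrite [RHS](exchange_big_dep xpredT)//=; apply: eq_bigr => i _.
by apply: eq_bigr => j _.
Qed.

(** The index [n0] is uniform over all probability spaces and matrices with the given bounds; a
    sequence on changing spaces can then be treated one [n] at a time. *)
Lemma opnorm_clt (R : realType) (p r m0 M0 K k0 : R) (M : nat -> R) (y eta : R) :
  1 < p -> p <= r -> 0 < m0 -> 0 < M0 -> 0 <= K -> 0 < k0 -> (forall k, 0 <= M k) ->
  0 < eta -> exists n0 : nat,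
  forall (n : nat) d (T : measurableType d) (P : probability T R)
    (a : 'I_n -> 'I_n -> {RV P >-> R}) (mu : R) (s : 'I_n -> 'I_n -> R),
  (n0 <= n)%N ->
  (forall i j w, a i j w = a j i w) -> (forall i w, a i i w = 0) ->
  mutually_independent (fun e : 'I_n * 'I_n => (e.1 < e.2)%N) (fun e => a e.1 e.2) ->
  (forall i j : 'I_n, (i < j)%N ->
     [/\ P [set w | a i j w < 0] = 0%E, all_moments P (fun w => a i j w - mu),
         \int[P]_w (a i j w - mu) = 0, \int[P]_w ((a i j w - mu) ^+ 2) = s i j ^+ 2 &
         forall k, \int[P]_w (`|a i j w - mu| ^+ k) <= M k]) ->
  let V := \sum_(i < n) \sum_(j < n | (i < j)%N) s i j ^+ 2 in
  m0 <= mu <= M0 -> k0 * n%:R ^+ 2 <= V <= K * n%:R ^+ 2 ->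
  `|fine (P [set w | n%:R / Num.sqrt (2 * V) *
       (opnorm r p (n%:R `^ (- (p^-1 - r^-1)) *: \matrix_(i, j) a i j w) -
        ((n%:R - 1) * mu + (p - 1 + (r - 1)^-1) * (V / (n%:R ^+ 2 * mu)))) <= y])
    - gauss_cdf y| <= eta.
Proof.
move=> p1 pr m00 M00 K0 k00 Mge0 eta0.
have r0 : 0 < r by lra.
have q0 : 0 < eta / 4 by rewrite divr_gt0.
have : {for y, continuous (@gauss_cdf R)}.
  apply: differentiable_continuous; apply/derivable1_diffP.
  exact: (@ex_derive _ _ _ _ _ _ _ (is_derive_gauss_cdf y)).
move=> /cvgrPdist_le/(_ _ q0)/nbhs_ballP[d0/= d00 Hd].
pose de := d0 / 2; have de0 : 0 < de by rewrite divr_gt0.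
have near x : `|x - y| <= de -> `|gauss_cdf x - gauss_cdf y| <= eta / 4.
  move=> xy; rewrite distrC; apply: Hd; rewrite /ball/= distrC.
  by apply: le_lt_trans xy _; rewrite /de; move: d00; clear; lra.
have nearp : `|gauss_cdf (y + de) - gauss_cdf y| <= eta / 4.
  by apply: near; rewrite addrC addKr gtr0_norm.
have nearm : `|gauss_cdf (y - de) - gauss_cdf y| <= eta / 4.
  by apply: near; rewrite addrC addKr normrN gtr0_norm.
have [kap1 kap10 clt1] := lindeberg_clt (y + de) q0.
have [kap2 kap20 clt2] := lindeberg_clt (y - de) q0.
have [m Hm] := opnorm_expansion p1 pr m00 M00 K0.
pose sk := Num.sqrt (2 * k0); have sk0 : 0 < sk by rewrite sqrtr_gt0 mulr_gt0.
(* The normalizing root is at least [sk * n], so an error [de * sk * n] in the expansion becomes at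
   most [de] after division. *)
have [delta delta0 {}Hm] := Hm _ (mulr_gt0 de0 sk0).
pose k := (24 * m.+1)%N.
pose Mm := Num.max (M 4) (M (2 * k)).
have Mm0 : 0 <= Mm by rewrite le_max Mge0.
pose C := 8 * (Mm + (1 + Mm) ^+ 2).
have C0 : 0 <= C by rewrite /C mulr_ge0// addr_ge0// sqr_ge0.
pose c := 2 / sk.
have c0 : 0 < c by rewrite divr_gt0.
pose kap := Num.min kap1 kap2; have kap0 : 0 < kap by rewrite lt_min kap10.
pose B := c ^+ 3 * M 3 + c ^+ 4 * M 2 ^+ 2.
have B0 : 0 <= B by rewrite addr_ge0// mulr_ge0 ?sqr_ge0// exprn_ge0// ltW.
(* The second summand gives [2 <= delta * g]; the third makes the probability [6 * C / g] of the bad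
   event at most [eta / 2]. *)
pose G := 1 + 2 / delta + C * 12 / eta.
have G1 : [/\ 1 <= G, 2 / delta <= G & C * 12 / eta <= G].
  have u0 : 0 <= 2 / delta by rewrite divr_ge0// ltW.
  have v0 : 0 <= C * 12 / eta by apply: divr_ge0 (ltW eta0); apply: mulr_ge0 => //.
  by move: u0 v0; rewrite /G; move: (2 / delta) (C * 12 / eta) => u v; clear => *; split; lra.
have [G1' Gd Ge] := G1.
(* The first bound gives [G <= g] for [g = n^(1/8)]. The second makes the third-moment and
   squared-variance sum of the central limit theorem, which is at most [B / n], smaller than
   [kap]. *)
exists (maxn (Num.bound (G ^+ 8)) (Num.bound (B / kap))) => n d T P a mu s nn asym adiag aind aij muE.
set V := \sum_(i < n) _ => VE.
move: nn; rewrite geq_max => /andP[n1 n2].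
have nG : G ^+ 8 <= n%:R.
  have G80 : 0 <= G ^+ 8 by rewrite exprn_ge0// (le_trans _ G1').
  by apply: le_trans (ltW (archi_boundP G80)) _; rewrite ler_nat.
have nB : B / kap <= n%:R.
  have Bk : 0 <= B / kap by rewrite divr_ge0// ltW.
  by apply: le_trans (ltW (archi_boundP Bk)) _; rewrite ler_nat.
have n1R : 1 <= n%:R :> R by apply: le_trans nG; exact: exprn_ege1.
have N0 : 0 < n%:R :> R by exact: lt_le_trans n1R.
have n0 : (0 < n)%N by rewrite -(ltr0n R).
pose g := n%:R `^ 8%:R^-1 : R.
have g0 : 0 <= g by exact: powR_ge0.
have gn : g ^+ 8 = n%:R by rewrite /g -powR_mulrn ?powR_ge0// powR_inv_powR// ltW.
have gG : G <= g by rewrite -(@ler_pXn2r _ 8) ?nnegrE// ?gn// (le_trans _ G1').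
have g1 : 1 <= g by exact: le_trans gG.
clearbody g.
have dg : 2 <= delta * g by rewrite mulrC -ler_pdivrMr// (le_trans Gd).
have Cg : C / g * 6 <= eta / 2.
  rewrite mulrAC ler_pdivrMr; last exact: lt_le_trans g1.
  move: (le_trans Ge gG); rewrite ler_pdivrMr//.
  by move: (g) (C) => u v; clear; lra.
have amom (i j : 'I_n) : (i < j)%N -> all_moments P (fun w => a i j w - mu).
  by move=> /aij[].
have amean (i j : 'I_n) : (i < j)%N -> \int[P]_w (a i j w - mu) = 0.
  by move=> /aij[].
have aeven (l : nat) (i j : 'I_n) : (i < j)%N ->
    \int[P]_w ((a i j w - mu) ^+ (2 * l)) <= M (2 * l).
  move=> /aij[_ _ _ _ /(_ (2 * l)%N)]; congr (_ <= _); apply: eq_Rintegral => w _.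
  by rewrite !exprM real_normK// num_real.
have a4 (i j : 'I_n) : (i < j)%N -> \int[P]_w ((a i j w - mu) ^+ 4) <= Mm.
  by move=> ij; apply: le_trans (aeven 2 _ _ ij) _; rewrite le_max lexx.
have a2k (i j : 'I_n) : (i < j)%N -> \int[P]_w ((a i j w - mu) ^+ (2 * k)) <= Mm.
  by move=> ij; apply: le_trans (aeven k _ _ ij) _; rewrite le_max lexx orbT.
have [mb Pb] := statistics_bad asym adiag aind amom amean a4 a2k isT Mm0 g1 gn.
set bad := [set w | ~~ _] in mb Pb.
have mneg (e : 'I_n * 'I_n) : (e.1 < e.2)%N -> measurable [set w | a e.1 e.2 w < 0].
  move=> _; rewrite (_ : [set w | a e.1 e.2 w < 0] = a e.1 e.2 @^-1` `]-oo, 0[).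
    exact: measurable_sfunP.
  by apply/seteqP; split => w /=; rewrite in_itv.
have Pneg (e : 'I_n * 'I_n) : (e.1 < e.2)%N -> P [set w | a e.1 e.2 w < 0] = 0%E.
  by move=> /aij[].
(* The entries are nonnegative only almost surely; the finitely many null events where this fails
   are added to the bad event. *)
have [mn Pn] := measure_bigsetU_null (index_enum _) mneg Pneg.
set neg := \big[setU/set0]_(e <- _ | _) _ in mn Pn.
have V0 : 0 < V.
  by case/andP: VE => VE _; apply: lt_le_trans VE; rewrite mulr_gt0// exprn_gt0.
(* The factor 2 reflects that the sum over all [i, j] counts each independent entry twice; it makes
   the variances of the normalized variables add up to 2. *)
have [h [hE hh]] : exists h : R, h = 2 / Num.sqrt (2 * V) /\ h ^+ 2 = 2 / V.
  eexists; split; first reflexivity.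
  by rewrite exprMn exprVn sqr_sqrtr ?mulr_ge0 ?(ltW V0)//; field; rewrite gt_eqF.
have sV0 : 0 < Num.sqrt (2 * V) by rewrite sqrtr_gt0 mulr_gt0.
have h0 : 0 <= h by rewrite hE divr_ge0// ltW.
have sVn : sk * n%:R <= Num.sqrt (2 * V).
  rewrite -(ger0_norm (ltW N0)) -sqrtr_sqr -sqrtrM ?mulr_ge0 ?(ltW k00)//.
  rewrite ler_sqrt ?mulr_ge0 ?(ltW V0)// -mulrA ler_pM2l//.
  by case/andP: VE.
have hn : h <= c / n%:R.
  rewrite hE /c -mulrA ler_pM2l// -invfM lef_pV2// posrE// mulr_gt0//.
pose W w := \sum_(e : 'I_n * 'I_n | (e.1 < e.2)%N) (a e.1 e.2 w - mu) * h.
have WE w : W w = (\sum_i \sum_j noise a mu i j w) / Num.sqrt (2 * V).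
  rewrite (sum_sym_offdiag (fun i j => noise_sym mu asym i j w) (fun i => noise_diag mu adiag i w)).
  rewrite /W -mulr_suml hE -(pair_big_dep xpredT (fun i j : 'I_n => (i < j)%N)
    (fun i j => a i j w - mu))/=.
  rewrite mulrA [_ * 2]mulrC; congr (_ * _ / _).
  apply: eq_bigr => i _; apply: eq_bigr => j ij.
  by rewrite /noise (_ : (i != j) = true) ?mul1r// neq_ltn ij.
have mO : measurable_fun setT (fun w =>
    opnorm r p (n%:R `^ (- (p^-1 - r^-1)) *: \matrix_(i, j) a i j w)).
  by apply: measurable_opnorm => // i j; exact: measurable_funPT.
pose X w := n%:R / Num.sqrt (2 * V) *
  (opnorm r p (n%:R `^ (- (p^-1 - r^-1)) *: \matrix_(i, j) a i j w) -
   ((n%:R - 1) * mu + (p - 1 + (r - 1)^-1) * (V / (n%:R ^+ 2 * mu)))).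
rewrite -/X.
have mX : measurable_fun setT X.
  by apply: measurable_funM => //; exact: measurable_funB.
have mWe (e : 'I_n * 'I_n) : (e.1 < e.2)%N ->
    all_moments P (fun w => (a e.1 e.2 w - mu) * h).
  by move=> eD; apply: all_moments_mul; [exact: amom|exact: all_moments_cst].
have mW : measurable_fun setT W.
  by apply: all_moments_measurable; apply: all_moments_sum => e; exact: mWe.
have mN : measurable (bad `|` neg) by exact: measurableU.
have PN : (P (bad `|` neg) <= (C / g * 6)%:E)%E.
  apply: (le_trans (measureU2 P mb mn)); rewrite -[leRHS]adde0; apply: leeD => //.
  have := lexx (0 : \bar R)%E; rewrite -[X in (X <= _)%E -> _]Pn; exact.
have W2 (e : 'I_n * 'I_n) : (e.1 < e.2)%N ->
    \int[P]_w (((a e.1 e.2 w - mu) * h) ^+ 2) = s e.1 e.2 ^+ 2 * h ^+ 2.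
  move=> eD; have [_ _ _ <- _] := aij _ _ eD; rewrite mulrC -RintegralZl//.
    by apply: eq_Rintegral => w _; rewrite exprMn mulrC.
  by apply: all_moments_integrable; apply: all_moments_exp; exact: amom.
have W3 (e : 'I_n * 'I_n) : (e.1 < e.2)%N ->
    \int[P]_w (`|(a e.1 e.2 w - mu) * h| ^+ 3) <= M 3 * h ^+ 3.
  move=> eD; have [_ _ _ _ /(_ 3)] := aij _ _ eD => M3.
  rewrite [leRHS]mulrC; apply: le_trans (ler_wpM2l (exprn_ge0 3 h0) M3).
  rewrite -RintegralZl//.
    by apply: ler_of_eq; apply: eq_Rintegral => w _; rewrite normrM exprMn mulrC (ger0_norm h0).
  apply: all_moments_integrable; apply: all_moments_exp; apply: all_moments_norm.
  exact: amom.
have W1 (e : 'I_n * 'I_n) : (e.1 < e.2)%N -> \int[P]_w ((a e.1 e.2 w - mu) * h) = 0.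
  move=> eD; have [_ _ a0 _ _] := aij _ _ eD.
  under eq_Rintegral do rewrite mulrC.
  by rewrite RintegralZl ?a0 ?mulr0//; apply: all_moments_integrable; exact: amom.
have sumV : \sum_(e : 'I_n * 'I_n | (e.1 < e.2)%N) s e.1 e.2 ^+ 2 * h ^+ 2 = 2.
  rewrite -mulr_suml -(pair_big_dep xpredT (fun i j : 'I_n => (i < j)%N)
    (fun i j => s i j ^+ 2))/= -/V hh.
  by rewrite mulrC divfK// gt_eqF.
have s2 (e : 'I_n * 'I_n) : (e.1 < e.2)%N -> s e.1 e.2 ^+ 2 <= M 2.
  move=> eD; have [_ _ _ <- /(_ 2)] := aij _ _ eD; congr (_ <= _).
  by apply: eq_Rintegral => w _; rewrite real_normK// num_real.
have sumB : \sum_(e : 'I_n * 'I_n | (e.1 < e.2)%N)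
    (M 3 * h ^+ 3 + (s e.1 e.2 ^+ 2 * h ^+ 2) ^+ 2) <= kap.
  pose t := c / n%:R.
  have t0 : 0 <= t by rewrite divr_ge0// ltW.
  have ht i : h ^+ i <= t ^+ i by apply: lerXn2r; rewrite ?nnegrE.
  apply: (@le_trans _ _ (\sum_(e : 'I_n * 'I_n) (M 3 * t ^+ 3 + M 2 ^+ 2 * t ^+ 4))).
    rewrite big_mkcond/=; apply: ler_sum => e _; case: ifPn => [eD|_]; last first.
      by rewrite addr_ge0// mulr_ge0 ?sqr_ge0 ?exprn_ge0.
    apply: lerD; first by rewrite ler_wpM2l.
    rewrite exprMn; apply: ler_pM; rewrite ?sqr_ge0//; last by rewrite -exprM.
    by apply: lerXn2r; rewrite ?nnegrE ?sqr_ge0//; exact: s2.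
  rewrite sumr_const card_prod card_ord -[leLHS]mulr_natr natrM.
  apply: (@le_trans _ _ (B / n%:R)); last first.
    by rewrite ler_pdivrMr// mulrC -ler_pdivrMr.
  rewrite /t [leLHS](_ : _ = (c ^+ 3 * M 3 + c ^+ 4 * M 2 ^+ 2 / n%:R) / n%:R); last first.
    by field; rewrite gt_eqF.
  rewrite ler_pM2r ?invr_gt0// lerD2l ler_pdivrMr// ler_peMr//.
  by rewrite mulr_ge0 ?exprn_ge0 ?sqr_ge0// ltW.
have mf (e : 'I_n * 'I_n) : measurable_fun setT (fun x : R => (x - mu) * h).
  by apply: measurable_funM => //; exact: measurable_funB.
have c1 : `|fine (P [set w | W w <= y + de]) - gauss_cdf (y + de)| <= eta / 4.
  apply: (clt1 _ _ P _ _ _ (fun _ x => (x - mu) * h) _ _ aind mf mWe W1 W2 W3 sumV).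
  by apply: le_trans sumB _; rewrite ge_min lexx.
have c2 : `|fine (P [set w | W w <= y - de]) - gauss_cdf (y - de)| <= eta / 4.
  apply: (clt2 _ _ P _ _ _ (fun _ x => (x - mu) * h) _ _ aind mf mWe W1 W2 W3 sumV).
  by apply: le_trans sumB _; rewrite ge_min lexx orbT.
have closeW w : ~ (bad `|` neg) w -> `|X w - W w| <= de.
  move=> good.
  have st : all (fun z : (T -> R) * R => z.1 w < z.2) (statistics a mu k g).
    by apply/negbNE/negP => h1; apply: good; left.
  have pos (i j : 'I_n) : (i < j)%N -> 0 <= a i j w.
    move=> ij; rewrite leNgt; apply/negP => aneg; apply: good; right.
    by rewrite /neg (bigD1 (i, j))//=; left.
  have Ap i j : 0 <= zero_diag_add mu (fun i j => noise a mu i j w) i j.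
    rewrite mxE /noise addrC subrK; have [ij|ij|/val_inj ->] := ltngtP i j.
    - exact: pos.
    - by rewrite asym; exact: pos.
    - by rewrite adiag.
  pose S i j := \int[P]_v (noise a mu i j v ^+ 2).
  have SV : \sum_i \sum_j S i j = 2 * V.
    rewrite sum_sym_offdiag.
    - congr (2 * _); apply: eq_bigr => i _; apply: eq_bigr => j ij.
      have [_ _ _ <- _] := aij _ _ ij; apply: eq_Rintegral => v _.
      by rewrite /noise (_ : (i != j) = true) ?mul1r// neq_ltn ij.
    - by move=> i j; apply: eq_Rintegral => v _; rewrite (noise_sym mu asym).
    - move=> i; rewrite /S; under eq_Rintegral do rewrite (noise_diag mu adiag) expr0n.
      by rewrite Rintegral_cst_probability.
  have VK : 0 <= V <= K * n%:R ^+ 2 by rewrite (ltW V0); case/andP: VE.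
  have Es i j : noise a mu i j w = noise a mu j i w by exact: noise_sym.
  move: st => /= /andP[z1 /andP[z2 /andP[z3 /andP[z4 /andP[z5 /andP[z6 _]]]]]].
  have := Hm n _ S g mu V n0 g1 gn dg muE VK SV Es Ap z1 z2 z3 z4 z5 z6.
  rewrite (_ : zero_diag_add _ _ = \matrix_(i, j) a i j w); last first.
    by apply/matrixP => i j; rewrite !mxE /noise addrC subrK.
  rewrite WE /X; set O := opnorm _ _ _; set SN := \sum_i _; set cf := p - 1 + _.
  have mu0 : 0 < mu by case/andP: muE => + _; exact: lt_le_trans.
  move: (Num.sqrt _) sV0 sVn => q q0' qn H.
  rewrite (_ : _ - _ = (n%:R * O - (mu * n%:R * (n%:R - 1) + SN +
    cf * V / (n%:R * mu))) / q); last first.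
    by field; rewrite !gt_eqF.
  rewrite normrM (gtr0_norm (x := q^-1)) ?invr_gt0// ler_pdivrMr//.
  by apply: le_trans H _; rewrite -mulrA ler_pM2l.
apply: (@le_trans _ _ (2 * (eta / 4) + C / g * 6)); last first.
  by move: Cg; move: (C / g * 6) => u; clear; lra.
exact: (distribution_close mX mW mN PN closeW c1 c2 nearp nearm).
Qed.

(* The first summands cover the exponents [k < 3]. *)
Definition moment_bound (R : realType) (c S : R) (k : nat) : R :=
  1 + 3`!%:R / 2 * c * S + k`!%:R / 2 * c ^+ (k - 2) * S.

Lemma moment_bound_ge0 (R : realType) (c S : R) k : 0 <= c -> 0 <= S ->
  0 <= moment_bound c S k.
Proof.
move=> c0 S0; have h l : 0 <= l`!%:R / 2 :> R by rewrite divr_ge0.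
by rewrite /moment_bound !addr_ge0// !mulr_ge0// exprn_ge0.
Qed.

(** The hypothesis on moments starts at order 3. Orders below 3 are dominated by [1 + |X - mu|^3],
    which gives integrability of every order and the first summands of [moment_bound]. *)
Lemma centered_moments d (T : measurableType d) (R : realType) (P : probability T R)
    (X : {RV P >-> R}) (mu s c S : R) : 0 <= c -> 0 <= S ->
  distribution P X `[0, +oo[ = 1%E ->
  ('E_P[X] = mu%:E)%E -> ('V_P[X] = (s ^+ 2)%:E)%E ->
  (forall k, (3 <= k)%N -> ('E_P[fun w => (`|X w - mu| ^+ k)%R] <=
     (k`!%:R / 2 * c ^+ (k - 2) * S)%:E)%E) ->
  [/\ P [set w | X w < 0] = 0%E, all_moments P (fun w => X w - mu),
      \int[P]_w (X w - mu) = 0, \int[P]_w ((X w - mu) ^+ 2) = s ^+ 2 &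
      forall k, \int[P]_w (`|X w - mu| ^+ k) <= moment_bound c S k].
Proof.
move=> c0 S0 Xge EX VX Xk.
have mX : measurable_fun setT (fun w => X w - mu) by exact: measurable_funB.
have mXk k : measurable_fun setT (fun w => `|X w - mu| ^+ k).
  by apply: measurable_funX; exact: measurableT_comp.
have Xk_ge0 k w : (0 <= (`|X w - mu| ^+ k)%:E)%E by rewrite lee_fin exprn_ge0.
have int3 k : (3 <= k)%N -> P.-integrable setT (EFin \o (fun w => `|X w - mu| ^+ k)).
  move=> k3; apply/integrableP; split; first exact/measurable_EFinP.
  have := Xk k k3; rewrite unlock => /le_lt_trans/(_ (ltry _)) fin.
  by move: fin; congr (_ < _)%E; apply: eq_integral => w _; rewrite gee0_abs//; exact: Xk_ge0.
have low (k : nat) w : (k < 3)%N -> `|X w - mu| ^+ k <= 1 + `|X w - mu| ^+ 3.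
  move=> k3; move: (`|X w - mu|) (normr_ge0 (X w - mu)) => x x0.
  have [x1|x1] := leP x 1.
    by rewrite -[leLHS]addr0; apply: lerD; [exact: exprn_ile1|exact: exprn_ge0].
  by rewrite -[leLHS]add0r; apply: lerD => //; apply: ler_weXn2l (ltW x1) _ _ (ltnW k3).
have i13 : P.-integrable setT (EFin \o (fun w => 1 + `|X w - mu| ^+ 3)).
  apply: (integrable_add (integrable_cst_fun P 1) (int3 3%N _)) => //.
have am : all_moments P (fun w => X w - mu).
  split=> // k; have [k3|k3] := leqP 3 k; first exact: int3.
  by apply: integrable_le i13 _ => // w; rewrite ger0_norm ?exprn_ge0//; exact: low.
have iX := all_moments_integrable am.
have E0 : \int[P]_w (X w - mu) = 0.
  have iX' : P.-integrable setT (EFin \o (fun w => (X w - mu) + mu)).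
    exact: integrable_add iX (integrable_cst_fun P mu).
  have : \int[P]_w ((X w - mu) + mu) = mu.
    under eq_Rintegral do rewrite subrK.
    by rewrite /Rintegral -[RHS]/(fine mu%:E) -EX expectation_def.
  rewrite RintegralD//; last exact: integrable_cst_fun.
  by rewrite Rintegral_cst_probability => /eqP; rewrite -[X in _ == X]add0r => /eqP/addIr.
split => //.
- have -> : [set w | X w < 0] = ~` (X @^-1` `[0, +oo[).
    by apply/seteqP; split => w /=; rewrite in_itv/= andbT ltNge => /negP.
  have mS : measurable (X @^-1` `[0, +oo[) by exact: measurable_sfunP.
  rewrite (probability_setC P mS).
  move: Xge; rewrite /distribution /pushforward => ->; exact: subee.
- move: VX; rewrite /variance unlock EX/= unlock => VX.
  by rewrite /Rintegral -[RHS]/(fine (s ^+ 2)%:E) -VX; congr fine; apply: eq_integral.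
move=> k; have h l : 0 <= l`!%:R / 2 :> R by rewrite divr_ge0.
have le3 l : (3 <= l)%N -> \int[P]_w (`|X w - mu| ^+ l) <= l`!%:R / 2 * c ^+ (l - 2) * S.
  move=> l3; rewrite -lee_fin /Rintegral fineK.
    by have := Xk l l3; rewrite unlock.
  by apply: integrable_fin_num => //; exact: int3.
have p3 : 0 <= 3`!%:R / 2 * c * S by rewrite !mulr_ge0.
have [k3|k3] := leqP 3 k.
  by apply: le_trans (le3 k k3) _; rewrite /moment_bound lerDr addr_ge0.
apply: (@le_trans _ _ (\int[P]_w (1 + `|X w - mu| ^+ 3))).
  apply: le_Rintegral => //; last by move=> w _; exact: low.
  by apply: integrable_le i13 _ => // w; rewrite ger0_norm ?exprn_ge0//; exact: low.
rewrite RintegralD//; [|exact: integrable_cst_fun|exact: int3].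
rewrite Rintegral_cst_probability /moment_bound -addrA lerD2l.
rewrite -[leLHS]addr0; apply: lerD; last by rewrite !mulr_ge0// exprn_ge0.
by have := le3 3%N isT; rewrite expr1.
Qed.

Lemma limn_esup_lt (R : realType) (u : nat -> \bar R) (b : \bar R) :
  (limn_esup u < b)%E -> \forall n \near \oo, (u n < b)%E.
Proof.
rewrite /limn_esup /limf_esup => /ereal_inf_lt[_ [A FA <-]] Ab.
apply: filterS FA => n An; apply: le_lt_trans Ab.
by apply: ereal_sup_ubound; exists n.
Qed.

Lemma limn_einf_gt (R : realType) (u : nat -> \bar R) (b : \bar R) :
  (b < limn_einf u)%E -> \forall n \near \oo, (b < u n)%E.
Proof.
rewrite /limn_einf lteNr => /limn_esup_lt; apply: filterS => n.
by rewrite lteN2.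
Qed.

Lemma sum_lt_pairs (R : comNzRingType) n :
  2 * \sum_(i < n) \sum_(j < n | (i < j)%N) 1 = n%:R * (n%:R - 1) :> R.
Proof.
transitivity (2 * \sum_(i < n) \sum_(j < n | (i < j)%N) (i != j)%:R : R).
  congr (_ * _); apply: eq_bigr => i _; apply: eq_bigr => j ij.
  by rewrite (_ : (i != j) = true)// neq_ltn ij.
rewrite -(sum_sym_offdiag (F := fun i j : 'I_n => (i != j)%:R))/=; last 2 first.
- by move=> i j; rewrite eq_sym.
- by move=> i; rewrite eqxx.
transitivity (\sum_(i < n) (n%:R - 1 : R)); last by rewrite sumr_const card_ord mulr_natl.
apply: eq_bigr => i _; apply/esym/eqP; rewrite subr_eq; apply/eqP.
have -> : n%:R = \sum_(j < n) (1 : R) by rewrite sumr_const card_ord.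
rewrite (bigD1 i)//= [in RHS](bigD1 i)//= eqxx add0r addrC; congr (_ + _).
by apply: eq_bigr => j ji; rewrite eq_sym ji.
Qed.

Lemma limn_einf_gt0 (R : realType) (u : nat -> \bar R) : (0 < limn_einf u)%E ->
  exists2 b : R, 0 < b & \forall n \near \oo, (b%:E < u n)%E.
Proof.
move=> u0; have [b b0 bu] : exists2 b : R, 0 < b & (b%:E < limn_einf u)%E.
  case: (limn_einf u) u0 => [l|_|//]; last by exists 1; rewrite ?ltr01 ?ltry.
  by rewrite lte_fin => l0; exists (l / 2); rewrite ?lte_fin; lra.
by exists b => //; exact: limn_einf_gt.
Qed.

Theorem theorem2p11 (R : realType) (p r : R) (hp : 1 < p) (hpr : p <= r)
    (d : nat -> measure_display) (T : forall n, measurableType (d n))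
    (P : forall n, probability (T n) R)
    (a : forall n, 'I_n -> 'I_n -> {RV (P n) >-> R})
    (mu : nat -> R) (s : forall n, 'I_n -> 'I_n -> R) (sbar : nat -> R)
    (hi : assumption_i a mu s) (hii : assumption_ii s sbar)
    (hiii : assumption_iii mu sbar) (hiv : assumption_iv a mu sbar)
    (hsbar : (0 < limn_einf (fun n => (sbar n)%:E))%E) :
  cvg_in_distribution P
    (fun n w =>
       let Abar := n%:R `^ (- (p^-1 - r^-1)) *: \matrix_(i, j) a n i j w in
       n%:R / Num.sqrt (2 * sum_var s n)
         * (opnorm r p Abar - alpha s mu p r n))
    (normal_prob 0 (Num.sqrt 2)).
Proof.
have r0 : 0 < r by lra.
have mX n : measurable_fun setT (fun w =>
    let Abar := n%:R `^ (- (p^-1 - r^-1)) *: \matrix_(i, j) a n i j w in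
    n%:R / Num.sqrt (2 * sum_var s n) * (opnorm r p Abar - alpha s mu p r n)).
  apply: measurable_funM => //; apply: measurable_funB => //.
  by apply: measurable_opnorm => // i j; exact: measurable_funPT.
split=> // x _.
rewrite -[X in _ --> X]/(normal_prob 0 (Num.sqrt 2) `]-oo, x]%classic) gauss_cdfE; apply/fine_cvgP; split.
  apply: nearW => n; apply: fin_num_measure; rewrite -[X in measurable X]setTI.
  exact: (mX n measurableT _ (measurable_itv _)).
apply/cvgrPdist_le => eta eta0.
have [c [c0 Hc]] := hiv.
have [sb0 [c1 [c2 [c10 _ Hc1 _]]]] := hii.
have [/eqO_exP[M0 M00 HM0] mu_inf _ /eqO_exP[C C0 HC]] := hiii.
have [b b0 Hb] := limn_einf_gt0 hsbar.
have c12 : ((c1 / 2)%:E < c1%:E)%E by rewrite lte_fin; lra.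
have {}Hc1 := limn_einf_gt (lt_le_trans c12 Hc1).
move/cvgryPge: mu_inf => /(_ 1) mu_pos.
pose S := C * M0; have S0 : 0 <= S by rewrite mulr_ge0// ltW.
pose M := moment_bound c S.
have M_ge0 k : 0 <= M k by apply: moment_bound_ge0 => //; exact: ltW.
(* Eventually [b <= sbar n] and [sbar n ^+ 2 <= C * mu n]: a noise level bounded below forces the
   mean to be bounded below. *)
pose m0 := b ^+ 2 / C; have m00 : 0 < m0 by rewrite divr_gt0// exprn_gt0.
(* Each [s i j] is eventually at least [c1 / 2 * b], and there are [n (n - 1) / 2 >= n^2 / 4] pairs
   once [n >= 2]. *)
pose k0 := (c1 / 2 * b) ^+ 2 / 4.
have k00 : 0 < k0 by rewrite divr_gt0// exprn_gt0// mulr_gt0// divr_gt0.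
have [n0 H] := opnorm_clt x hp hpr m00 M00 (M_ge0 2) k00 M_ge0 eta0.
near=> n.
have n2 : (2 <= n)%N by near: n; exact: nbhs_infty_ge.
(* The denominator in the growth assumption is nonnegative, so a nonpositive mean would make the
   ratio nonpositive, while it is eventually at least 1. *)
have mu0 : 0 < mu n.
  rewrite ltNge; apply/negP => mu0; have : 1 <= mu n / (ln n%:R `^ (2 / 3) / n%:R `^ (1 / 3)).
    by near: n.
  by apply/negP; rewrite -ltNge; apply: le_lt_trans ltr01; rewrite mulr_le0_ge0// invr_ge0 divr_ge0 ?powR_ge0.
have muM : mu n <= M0.
  have : `|mu n| <= M0 * `|1 : R| by near: n.
  by rewrite normr1 mulr1; apply: le_trans; exact: ler_norm.
have sbC : sbar n ^+ 2 <= C * mu n.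
  have : `|sbar n ^+ 2 / mu n| <= C * `|1 : R| by near: n.
  by rewrite normr1 mulr1 => /(le_trans (ler_norm _)); rewrite ler_pdivrMr.
have sbS : sbar n ^+ 2 <= S by apply: le_trans sbC _; rewrite ler_pM2l.
have bs : b <= sbar n by rewrite -lee_fin; apply: ltW; near: n.
have mum : m0 <= mu n.
  rewrite ler_pdivrMr// mulrC; apply: le_trans sbC.
  by apply: lerXn2r; rewrite ?nnegrE ?(ltW b0) ?(ltW (sb0 n)).
have [asym adiag aind Ha] := hi n (ltnW n2).
have am (i j : 'I_n) : (i < j)%N ->
    [/\ P n [set w | a n i j w < 0] = 0%E, all_moments (P n) (fun w => a n i j w - mu n),
     \int[P n]_w (a n i j w - mu n) = 0,
     \int[P n]_w ((a n i j w - mu n) ^+ 2) = s n i j ^+ 2 &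
     forall k, \int[P n]_w (`|a n i j w - mu n| ^+ k) <= M k].
  move=> ij; have [h1 h2 _ h4] := Ha i j ij.
  apply: centered_moments => // [|k k3]; first exact: ltW.
  apply: le_trans (Hc n i j k ij k3) _; rewrite lee_fin ler_wpM2l//.
  by rewrite mulr_ge0 ?exprn_ge0 ?divr_ge0// ltW.
have Hmin : ((c1 / 2)%:E < \big[Order.min/+oo]_(e : 'I_n * 'I_n | (e.1 < e.2)%N)
    (s n e.1 e.2 / sbar n)%:E)%E by near: n.
have s_low (i j : 'I_n) : (i < j)%N -> 4 * k0 <= s n i j ^+ 2.
  move=> ij; rewrite /k0 mulrC divfK//.
  have c1s : c1 / 2 <= s n i j / sbar n.
    rewrite -lee_fin; apply: le_trans (ltW Hmin) _.
    exact: (@bigmin_le_cond _ _ _ _ (i, j)).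
  have c1b : c1 / 2 * b <= s n i j.
    move: c1s; rewrite ler_pdivlMr//; apply: le_trans.
    by rewrite ler_wpM2l// divr_ge0// ltW.
  have cb0 : 0 <= c1 / 2 * b by rewrite mulr_ge0 ?divr_ge0// ltW.
  by apply: lerXn2r; rewrite ?nnegrE// (le_trans cb0).
have s_up (i j : 'I_n) : (i < j)%N -> s n i j ^+ 2 <= M 2.
  move=> /am[_ _ _ <- /(_ 2)]; congr (_ <= _).
  by apply: eq_Rintegral => w _; rewrite real_normK// num_real.
have V_bounds : k0 * n%:R ^+ 2 <= sum_var s n <= M 2 * n%:R ^+ 2.
  have n2R : 2 <= n%:R :> R by rewrite ler_nat.
  apply/andP; split.
    apply: (@le_trans _ _ (4 * k0 * \sum_(i < n) \sum_(j < n | (i < j)%N) 1)); last first.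
      rewrite mulr_sumr; apply: ler_sum => i _; rewrite mulr_sumr; apply: ler_sum => j ij.
      by rewrite mulr1 s_low.
    rewrite (_ : 4 * k0 * _ = 2 * k0 * (2 * \sum_(i < n) \sum_(j < n | (i < j)%N) 1)); last by ring.
    rewrite sum_lt_pairs (_ : 2 * k0 * _ = k0 * (n%:R * (2 * (n%:R - 1)))); last by ring.
    by rewrite ler_pM2l// expr2 ler_wpM2l//; move: n2R; clear; lra.
  apply: (@le_trans _ _ (\sum_(i < n) \sum_(j < n) M 2)).
    apply: ler_sum => i _; rewrite big_mkcond/=; apply: ler_sum => j _.
    by case: ifP => // ij; exact: s_up.
  by rewrite !sumr_const !card_ord -mulrnA -[leLHS]mulr_natr natrM expr2.
rewrite distrC; apply: H => //; last by rewrite mum.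
by near: n; exact: nbhs_infty_ge.
Unshelve. all: by end_near.
Qed.
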